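(* Let $n\ge2$. Every generalized cusp $C$ of dimension $n$ with boundary a horomanifold has a hyperbolic metric $\kappa(C)$ such that $\partial C$ is the quotient of a horosphere in $\mathbb H^n$; and these metrics have the property that if $C'$ is another such cusp, and if $P:C\to C'$ is a projective diffeomorphism, then $P$ is an isometry from $\kappa(C)$ to $\kappa(C')$.
   Context: A subset $\Omega\subset\mathbb{RP}^n$ is properly convex if its intersection with every projective line is connected and omits at least two points; $\partial\Omega=\Omega\setminus\operatorname{int}\Omega$. A generalized cusp is a properly convex manifold $C=\Omega/\Gamma$ ($\Gamma\subset\mathrm{PGL}(n+1,\mathbb R)$ discrete, acting freely, preserving $\Omega$) with $\Gamma$ virtually abelian, $\partial C=\partial\Omega/\Gamma$ compact, connected and strictly convex ($\partial\Omega$ contains no line segment), and $C$ diffeomorphic to $\partial C\times[0,\infty)$. $A=\{\psi\in\mathrm{Hom}(\mathbb R^n,\mathbb R): \psi_i:=\psi(e_i),\ \psi_1\ge\cdots\ge\psi_n\ge 0\}$. For $\psi\in A$ the type is $\mathbf t=|\{i:\psi_i>0\}|$; $V_\psi=\mathbb R_+^{\mathbf t}\times\mathbb R^{n-\mathbf t}$ with $\mathbb R_+=(0,\infty)$; $h_\psi:V_\psi\to\mathbb R$ is $$h_\psi(x)=-x_{\mathbf t+1}-\sum_{i=1}^{\mathbf t}\psi_i\log x_i+\tfrac12\sum_{i=\mathbf t+2}^n x_i^2\ (\mathbf t<n),\qquad h_\psi(x)=-\Big(\sum_{i=1}^n\psi_i\Big)^{-1}\sum_{i=1}^n\psi_i\log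 x_i\ (\mathbf t=n).$$ $\Omega(\psi)=h_\psi^{-1}((-\infty,0])\subset\mathbb R^n\subset\mathbb{RP}^n$ via $x\mapsto[x_1:\cdots:x_n:1]$. The level sets of $h_\psi$ are horospheres and $G(\psi)\subset\mathrm{PGL}(n+1,\mathbb R)$ is the subgroup preserving each of them. A $\psi$-cusp is $\Omega(\psi)/\Gamma$ with $\Gamma\subset G(\psi)$ a torsion-free lattice (discrete and cocompact subgroup). A horomanifold is the image of a horosphere in such a quotient. A generalized cusp has boundary a horomanifold if, up to projective diffeomorphism, it is $h_\psi^{-1}((-\infty,t])/\Gamma$ for some $\psi\in A$, $t\in\mathbb R$ and torsion-free lattice $\Gamma\subset G(\psi)$ (this is projectively diffeomorphic to the $\psi$-cusp $\Omega(\psi)/\Gamma$). *)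

(* Defs.v *)
From mathcomp Require Import all_boot all_order all_algebra.
From mathcomp Require Import all_classical all_reals all_analysis.

Set Implicit Arguments.
Unset Strict Implicit.
Unset Printing Implicit Defensive.

Import Order.TTheory GRing.Theory Num.Theory numFieldNormedType.Exports.

Local Open Scope classical_set_scope.
Local Open Scope ring_scope.

(* Conventions.
   - A subset of RP^n is represented by the set of all nonzero vectors of
     R^(n+1) spanning one of its points; a subset of PGL(n+1,R) is represented
     by the set of all invertible matrices representing one of its elements.
     Since both projections are open quotient maps, topological notions in
     RP^n and PGL(n+1,R) are those of the saturated sets upstairs.
   - A tangent vector of RP^n at [x] is a vector of R^(n+1) modulo R x, and
     (x, u), (c x, c u) represent the same tangent vector for c != 0. *)

Section QuotientTopology.
Context {T : topologicalType}.
Implicit Types (X W : set T) (E : T -> T -> Prop).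

(* The open sets of the quotient X / E, seen as E-saturated relatively open
   subsets of X. *)
Definition sat_open X E W : Prop :=
  (exists2 O, open O & W = X `&` O) /\
  (forall x y, W x -> X y -> E x y -> W y).

Definition compact_mod X E : Prop :=
  forall F : set (set T), (forall W, F W -> sat_open X E W) ->
    X `<=` \bigcup_(W in F) W ->
    exists F', [/\ finite_set F', F' `<=` F & X `<=` \bigcup_(W in F') W].

Definition connected_mod X E : Prop :=
  forall W1 W2, sat_open X E W1 -> sat_open X E W2 ->
    W1 `|` W2 = X -> W1 `&` W2 = set0 -> W1 = set0 \/ W2 = set0.

End QuotientTopology.

Section Smoothness.
Context {R : realType} {V W : normedModType R}.

Fixpoint Ck_on (k : nat) (U : set V) (f : V -> W) : Prop :=
  if k is k'.+1 then
    (forall x, U x -> differentiable f x) /\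
    (forall v, Ck_on k' U (fun x => 'D_v f x))
  else forall x, U x -> {for x, continuous f}.

Definition smooth_open (U : set V) (f : V -> W) : Prop :=
  open U /\ forall k, Ck_on k U f.

(* Smoothness on an arbitrary subset (e.g. a domain with boundary): existence
   of local smooth extensions. *)
Definition smooth_on (X : set V) (f : V -> W) : Prop :=
  forall x, X x -> exists U F,
    [/\ U x, smooth_open U F & forall y, X y -> U y -> F y = f y].

End Smoothness.

Section ProjectiveGeometry.
Context {R : realType} {n : nat}.
Local Notation vec := 'cV[R]_n.+1.
Local Notation mat := 'M[R]_n.+1.
Implicit Types (Omega X : set vec) (Gamma G : set mat) (x y u v : vec).

Definition peq x y : Prop := exists2 c : R, c != 0 & y = c *: x.

Definition proj_set Omega : Prop :=
  ~ Omega 0 /\ forall x y, Omega x -> peq x y -> Omega y.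

Definition indep u v : Prop :=
  forall a b : R, a *: u + b *: v = 0 -> a = 0 /\ b = 0.

Definition proj_line u v : set vec :=
  [set x | x != 0 /\ exists a b : R, x = a *: u + b *: v].

Definition properly_convex Omega : Prop :=
  proj_set Omega /\
  forall u v, indep u v ->
    connected_mod (Omega `&` proj_line u v) peq /\
    exists p q, [/\ proj_line u v p, proj_line u v q, ~ peq p q,
                    ~ Omega p & ~ Omega q].

Definition bd Omega : set vec := Omega `\` interior Omega.

Definition no_segment X : Prop :=
  forall u v, indep u v ->
    ~ (forall s : R, 0 <= s <= 1 -> X ((1 - s) *: u + s *: v)).

Definition preserves (A : mat) X : Prop := [set A *m x | x in X] = X.

Definition pgl_subgroup Gamma : Prop :=
  [/\ Gamma `<=` [set A | A \in unitmx],
      Gamma 1%:M,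
      forall A B, Gamma A -> Gamma B -> Gamma (A *m B),
      forall A, Gamma A -> Gamma (invmx A)
    & forall (c : R) A, c != 0 -> Gamma A -> Gamma (c *: A)].

Definition discrete_in_pgl Gamma : Prop :=
  forall A, Gamma A -> exists2 U : set mat, open U /\ U A &
    forall B, Gamma B -> U B -> exists2 c : R, c != 0 & B = c *: A.

Definition torsion_free Gamma : Prop :=
  forall A (k : nat), Gamma A -> (0 < k)%N ->
    is_scalar_mx (A ^+ k) -> is_scalar_mx A.

Definition acts_freely Gamma Omega : Prop :=
  forall A x, Gamma A -> Omega x -> peq x (A *m x) -> is_scalar_mx A.

(* Abelian in PGL: representatives commute up to a scalar. *)
Definition virtually_abelian Gamma : Prop :=
  exists H : set mat, [/\ pgl_subgroup H, H `<=` Gamma,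
    forall A B, H A -> H B -> exists2 c : R, c != 0 & A *m B = c *: (B *m A)
  & exists2 s : set mat, finite_set s /\ s `<=` Gamma &
      forall A, Gamma A -> exists B D, [/\ s B, H D & A = B *m D]].

Definition lattice_in G Gamma : Prop :=
  [/\ pgl_subgroup Gamma, Gamma `<=` G, discrete_in_pgl Gamma
    & compact_mod G (fun A B => exists2 D, Gamma D & B = A *m D)].

(* As Gamma contains the nonzero scalar matrices, this is the relation of
   lying in the same Gamma-orbit of RP^n. *)
Definition orb Gamma x y : Prop := exists2 A, Gamma A & y = A *m x.

End ProjectiveGeometry.

(* The quotient dom / grp. *)
Record proj_quotient (R : realType) (n : nat) := ProjQuotient {
  dom : set 'cV[R]_n.+1;
  grp : set 'M[R]_n.+1 }.

Section Cusps.
Context {R : realType} {n : nat}.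
Local Notation vec := 'cV[R]_n.+1.
Local Notation mat := 'M[R]_n.+1.
Local Notation quo := (proj_quotient R n).
Implicit Types (C : quo) (Omega : set vec).

(* C is diffeomorphic to (boundary of C) x [0,oo).  As dom C is simply
   connected, such a diffeomorphism and its inverse lift to smooth maps F, G
   between bd (dom C) x [0,oo) and dom C, inverse to each other modulo grp C. *)
Definition diffeo_to_collar C : Prop :=
  let collar := [set p : vec * R^o | bd (dom C) p.1 /\ 0 <= p.2] in
  let collar_eq (p q : vec * R^o) := orb (grp C) p.1 q.1 /\ p.2 = q.2 in
  exists (F : vec * R^o -> vec) (G : vec -> vec * R^o),
  [/\ smooth_on collar F /\ smooth_on (dom C) G,
      (forall p, collar p -> dom C (F p)) /\
      (forall x, dom C x -> collar (G x)),
      forall p q, collar p -> collar q -> collar_eq p q ->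
        orb (grp C) (F p) (F q),
      forall x y, dom C x -> dom C y -> orb (grp C) x y ->
        collar_eq (G x) (G y)
    & (forall p, collar p -> collar_eq p (G (F p))) /\
      (forall x, dom C x -> orb (grp C) x (F (G x)))].

Definition generalized_cusp C : Prop :=
  [/\ properly_convex (dom C),
      [/\ pgl_subgroup (grp C), discrete_in_pgl (grp C),
          acts_freely (grp C) (dom C)
        & forall A, grp C A -> preserves A (dom C)],
      virtually_abelian (grp C),
      [/\ compact_mod (bd (dom C)) (orb (grp C)),
          connected_mod (bd (dom C)) (orb (grp C))
        & no_segment (bd (dom C))]
    & diffeo_to_collar C].

(* Maps between quotients are given by set-theoretic representatives
   P : dom C -> dom C', only meaningful modulo grp C'. *)
Definition local_lift C C' (P : vec -> vec) (U : set vec) (A : mat) : Prop :=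
  [/\ open U, A \in unitmx
    & forall y, dom C y -> U y -> orb (grp C') (P y) (A *m y)].

Definition projective_map C C' (P : vec -> vec) : Prop :=
  [/\ forall x, dom C x -> dom C' (P x),
      forall x y, dom C x -> dom C y -> orb (grp C) x y ->
        orb (grp C') (P x) (P y)
    & forall x, dom C x -> exists2 U : set vec, U x &
        exists A, local_lift C C' P U A].

Definition projective_diffeo C C' (P : vec -> vec) : Prop :=
  projective_map C C' P /\
  exists2 Q, projective_map C' C Q &
    (forall x, dom C x -> orb (grp C) x (Q (P x))) /\
    (forall y, dom C' y -> orb (grp C') y (P (Q y))).

(* A row vector psi is the linear form x |-> psi *m x, so psi_(i+1) is
   psi 0 i for i : 'I_n. *)
Implicit Types (psi : 'rV[R]_n).

Definition in_A psi : Prop :=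
  (forall i, 0 <= psi 0 i) /\
  (forall i j : 'I_n, (i <= j)%N -> psi 0 j <= psi 0 i).

Definition cusp_type psi : nat := #|[set i : 'I_n | 0 < psi 0 i]%SET|.

Definition V_ psi : set 'cV[R]_n :=
  [set x | forall i : 'I_n, (i < cusp_type psi)%N -> 0 < x i 0].

(* Indices are shifted by one: x_(t+1) is the entry of index t. *)
Definition h_ psi (x : 'cV[R]_n) : R :=
  let t := cusp_type psi in
  if (t < n)%N then
    - (\sum_(i < n | i == t :> nat) x i 0)
    - \sum_(i < n | (i < t)%N) psi 0 i * ln (x i 0)
    + 2^-1 * \sum_(i < n | (t < i)%N) x i 0 ^+ 2
  else
    - (\sum_(i < n) psi 0 i)^-1 * \sum_(i < n) psi 0 i * ln (x i 0).

(* [x_1 : ... : x_n : 1] *)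
Definition affine (x : 'cV[R]_n) : vec :=
  \col_i (if unlift ord_max i is Some j then x j 0 else 1).

Definition to_proj (X : set 'cV[R]_n) : set vec :=
  [set v | exists2 x, X x & peq (affine x) v].

Definition horosphere_psi psi (s : R) : set vec :=
  to_proj [set x | V_ psi x /\ h_ psi x = s].

Definition sublevel_psi psi (s : R) : set vec :=
  to_proj [set x | V_ psi x /\ h_ psi x <= s].

Definition G_ psi : set mat :=
  [set A | A \in unitmx /\ forall s, preserves A (horosphere_psi psi s)].

Definition boundary_horomanifold C : Prop :=
  exists psi s (Gamma : set mat),
  [/\ in_A psi, lattice_in (G_ psi) Gamma, torsion_free Gamma
    & exists P, projective_diffeo C (ProjQuotient (sublevel_psi psi s) Gamma) P].

End Cusps.

Section HyperbolicMetrics.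
Context {R : realType} {n : nat}.
Local Notation vec := 'cV[R]_n.+1.
Local Notation mat := 'M[R]_n.+1.
Local Notation quo := (proj_quotient R n).
(* g x u v is the inner product of the tangent vectors (x, u) and (x, v). *)
Local Notation tensor := (vec -> vec -> vec -> R).
Implicit Types (C : quo) (g : tensor).

(* A Riemannian metric on C, i.e. a grp C-invariant one on dom C. *)
Definition riemannian_metric C g : Prop :=
  [/\ forall x, dom C x -> forall u v, g x u v = g x v u,
      forall x, dom C x -> forall (a : R) u v w,
        g x (a *: u + v) w = a * g x u w + g x v w,
      forall x, dom C x -> (forall u, g x x u = 0) /\
        (forall u, (forall c : R, u != c *: x) -> 0 < g x u u),
      forall A x u v, grp C A -> dom C x ->
        g (A *m x) (A *m u) (A *m v) = g x u v
    & forall u v, smooth_on (dom C) (fun x => g x u v : R^o)].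

Definition lorentz (u v : vec) : R :=
  \sum_(i < n) u (lift ord_max i) 0 * v (lift ord_max i) 0
  - u ord_max 0 * v ord_max 0.

(* The hyperboloid model; the hyperbolic metric is the restriction of the
   Lorentz form to tangent spaces. *)
Definition hyperbolic_space : set vec :=
  [set v | lorentz v v = -1 /\ 0 < v ord_max 0].

Definition lorentz_isometry (B : mat) : Prop :=
  (forall u v, lorentz (B *m u) (B *m v) = lorentz u v) /\
  preserves B hyperbolic_space.

Definition horosphere (S : set vec) : Prop :=
  exists l : vec, [/\ lorentz l l = 0, 0 < l ord_max 0
    & S = hyperbolic_space `&` [set v | lorentz v l = -1]].

(* f is a smooth map from (the image in RP^n of) X to hyperbolic space pulling
   the hyperbolic metric back to g. *)
Definition isometric_on (X : set vec) g (f : vec -> vec) : Prop :=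
  [/\ forall x, X x -> hyperbolic_space (f x),
      forall x y, X x -> X y -> peq x y -> f x = f y
    & forall x, X x -> exists U F, [/\ U x, smooth_open U F,
        forall y, X y -> U y -> F y = f y
      & forall y, X y -> U y -> forall u v,
          lorentz ('D_u F y) ('D_v F y) = g y u v]].

Definition hyperbolic_metric C g : Prop :=
  riemannian_metric C g /\
  forall x, dom C x -> exists2 U : set vec, open U /\ U x &
    exists f, isometric_on (dom C `&` U) g f.

(* The boundary of C is the quotient of a horosphere S: some developing map of
   (C, g) restricts to a bijection from bd (dom C) to S and conjugates the
   action of grp C to an action by isometries of hyperbolic space
   preserving S. *)
Definition boundary_horosphere_quotient C g : Prop :=
  exists (f : vec -> vec) (S : set vec),
  [/\ isometric_on (dom C) g f,
      horosphere S,
      [set f x | x in bd (dom C)] = S,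
      forall x y, bd (dom C) x -> bd (dom C) y -> f x = f y -> peq x y
    & forall A, grp C A -> exists B,
        [/\ lorentz_isometry B, preserves B S
          & forall x, dom C x -> f (A *m x) = B *m f x]].

(* Near a point where P lifts to the projective map A, its derivative sends
   (x, u) to (A x, A u). *)
Definition projective_isometry C C' g g' (P : vec -> vec) : Prop :=
  forall U A, local_lift C C' P U A ->
    forall x, dom C x -> U x -> forall u v,
      g' (A *m x) (A *m u) (A *m v) = g x u v.

End HyperbolicMetrics.

(* Main.v *)
Require Import Defs.
From HB Require Import structures.
From mathcomp Require Import all_boot all_order all_algebra.
From mathcomp Require Import all_classical all_reals all_analysis.
From mathcomp Require Import ring lra.

Set Implicit Arguments.
Unset Strict Implicit.
Unset Printing Implicit Defensive.

Import Order.TTheory GRing.Theory Num.Theory numFieldNormedType.Exports.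

Local Open Scope classical_set_scope.
Local Open Scope ring_scope.

(* On the chart of Omega(psi), let h be the horofunction, normalised so that
   the boundary is h = s, and put a = exp (h - s).  Logarithms turn each
   horosphere into a flat R^(n-1) with coordinates Y, orthogonal to a unit
   vector u, and
     F = (a Y + k u, k + a),   2 k = (1 + a^2 |Y|^2) / a - a,
   maps the chart to the hyperboloid and pulls the hyperbolic metric back to
   dh^2 + a^2 |dY|^2.  The boundary goes to the horosphere a = 1 with null
   normal (u, 1).

   A projective automorphism of Omega(psi) permutes the extreme directions of
   its cone, from which it multiplies h - s by some c > 0 and acts on Y by a
   similarity of ratio sqrt c, with c = 1 when the type is positive.  For the
   parabolic type 0 it also has c = 1 as soon as it normalises a lattice: a
   contraction would accumulate infinitely many lattice elements in a compact
   set.  Hence the automorphisms of a psi-cusp are isometries.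

   By Baire category a map that lies, at each point of an open set, in the
   orbit of a discrete group is an element of this group.  So local projective
   lifts of a map between cusps agree modulo the group, and a projective
   diffeomorphism lifts to one matrix conjugating the groups.  The metric of C
   is transported from a model psi-cusp which is chosen as a function of the
   set of all models of C only; two isomorphic cusps then use the same model,
   and their metrics differ by an automorphism of it. *)

(** * Smoothness of composite functions *)

(** In F the number a is minus the Lorentz product with the null vector (u, 1), and k is then forced
    by the equation <F, F> = -1; dh^2 + a^2 |dY|^2 is the warped product form of the hyperbolic
    metric. The metric of a model is not determined by the projective class of its domain. For 0 < t
    < n, scaling x_(t+1) by lambda and the later coordinates by sqrt lambda carries the domain of
    psi / lambda to that of psi and multiplies the horofunction by lambda, so the two metrics do not
    correspond. Hence the choice of one model per isomorphism class, after which everything rests on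
    the automorphisms of a single model. The other obstacle is that a map of quotients is an
    arbitrary choice of representatives, and that the domain of a generalized cusp is only known to
    be properly convex. A diffeomorphism between a cusp and a model is therefore lifted from the
    model side, where points can be joined by segments and approximated by interior points. That the
    lift fills the domain of the cusp then follows from the connectedness of its line sections. *)

Section Locality.
Context {R : realType} {V W : normedModType R}.

(** The remainder in k (x + y) = k x + 0 + o(y) vanishes identically near 0. This makes
    differentiability a local notion. *)
Lemma near0_diff (k : V -> W) x : (\near x, k x = 0) -> differentiable k x.
Proof.
move=> k0.
have kx : k x = 0 by exact: nbhs_singleton k0.
have ek : k \o shift x = cst (k x) + (\0 : V -> W) +o_ 0 id.
  apply/eqaddoP => _/posnumP[e].
  have : \forall y \near 0, k (y + x) = 0.
    by have := k0; rewrite (near_shift 0); apply: filterS => y /=; rewrite subr0.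
  apply: filterS => y /= ky.
  by rewrite !fctE /= ky kx addr0 subr0 normr0 mulr_ge0.
have c0 : continuous (\0 : V -> W) by move=> y; exact: cvg_cst.
have dk : 'd k x = (\0 : V -> W) :> (V -> W) by exact: diff_unique.
by apply/diff_locallyP; rewrite dk.
Qed.

Lemma near_eq_differentiable (f g : V -> W) x :
  (\near x, f x = g x) -> differentiable f x -> differentiable g x.
Proof.
move=> fg df; have -> : g = f + (g - f) by rewrite addrC subrK.
apply: differentiableD => //; apply: near0_diff.
by apply: filterS fg => y; rewrite !fctE => ->; rewrite subrr.
Qed.

End Locality.

Section CkOn.
Context {R : realType} {V : normedModType R}.
Implicit Types (U : set V).

(** As U is open, equality on U is equality near each of its points, so the derivatives agree on U
    too and the induction applies to them. *)
Lemma Ck_on_eq (W : normedModType R) k U (f g : V -> W) : open U ->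
  (forall x, U x -> f x = g x) -> Ck_on k U f -> Ck_on k U g.
Proof.
move=> oU; elim: k f g => [|k IH] f g fg /=.
  move=> cf x Ux; rewrite /prop_for /continuous_at -(fg _ Ux).
  apply: cvg_trans (cf x Ux); apply: near_eq_cvg.
  by apply: filterS (open_nbhs_nbhs (conj oU Ux)) => y /fg.
have nfg x : U x -> \near x, f x = g x.
  by move=> Ux; apply: filterS (open_nbhs_nbhs (conj oU Ux)) => y /fg ->.
move=> [df Df]; split=> [x Ux|v].
  exact: near_eq_differentiable (nfg _ Ux) (df _ Ux).
by apply: IH (Df v) => x Ux; apply: near_eq_derive; exact: nfg.
Qed.

Lemma Ck_on_pred (W : normedModType R) k U (f : V -> W) :
  Ck_on k.+1 U f -> Ck_on k U f.
Proof.
elim: k f => [|k IH] f [df Df]; first by move=> x /df /differentiable_continuous.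
by split=> // v; apply: IH; exact: Df.
Qed.

Lemma Ck_on_cst (W : normedModType R) k U (a : W) : open U -> Ck_on k U (cst a).
Proof.
move=> oU; elim: k a => [|k IH] a; first by move=> x _; exact: cvg_cst.
split=> [x _|v]; first exact: differentiable_cst.
by apply: Ck_on_eq (IH 0) => // x _; rewrite derive_cst.
Qed.

Lemma Ck_on_linear (W : normedModType R) k U (f : {linear V -> W}) :
  open U -> continuous f -> Ck_on k U f.
Proof.
move=> oU cf; case: k => [|k]; first by move=> x _; exact: cf.
split=> [x _|v]; first exact: linear_differentiable.
apply: Ck_on_eq (Ck_on_cst k (f v) oU) => // x _.
by rewrite deriveE ?diff_lin//; exact: linear_differentiable.
Qed.

Lemma Ck_on_add (W : normedModType R) k U (f g : V -> W) : open U ->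
  Ck_on k U f -> Ck_on k U g -> Ck_on k U (f + g).
Proof.
move=> oU; elim: k f g => [|k IH] f g.
  by move=> cf cg x Ux; apply: cvgD; [exact: cf|exact: cg].
move=> [df Df] [dg Dg]; split=> [x Ux|v].
  by apply: differentiableD; [exact: df|exact: dg].
apply: Ck_on_eq (IH _ _ (Df v) (Dg v)) => // x Ux.
by rewrite deriveD//; apply: diff_derivable; [exact: df|exact: dg].
Qed.

Lemma Ck_on_sum (W : normedModType R) k U (I : Type) (r : seq I) (P : pred I)
    (f : I -> V -> W) : open U ->
  (forall i, P i -> Ck_on k U (f i)) -> Ck_on k U (\sum_(i <- r | P i) f i).
Proof.
move=> oU fC; elim/big_ind : _ => //; first exact: Ck_on_cst.
by move=> g h; exact: Ck_on_add.
Qed.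

Lemma Ck_on_scale (W : normedModType R) k U (f : V -> R^o) (w : W) : open U ->
  Ck_on k U f -> Ck_on k U (fun x => f x *: w).
Proof.
move=> oU; elim: k f => [|k IH] f.
  by move=> cf x Ux; apply: cvgZr_tmp; exact: cf.
move=> [df Df]; split=> [x Ux|v].
  apply: differentiableZl; exact: (df x Ux).
apply: Ck_on_eq (IH _ (Df v)) => // x Ux.
have dfx : differentiable (f : V -> R) x by exact: (df x Ux).
have dfw : differentiable (fun y => (f y : R) *: w) x by exact: differentiableZl.
by rewrite (deriveE _ dfw) diffZl//= (deriveE v dfx).
Qed.

Lemma Ck_on_mul k U (f g : V -> R^o) : open U ->
  Ck_on k U f -> Ck_on k U g -> Ck_on k U (fun x => f x * g x : R^o).
Proof.
move=> oU; elim: k f g => [|k IH] f g.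
  by move=> cf cg x Ux; apply: cvgM; [exact: cf|exact: cg].
move=> Cf Cg; have [df Df] := Cf; have [dg Dg] := Cg; split=> [x Ux|v].
  by apply: differentiableM; [exact: df|exact: dg].
apply: Ck_on_eq (Ck_on_add _ (IH _ _ (Ck_on_pred Cf) (Dg v))
  (IH _ _ (Ck_on_pred Cg) (Df v))) => // x Ux.
by rewrite deriveM//; apply: diff_derivable; [exact: df|exact: dg].
Qed.

Lemma derive_comp1 (phi : R -> R) (f : V -> R) (x v : V) (c : R) :
  differentiable f x -> is_derive (f x) 1 phi c ->
  differentiable (phi \o f) x /\ 'D_v (phi \o f) x = c * 'D_v f x.
Proof.
move=> df dphi.
have dphi' : differentiable phi (f x) by apply/derivable1_diffP; exact: ex_derive.
have dc : differentiable (phi \o f) x by exact: differentiable_comp.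
split => //; rewrite !deriveE// diff_comp//= diff1E//=.
by rewrite derive1E derive_val mulrC.
Qed.

(** One step of regularity, shared by exp, ln and inversion: the derivative of phi o f is (psi o f)
    times that of f, so order k for psi o f gives order k + 1 for phi o f. *)
Lemma Ck_on_comp1 k U (phi psi : R -> R) (f : V -> R^o) : open U ->
  (forall x, U x -> is_derive (f x) 1 phi (psi (f x))) ->
  (Ck_on k U f -> Ck_on k U (psi \o f : V -> R^o)) ->
  Ck_on k.+1 U f -> Ck_on k.+1 U (phi \o f : V -> R^o).
Proof.
move=> oU dphi Cpsi Cf; have [df Df] := Cf; split=> [x Ux|v].
  by have [] := derive_comp1 0 (df _ Ux) (dphi _ Ux).
apply: Ck_on_eq (Ck_on_mul _ (Cpsi (Ck_on_pred Cf)) (Df v)) => // x Ux.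
by have [_ ->] := derive_comp1 v (df _ Ux) (dphi _ Ux).
Qed.

Lemma Ck_on_expR k U (f : V -> R^o) : open U -> Ck_on k U f ->
  Ck_on k U (expR \o f : V -> R^o).
Proof.
move=> oU; elim: k => [|k IH] Cf.
  by move=> x Ux; apply: (@continuous_comp _ _ _ f expR); [exact: Cf|exact: continuous_expR].
by apply: (@Ck_on_comp1 _ _ _ expR) Cf => // x _; exact: is_derive_expR.
Qed.

Lemma Ck_on_inv k U (f : V -> R^o) : open U -> (forall x, U x -> f x != 0) ->
  Ck_on k U f -> Ck_on k U (fun x => (f x)^-1 : R^o).
Proof.
move=> oU f0; elim: k => [|k IH] Cf.
  by move=> x Ux; apply: cvgV; [exact: f0|exact: Cf].
apply: (@Ck_on_comp1 _ _ _ (fun y => - (y^-1 * y^-1))) Cf => //.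
  move=> x Ux; apply: is_derive_eq (is_deriveV _ (is_derive_id _ _)) _.
    exact: f0.
  by rewrite scaler1 -exprVn expr2.
move=> /IH Cf.
apply: Ck_on_eq (Ck_on_scale (-1 : R^o) oU (Ck_on_mul oU Cf Cf)) => // x _.
by rewrite /= scalerN; congr (- _); exact: mulr1.
Qed.

Lemma Ck_on_ln k U (f : V -> R^o) : open U -> (forall x, U x -> 0 < f x) ->
  Ck_on k U f -> Ck_on k U (@ln R \o f : V -> R^o).
Proof.
move=> oU f0; case: k => [|k] Cf.
  by move=> x Ux; apply: (@continuous_comp _ _ _ f (@ln R)); [exact: Cf|exact/continuous_ln/f0].
apply: (@Ck_on_comp1 _ _ _ (fun y => y^-1)) Cf => //.
  by move=> x Ux; exact/is_derive1_ln/f0.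
by move=> Cf; apply: Ck_on_inv => // x /f0; rewrite lt0r => /andP[].
Qed.

Lemma derive_linear_comp (W W' : normedModType R) (L : {linear W -> W'})
    (f : V -> W) (x v : V) : continuous L -> differentiable f x ->
  'D_v (L \o f) x = L ('D_v f x).
Proof.
move=> cL df; have dL : differentiable L (f x) by exact: linear_differentiable.
have dLf : differentiable (L \o f) x by exact: differentiable_comp.
by rewrite (deriveE _ dLf) (diff_comp df dL)/= (deriveE _ df) (diff_lin _ cL).
Qed.

Lemma derive_comp_linear (V' W : normedModType R) (L : {linear V -> V'})
    (f : V' -> W) (x v : V) : continuous L -> differentiable f (L x) ->
  'D_v (f \o L) x = 'D_(L v) f (L x).
Proof.
move=> cL df; have dL : differentiable L x by exact: linear_differentiable.
have dfL : differentiable (f \o L) x by exact: differentiable_comp.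
rewrite (deriveE _ dfL) (deriveE _ df) (diff_comp dL df) /=.
by have -> : 'd L x v = L v by rewrite (diff_lin _ cL).
Qed.

Lemma Ck_on_linear_comp (W W' : normedModType R) k U (L : {linear W -> W'})
    (f : V -> W) : open U -> continuous L -> Ck_on k U f -> Ck_on k U (L \o f).
Proof.
move=> oU cL; elim: k f => [|k IH] f.
  by move=> cf q Uq; apply: continuous_comp; [exact: cf|exact: cL].
move=> [df Df]; split=> [q Uq|y].
  by apply: differentiable_comp; [exact: df|exact: linear_differentiable].
apply: Ck_on_eq (IH _ (Df y)) => // q Uq.
by rewrite (derive_linear_comp _ cL)//; exact: df.
Qed.

Lemma Ck_on_comp_linear (V' W : normedModType R) k (U' : set V') U
    (L : {linear V -> V'}) (f : V' -> W) : open U -> continuous L ->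
  (forall x, U x -> U' (L x)) -> Ck_on k U' f -> Ck_on k U (f \o L).
Proof.
move=> oU cL UU'; elim: k f => [|k IH] f.
  by move=> cf x Ux; apply: continuous_comp; [exact: cL|exact/cf/UU'].
move=> [df Df]; split=> [x Ux|v].
  apply: differentiable_comp; first exact: linear_differentiable.
  exact/df/UU'.
apply: Ck_on_eq (IH _ (Df (L v))) => // x Ux.
by rewrite /= (derive_comp_linear _ cL)//; exact/df/UU'.
Qed.

End CkOn.

(** * Discrete groups of projective maps *)

Section MatrixTopology.
Context {R : realType}.

Lemma mx_continuous_at (T : topologicalType) (m n : nat) (f : T -> 'M[R]_(m, n)) x :
  (forall i j, {for x, continuous (fun y => f y i j : R)}) -> {for x, continuous f}.
Proof.
move=> cf A [P xP PA].
have : \forall y \near x, forall i j, P i j (f y i j).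
  apply: filter_forall => i; apply: filter_forall => j.
  exact: cf (xP i j).
by apply: filterS => y; exact: PA.
Qed.

Lemma mulmx_continuous (m n p : nat) (A : 'M[R]_(m, n)) :
  continuous (mulmx A : 'M[R]_(n, p) -> 'M[R]_(m, p)).
Proof.
suff cA (x : 'M[R]_(n, p)) : {for x, continuous (mulmx A : 'M[R]_(n, p) -> _)} by [].
apply: mx_continuous_at => i j.
rewrite [X in {for _, continuous X}](_ : _ =
  (fun y : 'M[R]_(n, p) => \sum_k A i k * y k j)); last first.
  by apply/funext => y; rewrite mxE.
apply: (@cvg_big R^o _ _ _ _ _ _ (nbhs x)); first exact: add_continuous.
move=> k _; apply: (@cvgM _ _ (nbhs x)); last exact: coord_continuous.
exact: (@cvg_cst _ (A i k) _ (nbhs x)).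
Qed.

Lemma open_mulmx (n : nat) (A : 'M[R]_n) (U : set 'cV[R]_n) :
  open U -> open [set x | U (A *m x)].
Proof. by move=> oU; apply: open_comp => // x _; exact: mulmx_continuous. Qed.

Lemma open_line (V : normedModType R) (U : set V) (y v : V) : open U -> U y ->
  exists2 e : R, 0 < e & forall t, `|t| < e -> U (y + t *: v).
Proof.
move=> oU Uy.
have : {for (0 : R), continuous (fun t : R => y + t *: v)}.
  by apply: cvgD; [exact: cvg_cst|apply: cvgZr_tmp; exact: cvg_id].
move=> /(_ U); rewrite /= scale0r addr0 => /(_ (open_nbhs_nbhs (conj oU Uy))).
move=> /nbhs_ballP[e /= e0 eU]; exists e => // t te; apply: eU.
by rewrite -ball_normE /= sub0r normrN.
Qed.

Lemma interior_mulmx (n : nat) (A : 'M[R]_n) (X : set 'cV[R]_n) x :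
  A \in unitmx -> interior [set y | X (A *m y)] x <-> interior X (A *m x).
Proof.
move=> uA; rewrite /interior; split.
  rewrite nbhsE => -[U [oU Ux] UX].
  have := @open_mulmx n (invmx A) U oU.
  move=> oU'; rewrite nbhsE; exists [set y | U (invmx A *m y)].
    by split=> //=; rewrite mulKmx.
  by move=> y /= /UX /=; rewrite mulKVmx.
by move=> XA; exact: (@mulmx_continuous _ _ _ A x _ XA).
Qed.

End MatrixTopology.

Section DiscreteGroups.
Context {R : realType} {n : nat}.
Local Notation vec := 'cV[R]_n.+1.
Local Notation mat := 'M[R]_n.+1.
Implicit Types (A B D N : mat) (Gamma : set mat) (O : set vec).

(** The 2 x 2 minors of the pair (N y, y). For y nonzero they all vanish exactly when N y is
    proportional to y. *)
Definition comm_minor N (y : vec) i j : R :=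
  (N *m y) i 0 * y j 0 - (N *m y) j 0 * y i 0.

Lemma comm_minor_continuous N i j (y : vec) :
  {for y, continuous (fun y : vec => comm_minor N y i j : R^o)}.
Proof.
have cN k : {for y, continuous (fun y : vec => (N *m y) k 0)}.
  apply: (@continuous_comp _ _ _ (mulmx N) (fun y : vec => y k 0)).
    exact: mulmx_continuous.
  exact: coord_continuous.
have cy k : {for y, continuous (fun y : vec => y k 0)} by exact: coord_continuous.
apply: (@cvgB _ R^o _ (nbhs y)); apply: (@cvgM _ _ (nbhs y));
  by [exact: cN|exact: cy].
Qed.

(* The minors are quadratic along lines, so they vanish identically as soon as
   they vanish on an open set. *)
Lemma scalar_on_open N O : open O -> O !=set0 ->
  (forall y, O y -> forall i j, comm_minor N y i j = 0) -> is_scalar_mx N.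
Proof.
move=> oO [y Oy] Ny.
have N0 v i j : comm_minor N v i j = 0.
  have [e e0 eO] := open_line v oO Oy.
  (* The second difference of the minor over y - t v, y, y + t v is 2 t^2 times its value at v. *)
  pose t := e / 2; have t0 : t != 0 by rewrite mulf_neq0 ?gt_eqF.
  have te : `|t| < e by rewrite gtr0_norm ?divr_gt0// /t; lra.
  have e1 := Ny _ Oy i j; have e2 := Ny _ (eO _ te) i j.
  have : `|- t| < e by rewrite normrN.
  move=> /eO /Ny /(_ i j) e3.
  move: e1 e2 e3; rewrite /comm_minor !mulmxDr -!scalemxAr !mxE.
  move: (\sum_ _ _) (\sum_ _ _) (\sum_ _ _) (\sum_ _ _) => a b c d e1 e2 e3.
  apply/eqP; rewrite -(inj_eq (mulfI (mulf_neq0 t0 t0))) mulr0; apply/eqP.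
  lra.
have Nd i j : i != j -> N i j = 0.
  move=> ij; have := N0 (delta_mx j 0) i j.
  rewrite /comm_minor -colE !mxE !eqxx (negbTE ij) /=.
  by rewrite mulr1 mulr0 subr0.
have Ndiag i j : N i i = N j j.
  have [->//|ij] := eqVneq i j.
  have := N0 (delta_mx i 0 + delta_mx j 0) i j.
  rewrite /comm_minor mulmxDr -!colE !mxE !eqxx (eq_sym j i) (negbTE ij) /=.
  rewrite (Nd i j) // (Nd j i) 1?eq_sym //.
  by rewrite !(addr0, add0r, mulr1) => /eqP; rewrite subr_eq0 => /eqP.
apply/is_scalar_mxP; exists (N ord0 ord0); apply/matrixP => i j; rewrite !mxE.
by have [<-|ij] := eqVneq i j; [rewrite mulr1n; exact: Ndiag|rewrite mulr0n Nd].
Qed.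

(** An element is isolated, up to scalars, from the rest of Gamma at some precision, so a rational
    matrix and a precision suffice to name it; there are countably many such data. *)
Lemma discrete_countable Gamma : pgl_subgroup Gamma -> discrete_in_pgl Gamma ->
  exists2 D : nat -> mat, (forall k, Gamma (D k)) &
    forall A, Gamma A -> exists k, exists2 c : R, c != 0 & A = c *: D k.
Proof.
move=> [_ G1 _ _ _] dG.
pose near_rat (q : 'M[rat]_n.+1 * nat) : set mat :=
  [set B | forall i j, `|B i j - ratr (q.1 i j)| < q.2.+1%:R^-1].
pose rep q : set mat := [set A | Gamma A /\ forall B, Gamma B ->
  near_rat q B -> exists2 c : R, c != 0 & B = c *: A].
have rep1 A : Gamma A -> exists q, rep q A /\ near_rat q A.
  move=> GA; have [U [oU UA] UG] := dG A GA.
  have : nbhs A U by exact: open_nbhs_nbhs.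
  move=> /nbhs_ballP[e /= e0 eU].
  (* Two matrices close to the same rational matrix are within twice the precision of each other,
     whence 2 / (m + 1) < e. *)
  pose m := Num.truncn (2 / e).
  have m0 : 0 < m.+1%:R^-1 :> R by rewrite invr_gt0 ltr0n.
  have me : 2 * m.+1%:R^-1 < e.
    rewrite ltr_pdivrMr ?ltr0n// mulrC -ltr_pdivrMr//.
    exact: truncnS_gt.
  have q_ (i j : 'I_n.+1) : exists q : rat, `|A i j - ratr q| < m.+1%:R^-1.
    have [q] := @rat_in_itvoo R (A i j) (A i j + m.+1%:R^-1) (ltr_pwDr m0 (lexx _)).
    rewrite in_itv /= => /andP[q1 q2]; exists q.
    move: q1 q2 m0; move: (ratr q : R) (m.+1%:R^-1 : R) => r d q1 q2 d0.
    by rewrite ltr_norml; apply/andP; split; lra.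
  pose Q : 'M[rat]_n.+1 := \matrix_(i, j) sval (cid (q_ i j)).
  have QA i j : `|A i j - ratr (Q i j)| < m.+1%:R^-1.
    by rewrite mxE; case: cid.
  exists (Q, m); split => //; split=> // B GB QB; apply: UG => //; apply: eU.
  split=> // i j; rewrite -ball_normE /=.
  have := QA i j; have := QB i j; rewrite /= !ltr_norml.
  move: me; move: (ratr (Q i j) : R) (m.+1%:R^-1 : R) => r d.
  by move=> ? /andP[? ?] /andP[? ?]; apply/andP; split; lra.
(* Codes that name no element yield the default [1%:M], which lies in Gamma. *)
exists (fun k => if unpickle k is Some q then
    xget 1%:M (rep q) else 1%:M).
  move=> k; case: unpickle => // q; case: xgetP => [A _ []|] //.
move=> A GA; have [q [qA qAA]] := rep1 A GA.
exists (pickle q); rewrite pickleK.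
by case: (xgetPex 1%:M (ex_intro (rep q) A qA)) => _; apply.
Qed.

Definition complete_vec : completeNormedModType R :=
  HB.pack_for (completeNormedModType R) vec
    (Uniform_isComplete.Build vec (@mx_complete _ _ _)).

(* A discrete group is countable modulo scalars, and each of its elements
   agrees with B, as a projective map, on a closed set. *)
Lemma discrete_baire Gamma B O : pgl_subgroup Gamma -> discrete_in_pgl Gamma ->
  B \in unitmx -> open O -> O !=set0 ->
  (forall y, O y -> orb Gamma y (B *m y)) -> Gamma B.
Proof.
move=> pG dG uB oO O0 OB; have [D GD DG] := discrete_countable pG dG.
have [Gu G1 GM GV GZ] := pG.
have uD k : D k \in unitmx by exact: Gu.
pose N k := invmx (D k) *m B.
(* The points where B and [D k] differ as projective maps. If no [N k] is scalar, these open sets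
   are all dense, and a point of O common to all of them contradicts the hypothesis on orbits. *)
pose F k : set vec := [set y | exists i j, comm_minor (N k) y i j != 0].
have [[k kN]|noscalar] := pselect (exists k, is_scalar_mx (N k)).
  have /is_scalar_mxP[c Nc] := kN.
  have BD : B = c *: D k.
    by rewrite -(mulKVmx (uD k) B) -/(N k) Nc mul_mx_scalar.
  rewrite BD; apply: GZ => //; apply/negP => /eqP c0.
  by move: uB; rewrite BD c0 scale0r unitmxE det0 unitr0.
exfalso; have := @Baire R complete_vec F.
have F_ k : open (F k) /\ dense (F k).
  split.
    rewrite openE => y [i [j Nij]].
    have : \forall z \near y, comm_minor (N k) z i j != 0.
      apply: (@comm_minor_continuous (N k) i j y [set x : R | x != 0]).
      by apply: open_nbhs_nbhs; split=> //; exact: open_neq.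
    by apply: filterS => z Nz; exists i, j.
  move=> W W0 oW; apply: contrapT => WF; apply: noscalar; exists k.
  apply: (scalar_on_open oW W0) => y Wy i j; apply/eqP; apply: contrapT => /negP Nij.
  by apply: WF; exists y; split => //; exists i, j.
move=> /(_ F_ O O0 oO)[y [Oy Fy]].
have [A GA BA] := OB y Oy; have [k [c c0 Ak]] := DG A GA.
have [i [j]] := Fy k Logic.I.
rewrite /comm_minor /N -mulmxA BA Ak -scalemxAl -scalemxAr mulKmx//.
by rewrite !mxE => /eqP; apply; ring.
Qed.

End DiscreteGroups.

(** * Horofunctions *)

Section LogEstimates.
Context {R : realType}.
Implicit Types (x y a b e C D : R).

Lemma ln_le_sub1 y : 0 < y -> ln y <= y - 1.
Proof.
move=> y0; have -> : ln y = ln (1 + (y - 1)) by rewrite addrC subrK.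
by apply: le_ln1Dx; rewrite ltrBrDl subrr.
Qed.

(** The slope e is free: along a ray the logarithmic part of the horofunction is beaten by any
    linear growth. *)
Lemma ln_sublinear_eps e x : 0 < e -> 0 < x -> ln x <= e * x - ln e.
Proof.
move=> e0 x0; have := ln_sublinear (mulr_gt0 e0 x0).
by rewrite lnM ?posrE// => h; rewrite lerBrDl ltW.
Qed.

(** Both logarithms lie below the tangent line of ln at the barycentre m, and the two linear
    corrections cancel. *)
Lemma ln_concave a x y : 0 <= a <= 1 -> 0 < x -> 0 < y ->
  a * ln x + (1 - a) * ln y <= ln (a * x + (1 - a) * y).
Proof.
move=> /andP[a0 a1] x0 y0; set m := a * x + (1 - a) * y.
have m0 : 0 < m.
  rewrite /m; have [a_gt0|] := ltP 0 a.
    by apply: ltr_pwDl; [exact: mulr_gt0|rewrite mulr_ge0 ?subr_ge0// ltW].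
  move=> aN; have -> : a = 0 by apply/eqP; rewrite eq_le aN a0.
  by rewrite mul0r add0r subr0 mul1r.
have lx : ln x <= ln m + (x / m - 1).
  rewrite -lerBlDl -ln_div ?posrE//; apply: ln_le_sub1.
  by rewrite divr_gt0.
have ly : ln y <= ln m + (y / m - 1).
  rewrite -lerBlDl -ln_div ?posrE//; apply: ln_le_sub1.
  by rewrite divr_gt0.
have b0 : 0 <= 1 - a by rewrite subr_ge0.
apply: le_trans (lerD (ler_wpM2l a0 lx) (ler_wpM2l b0 ly)) _.
rewrite le_eqVlt; apply/orP; left; apply/eqP.
have : m / m = 1 by rewrite divff// gt_eqF.
rewrite {1}/m mulrDl => e1.
transitivity (ln m + (a * x / m + (1 - a) * y / m - 1)); last by rewrite e1; ring.
by ring.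
Qed.

Lemma linear_ge0 a b : (forall r, 1 <= r -> 0 <= a + r * b) -> 0 <= b.
Proof.
move=> h; rewrite leNgt; apply/negP => b0.
have nb : 0 <= - b by rewrite oppr_ge0 ltW.
have := h (1 + `|a| / - b); rewrite lerDl divr_ge0// => /(_ isT).
rewrite mulrDl mul1r -mulrA invrN mulNr mulVf ?lt_eqF// mulrN1 => h1.
by have := ler_norm a; lra.
Qed.

Lemma quadratic_le_linear a b C D :
  (forall r, 0 <= r -> (a + r * b) ^+ 2 <= C + r * D) -> b = 0.
Proof.
move=> h; apply/eqP; rewrite -sqrf_eq0 eq_le sqr_ge0 andbT.
(* For r >= 1, all terms other than r^2 b^2 are at most r times this constant; divide by r. *)
rewrite -oppr_ge0; apply: (@linear_ge0 (`|C| + `|D| + 2 * `|a * b|)) => r r1.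
have r0 : 0 < r by apply: lt_le_trans r1.
rewrite -(pmulr_rge0 _ r0).
have := h r (ltW r0).
have h1 : C <= `|C| * r.
  by apply: le_trans (ler_norm C) _; rewrite ler_peMr.
have h2 : r * D <= r * `|D| by rewrite ler_pM2l// ler_norm.
have h3 : - (r * `|a * b|) <= r * (a * b).
  by rewrite -mulrN ler_pM2l// lerNl -normrN ler_norm.
have h4 : 0 <= a ^+ 2 by exact: sqr_ge0.
nra.
Qed.

End LogEstimates.

Section Horofunction.
Context {R : realType} {n : nat} (w : 'I_n -> R) (t : nat).
Implicit Types (x y v : 'I_n -> R) (i j k l : 'I_n) (s r : R).

(* The weights of [psi] are psi_i when t < n, and psi_i / (psi_1 + ... + psi_n)
   when t = n; with them [horo] covers both cases of [h_ psi]. *)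
Definition cusp_weights : Prop :=
  [/\ (t <= n)%N, forall i, 0 <= w i, forall i, (0 < w i) = (i < t)%N
    & t = n -> \sum_i w i = 1].

Definition posV x : Prop := forall i, (i < t)%N -> 0 < x i.

Definition horo x : R :=
  - (\sum_i w i * ln (x i)) - \sum_(i < n | i == t :> nat) x i
  + 2^-1 * \sum_(i < n | (t < i)%N) x i ^+ 2.

Definition upd x i r : 'I_n -> R := fun k => if k == i then r else x k.

Context (hw : cusp_weights).

Let w_ge0 i : 0 <= w i. Proof. by case: hw. Qed.
Let w_gt0 i : (0 < w i) = (i < t)%N. Proof. by case: hw. Qed.

Lemma weight0 i : (t <= i)%N -> w i = 0.
Proof.
move=> ti; apply/eqP; rewrite eq_le w_ge0 andbT leNgt w_gt0.
by rewrite ltnNge ti.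
Qed.

Lemma sum_horo_index (f : 'I_n -> R) i : i = t :> nat ->
  \sum_(k < n | k == t :> nat) f k = f i.
Proof.
by move=> it; rewrite (big_pred1 i)// => k; rewrite /= -it.
Qed.

Lemma horo_upd_log x i r : (i < t)%N ->
  horo (upd x i r) = horo x + w i * (ln (x i) - ln r).
Proof.
move=> it; rewrite /horo (bigD1 i)//= [in RHS](bigD1 i)//=.
have e1 : \sum_(k | k != i) w k * ln (upd x i r k) =
    \sum_(k | k != i) w k * ln (x k).
  by apply: eq_bigr => k ki; rewrite /upd (negbTE ki).
have e2 : \sum_(k < n | k == t :> nat) upd x i r k = \sum_(k < n | k == t :> nat) x k.
  apply: eq_bigr => k /eqP kt; rewrite /upd; case: eqP => // ki.
  by move: it; rewrite -kt ki ltnn.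
have e3 : \sum_(k : 'I_n | (t < k)%N) upd x i r k ^+ 2 =
    \sum_(k : 'I_n | (t < k)%N) x k ^+ 2.
  apply: eq_bigr => k kt; rewrite /upd; case: eqP => // ki.
  by move: kt; rewrite ki ltnNge (ltnW it).
by rewrite e1 e2 e3 {1}/upd eqxx; ring.
Qed.

Lemma horo_upd_lin x i r : i = t :> nat ->
  horo (upd x i r) = horo x + (x i - r).
Proof.
move=> it; rewrite /horo.
have e1 : \sum_k w k * ln (upd x i r k) = \sum_k w k * ln (x k).
  apply: eq_bigr => k _; rewrite /upd; case: eqP => // ->.
  by rewrite weight0 ?it// !mul0r.
have e3 : \sum_(k : 'I_n | (t < k)%N) upd x i r k ^+ 2 =
    \sum_(k : 'I_n | (t < k)%N) x k ^+ 2.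
  apply: eq_bigr => k kt; rewrite /upd; case: eqP => // ki.
  by move: kt; rewrite ki it ltnn.
rewrite e1 e3 !(sum_horo_index _ it) /upd eqxx; ring.
Qed.

Lemma posV_upd x i r : posV x -> ((i < t)%N -> 0 < r) -> posV (upd x i r).
Proof.
by move=> Vx r0 k kt; rewrite /upd; case: eqP => [ki|_]; [apply: r0; rewrite -ki|exact: Vx].
Qed.

(** Raising a coordinate of index l <= t lowers [horo] without bound, logarithmically for l < t and
    linearly for l = t. The other coordinates of a point of the domain can thus be prescribed. *)
Lemma horo_lower x l s : posV x -> (l <= t)%N ->
  exists2 r0, 0 < r0 & forall r, r0 <= r ->
    posV (upd x l r) /\ horo (upd x l r) <= s.
Proof.
move=> Vx; rewrite leq_eqVlt => /orP[/eqP lt|lt].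
  exists (1 + `|horo x + x l - s|); first by rewrite ltr_pwDl.
  move=> r r0; split; first by apply: posV_upd => //; rewrite lt ltnn.
  by rewrite horo_upd_lin//; have := ler_norm (horo x + x l - s); lra.
have wl : 0 < w l by rewrite w_gt0.
(* With [expR c] as coordinate l, [horo] takes exactly the value s. *)
pose c := ln (x l) + (horo x - s) / w l.
exists (expR c); first exact: expR_gt0.
move=> r cr; have r0 : 0 < r by exact: lt_le_trans (expR_gt0 _) cr.
split; first exact: posV_upd.
rewrite horo_upd_log//.
have : c <= ln r by rewrite -[c]expRK ler_ln ?posrE ?expR_gt0.
rewrite /c -lerBrDl ler_pdivrMr// => h.
by rewrite -lerBrDl; lra.
Qed.

(** These v are directions of recession: logarithms and the linear coordinate enter [horo] with a
    minus sign and can only grow, while the quadratic part is untouched. *)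
Lemma horo_mono x v : posV x -> (forall i, (i <= t)%N -> 0 <= v i) ->
  (forall j, (t < j)%N -> v j = 0) ->
  posV (fun i => x i + v i) /\ horo (fun i => x i + v i) <= horo x.
Proof.
move=> Vx v0 vj; split.
  by move=> i it; rewrite ltr_wpDr ?Vx// v0// ltnW.
rewrite /horo; apply: lerD; last first.
  by rewrite (eq_bigr (fun i => x i ^+ 2))// => j /vj ->; rewrite addr0.
apply: lerD; rewrite lerN2; apply: ler_sum => i.
  move=> _; have [it|ti] := ltnP i t; last by rewrite weight0// !mul0r.
  rewrite ler_wpM2l// ler_ln ?posrE ?Vx//.
    by rewrite lerDl v0// ltnW.
  by rewrite ltr_wpDr ?Vx// v0// ltnW.
by move=> /eqP it; rewrite lerDl v0// it.
Qed.

Lemma horo_convex a x y : 0 <= a <= 1 -> posV x -> posV y ->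
  posV (fun i => a * x i + (1 - a) * y i) /\
  horo (fun i => a * x i + (1 - a) * y i) <= a * horo x + (1 - a) * horo y.
Proof.
move=> a01 Vx Vy; have /andP[a0 a1] := a01.
have b0 : 0 <= 1 - a by rewrite subr_ge0.
split.
  move=> i it; have [a_gt0|] := ltP 0 a.
    by apply: ltr_pwDl; [exact/mulr_gt0/Vx|rewrite mulr_ge0// ltW// Vy].
  move=> aN; have -> : a = 0 by apply/eqP; rewrite eq_le aN a0.
  by rewrite mul0r add0r subr0 mul1r Vy.
rewrite /horo !mulrDr [leRHS]addrACA; apply: lerD; last first.
  rewrite !(mulrCA _ 2^-1) -mulrDr ler_pM2l ?invr_gt0// !mulr_sumr -big_split/=.
  apply: ler_sum => i _.
  have : 0 <= a * (1 - a) * (x i - y i) ^+ 2 by rewrite mulr_ge0 ?sqr_ge0// mulr_ge0.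
  by rewrite -subr_ge0; congr (_ <= _); ring.
rewrite [leRHS]addrACA; apply: lerD; last first.
  by rewrite !mulrN -opprD !mulr_sumr -big_split/=.
rewrite !mulrN -opprD lerN2 !mulr_sumr -big_split/=; apply: ler_sum => i _.
have [it|ti] := ltnP i t; last by rewrite weight0// !(mul0r, mulr0) addr0.
rewrite !(mulrCA _ (w i)) -mulrDr ler_wpM2l//.
by apply: ln_concave => //; [exact: Vx|exact: Vy].
Qed.

(** The logarithm is a barrier: on a bounded part of a sublevel set all other terms are bounded, so
    - w_i ln (x_i) is too and x_i stays away from 0. *)
Lemma horo_bounded_below (M s : R) : exists2 d : R, 0 < d &
  forall x, posV x -> horo x <= s -> (forall k, `|x k| <= M) ->
    forall i, (i < t)%N -> d <= x i.
Proof.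
pose C := `|s| + \sum_k w k * `|M| + \sum_(k < n | k == t :> nat) `|M|.
have C0 : 0 <= C by rewrite !addr_ge0// sumr_ge0// => k _; rewrite mulr_ge0.
(* All factors lie in ]0, 1], so the product is at most each single bound [expR (- C / w i)]. *)
pose d : R := \prod_(i < n | (i < t)%N) Num.min 1 (expR (- C / w i)).
have m01 i : 0 < Num.min 1 (expR (- C / w i)) <= 1.
  by rewrite lt_min ltr01 expR_gt0/= ge_min lexx.
exists d.
  by rewrite /d; apply: prodr_gt0 => i _; case/andP: (m01 i).
move=> x Vx hs xM i it; apply: (@le_trans _ _ (expR (- C / w i))).
  rewrite /d (bigD1 i)//=; apply: (@le_trans _ _ (Num.min 1 (expR (- C / w i)))).
    apply: ler_piMr; first by case/andP: (m01 i) => /ltW.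
    by apply: prodr_ile1 => k _; case/andP: (m01 k) => /ltW -> ->.
  by rewrite ge_min lexx orbT.
rewrite -[leRHS]lnK ?posrE ?Vx// ler_expR ler_pdivrMr ?w_gt0// mulrC.
have MM : M <= `|M| by exact: ler_norm.
have e1 : \sum_(k | k != i) w k * ln (x k) <= \sum_k w k * `|M|.
  rewrite [leRHS](bigD1 i)//= -[leLHS]add0r; apply: lerD.
    by rewrite mulr_ge0.
  apply: ler_sum => k _; have [kt|tk] := ltnP k t; last by rewrite weight0// !mul0r.
  rewrite ler_wpM2l// (le_trans (ltW (ln_sublinear _))) ?Vx//.
  by rewrite (le_trans (ler_norm _))// (le_trans (xM k)).
have e2 : \sum_(k < n | k == t :> nat) x k <= \sum_(k < n | k == t :> nat) `|M|.
  apply: ler_sum => k _.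
  by rewrite (le_trans (ler_norm _))// (le_trans (xM k)).
have e3 : 0 <= \sum_(k : 'I_n | (t < k)%N) x k ^+ 2.
  by apply: sumr_ge0 => k _; exact: sqr_ge0.
move: hs; rewrite /horo (bigD1 i)//=.
have := ler_norm s; rewrite /C; lra.
Qed.

End Horofunction.

(** * Homogeneous and affine coordinates *)

Section Coordinates.
Context {R : realType} {n : nat}.
Local Notation vec := 'cV[R]_n.+1.
Implicit Types (p q v : vec) (i : 'I_n).

(** [wo] is the last homogeneous coordinate and [co] the others: wo = 0 is the hyperplane at
    infinity, and [aff] gives the affine coordinates on its complement. *)
Definition co p i : R := p (lift ord_max i) 0.
Definition wo p : R := p ord_max 0.
Definition aff p i : R := co p i / wo p.

Lemma vec_ext p q : (forall i, co p i = co q i) -> wo p = wo q -> p = q.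
Proof.
move=> pq w; apply/colP => k; case: (unliftP ord_max k) => [i|] ->; last exact: w.
exact: pq.
Qed.

Definition mkv (x : 'I_n -> R) (r : R) : vec :=
  \col_k (if unlift ord_max k is Some i then x i else r).

Lemma co_mkv x r i : co (mkv x r) i = x i.
Proof. by rewrite /co mxE liftK. Qed.

Lemma wo_mkv x r : wo (mkv x r) = r.
Proof. by rewrite /wo mxE unlift_none. Qed.

Lemma co_comb (a : R) p q i : co (a *: p + q) i = a * co p i + co q i.
Proof. by rewrite /co !mxE. Qed.

Lemma wo_comb (a : R) p q : wo (a *: p + q) = a * wo p + wo q.
Proof. by rewrite /wo !mxE. Qed.

Lemma coD p q i : co (p + q) i = co p i + co q i. Proof. by rewrite /co mxE. Qed.
Lemma woD p q : wo (p + q) = wo p + wo q. Proof. by rewrite /wo mxE. Qed.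
Lemma coZ (a : R) p i : co (a *: p) i = a * co p i. Proof. by rewrite /co mxE. Qed.
Lemma woZ (a : R) p : wo (a *: p) = a * wo p. Proof. by rewrite /wo mxE. Qed.
Lemma co0 i : co 0 i = 0. Proof. by rewrite /co mxE. Qed.
Lemma wo0 : wo 0 = 0. Proof. by rewrite /wo mxE. Qed.

Lemma co_sum (I : Type) (r : seq I) (P : pred I) (f : I -> vec) i :
  co (\sum_(k <- r | P k) f k) i = \sum_(k <- r | P k) co (f k) i.
Proof. by rewrite /co summxE. Qed.

Lemma wo_sum (I : Type) (r : seq I) (P : pred I) (f : I -> vec) :
  wo (\sum_(k <- r | P k) f k) = \sum_(k <- r | P k) wo (f k).
Proof. by rewrite /wo summxE. Qed.

Definition ev i : vec := delta_mx (lift ord_max i) 0.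
Definition ew : vec := delta_mx ord_max 0.

Lemma co_ev i k : co (ev k) i = (i == k)%:R.
Proof. by rewrite /co /ev mxE eqxx andbT (inj_eq lift_inj). Qed.

Lemma wo_ev k : wo (ev k) = 0.
Proof. by rewrite /wo /ev mxE eqxx andbT (negbTE (neq_lift _ _)). Qed.

Lemma co_ew i : co ew i = 0.
Proof. by rewrite /co /ew mxE eqxx andbT eq_sym (negbTE (neq_lift _ _)). Qed.

Lemma wo_ew : wo ew = 1.
Proof. by rewrite /wo /ew mxE !eqxx. Qed.

Lemma vecE p : p = \sum_i co p i *: ev i + wo p *: ew.
Proof.
apply: vec_ext => [i|].
  rewrite coD co_sum coZ co_ew mulr0 addr0 (bigD1 i)//= big1 => [|k ki].
    by rewrite coZ co_ev eqxx mulr1 addr0.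
  by rewrite coZ co_ev eq_sym (negbTE ki) mulr0.
by rewrite woD wo_sum woZ wo_ew mulr1 big1 ?add0r// => k _; rewrite woZ wo_ev mulr0.
Qed.

Lemma aff_scale (c : R) p : c != 0 -> aff (c *: p) = aff p.
Proof.
move=> c0; apply/funext => i; rewrite /aff coZ woZ.
have [->|w0] := eqVneq (wo p) 0; first by rewrite mulr0 invr0 !mulr0.
by rewrite -mulf_div divff// mul1r.
Qed.

Lemma lorentzE p q : lorentz p q = \sum_i co p i * co q i - wo p * wo q.
Proof. by []. Qed.

Lemma aff_eq_peq p q : wo p != 0 -> wo q != 0 -> aff p =1 aff q -> peq p q.
Proof.
move=> wp wq pq; exists (wo q / wo p); first by rewrite mulf_neq0// invr_neq0.
apply: vec_ext => [i|]; last by rewrite woZ divfK.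
by rewrite coZ mulrAC -mulrA -/(aff p i) pq /aff mulrC divfK.
Qed.

Lemma coord_linear k : linear (fun p : vec => p k 0 : R^o).
Proof. by move=> a p q; rewrite !mxE. Qed.

Definition coordL k : {linear vec -> R^o} :=
  HB.pack (fun p : vec => p k 0 : R^o)
    (GRing.isLinear.Build _ _ _ _ _ (coord_linear k)).

Lemma coordL_continuous k : continuous (coordL k).
Proof.
suff c (p : vec) : {for p, continuous (fun p : vec => p k 0 : R^o)} by [].
exact: coord_continuous.
Qed.

Lemma coord_Ck m U k : open U -> Ck_on m U (fun p : vec => p k 0 : R^o).
Proof.
move=> oU; apply: (@Ck_on_linear _ _ _ m U (coordL k)) => //.
exact: coordL_continuous.
Qed.

Lemma coord_derive k p v : differentiable (fun p : vec => p k 0 : R^o) p /\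
  'D_v (fun p : vec => p k 0 : R^o) p = v k 0.
Proof.
have cL := @coordL_continuous k.
have d : differentiable (coordL k) p by exact: linear_differentiable.
split; first exact: d.
by rewrite (deriveE v d) (diff_lin _ cL).
Qed.

End Coordinates.

Section Derivation.
Context {R : realType} {V : normedModType R}.
Implicit Types (f g : V -> R^o) (p v : V).

Lemma derive_mul f g p v : differentiable f p -> differentiable g p ->
  'D_v (fun q => f q * g q : R^o) p = f p * 'D_v g p + 'D_v f p * g p.
Proof.
move=> df dg.
have := deriveM (@diff_derivable _ _ _ f p v df) (@diff_derivable _ _ _ g p v dg).
by move=> ->; congr (_ + _); exact: mulrC.
Qed.

Lemma derive_sum_seq (I : Type) (r : seq I) (P : pred I) (f : I -> V -> R^o) p v :
  (forall i, P i -> differentiable (f i) p) ->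
  differentiable (fun q => \sum_(i <- r | P i) f i q : R^o) p /\
  'D_v (fun q => \sum_(i <- r | P i) f i q : R^o) p =
    \sum_(i <- r | P i) 'D_v (f i) p.
Proof.
move=> df; elim: r => [|a r [IHd IH]].
  rewrite big_nil.
  under [X in differentiable X _]eq_fun do rewrite big_nil.
  under [X in 'D_v X _]eq_fun do rewrite big_nil.
  by split; [exact: differentiable_cst|exact: derive_cst].
rewrite big_cons.
under [X in differentiable X _]eq_fun do rewrite big_cons.
under [X in 'D_v X _]eq_fun do rewrite big_cons.
case: ifPn => Pa; last by [].
split; first by apply: differentiableD; [exact: df|].
by rewrite -IH; apply: deriveD; apply: diff_derivable => //; exact: df.
Qed.

End Derivation.

(** * Horospherical coordinates on the chart of a cusp *)

Section HorosphericalCoordinates.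
Context {R : realType} {n : nat} (w : 'I_n -> R) (t : nat).
Local Notation vec := 'cV[R]_n.+1.
Implicit Types (p q v : vec) (i j k : 'I_n).

Definition cusp_chart : set vec := [set p | wo p != 0 /\ posV t (aff p)].
Local Notation VV := cusp_chart.

Definition horofun p : R := horo w t (aff p).
Local Notation hh := horofun.

(** The unit vector u. For t < n it is the axis along which the horofunction is linear. For t = n
    the horospheres are the hyperplanes of constant sum of w_i ln (x_i); in the coordinates
    sqrt(w_i) ln (x_i) their normal is sqrt(w), a unit vector because the weights sum to 1. *)
Definition vertical i : R := if (t < n)%N then (i == t :> nat)%:R else Num.sqrt (w i).
Local Notation uu := vertical.

(** The factors sqrt(w_i) make |dY|^2, restricted to a horosphere, the Hessian of the horofunction.
    The term in h, present only for t = n, projects orthogonally to u, since the sum of w_i ln (x_i)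
    is then - h. *)
Definition flat_coord p i : R :=
  Num.sqrt (w i) * (ln (aff p i) + (t == n)%:R * hh p) + (t < i)%:R * aff p i.
Local Notation YY := flat_coord.

Context (hw : cusp_weights w t).

Let w_ge0 i : 0 <= w i. Proof. by case: hw. Qed.
Let w_gt0 i : (0 < w i) = (i < t)%N. Proof. by case: hw. Qed.

Lemma open_chart : open VV.
Proof.
suff nV (p : vec) : VV p -> nbhs p VV by rewrite openE => p; exact: nV.
move=> [wp Vp].
have cw : {for p, continuous (@wo R n : vec -> R)} by exact: coord_continuous.
have cc i : {for p, continuous (fun q : vec => aff q i)}.
  apply: (@cvgM _ _ (nbhs p)); first exact: coord_continuous.
  by apply: (@cvgV _ _ (nbhs p)) => //; exact: coord_continuous.
have n1 : \forall q \near p, wo q != 0.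
  by apply: (cw [set x | x != 0]); apply: open_nbhs_nbhs; split => //; exact: open_neq.
have n2 i : \forall q \near p, (i < t)%N -> 0 < aff q i.
  have [it|ti] := ltnP i t; last by apply: filterS n1 => q _.
  have : \forall q \near p, 0 < aff q i.
    by apply: (cc i [set x | 0 < x]); apply: open_nbhs_nbhs; split; [exact: open_gt|exact: Vp].
  by apply: filterS.
have n3 : \forall q \near p, forall i, (i < t)%N -> 0 < aff q i.
  exact: (@filter_forall _ _ _ (nbhs p) _ n2).
by apply: filterS2 n1 n3.
Qed.

Lemma aff_smooth m i : Ck_on m VV (fun p => aff p i : R^o).
Proof.
have oV := open_chart.
apply: Ck_on_mul oV (coord_Ck _ _ oV) (Ck_on_inv oV _ (coord_Ck _ _ oV)).
by move=> p [].
Qed.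

Lemma ln_aff_smooth m i : (i < t)%N -> Ck_on m VV (fun p => ln (aff p i) : R^o).
Proof.
move=> it; apply: (Ck_on_ln open_chart _ (aff_smooth m i)).
by move=> p [_]; apply.
Qed.

Lemma wln_smooth m i (c : R) : ((t <= i)%N -> c = 0) ->
  Ck_on m VV (fun p => c * ln (aff p i) : R^o).
Proof.
move=> ci; have oV := open_chart.
have [it|ti] := ltnP i t.
  exact: Ck_on_mul oV (Ck_on_cst _ (c : R^o) oV) (ln_aff_smooth _ it).
apply: Ck_on_eq oV _ (Ck_on_cst _ (0 : R^o) oV) => p _.
by rewrite ci// mul0r.
Qed.

Lemma smooth_sum m (P : pred 'I_n) (f : 'I_n -> vec -> R^o) :
  (forall i, P i -> Ck_on m VV (f i)) ->
  Ck_on m VV (fun p => \sum_(i | P i) f i p : R^o).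
Proof.
move=> fC; have := Ck_on_sum (index_enum 'I_n) open_chart fC.
apply: Ck_on_eq open_chart _ => p _.
by rewrite fct_sumE.
Qed.

Lemma smooth_cmul m (c : R) (f : vec -> R^o) :
  Ck_on m VV f -> Ck_on m VV (fun p => c * f p : R^o).
Proof. exact: Ck_on_mul open_chart (Ck_on_cst _ (c : R^o) open_chart). Qed.

Lemma smooth_add m (f g : vec -> R^o) :
  Ck_on m VV f -> Ck_on m VV g -> Ck_on m VV (fun p => f p + g p : R^o).
Proof. exact: Ck_on_add open_chart. Qed.

Lemma horofun_smooth m : Ck_on m VV (hh : vec -> R^o).
Proof.
have oV := open_chart.
have s1 : Ck_on m VV (fun p => \sum_i w i * ln (aff p i) : R^o).
  by apply: smooth_sum => i _; apply: wln_smooth => ti; exact: (weight0 hw).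
have s2 : Ck_on m VV (fun p => \sum_(i < n | i == t :> nat) aff p i : R^o).
  by apply: smooth_sum => i _; exact: aff_smooth.
have s3 : Ck_on m VV (fun p => \sum_(i < n | (t < i)%N) aff p i ^+ 2 : R^o).
  apply: smooth_sum => i _; apply: Ck_on_eq oV _
    (Ck_on_mul oV (aff_smooth m i) (aff_smooth m i)) => p _.
  by rewrite expr2.
have := smooth_add (smooth_add (smooth_cmul (-1) s1) (smooth_cmul (-1) s2))
  (smooth_cmul (2^-1) s3).
by apply: Ck_on_eq oV _ => p _; rewrite !mulN1r.
Qed.

Lemma sqrt_w0 i : (t <= i)%N -> Num.sqrt (w i) = 0.
Proof. by move=> ti; rewrite (weight0 hw ti) sqrtr0. Qed.

Lemma flat_coord_smooth m i : Ck_on m VV (fun p => YY p i : R^o).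
Proof.
have oV := open_chart.
have := smooth_add (smooth_add (wln_smooth m (@sqrt_w0 i))
   (smooth_cmul (Num.sqrt (w i) * (t == n)%:R) (horofun_smooth m)))
   (smooth_cmul ((t < i)%N%:R) (aff_smooth m i)).
by apply: Ck_on_eq oV _ => p _; rewrite /YY; ring.
Qed.

Lemma vertical_norm : (2 <= n)%N -> \sum_i uu i ^+ 2 = 1.
Proof.
move=> n2; rewrite /uu; have [tn|nt] := ltnP t n.
  rewrite (bigD1 (Ordinal tn))//= eqxx expr1n big1 ?addr0// => i it.
  have -> : (i == t :> nat) = false.
    by apply: contraNF it => /eqP it; apply/eqP/val_inj.
  by rewrite expr0n.
have tn : t = n by case: hw => tn _ _ _; apply/eqP; rewrite eqn_leq tn.
by under eq_bigr do rewrite sqr_sqrtr//; case: hw => _ _ _; apply.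
Qed.

Lemma flat_coord_vertical p : \sum_i YY p i * uu i = 0.
Proof.
rewrite /YY /uu; have [tn|nt] := ltnP t n.
  rewrite (bigD1 (Ordinal tn))//= eqxx mulr1 ltnn mul0r addr0 sqrt_w0// mul0r.
  rewrite add0r big1// => i it.
  have -> : (i == t :> nat) = false.
    by apply: contraNF it => /eqP it; apply/eqP/val_inj.
  by rewrite mulr0.
have tn : t = n by case: hw => tn _ _ _; apply/eqP; rewrite eqn_leq tn.
have e i : (t < i)%N = false by rewrite ltnNge tn ltnW.
under eq_bigr do rewrite e mul0r addr0 mulrAC -expr2 sqr_sqrtr// mulrDr.
rewrite big_split/= tn eqxx mul1r -mulr_suml.
case: hw => _ _ _ /(_ tn) ->; rewrite mul1r /hh /horo.
rewrite [X in _ - X + _]big1 => [|i /eqP it]; last by have := ltn_ord i; rewrite it tn ltnn.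
rewrite [X in _ * X]big1 => [|i ti]; last by rewrite e in ti.
by rewrite mulr0; ring.
Qed.

End HorosphericalCoordinates.

(** * The developing map and the metric of a cusp *)

Section DevelopingMap.
Context {R : realType} {n : nat} (w : 'I_n -> R) (t : nat) (s : R).
Local Notation vec := 'cV[R]_n.+1.
Implicit Types (p q v : vec) (i j k : 'I_n).
Local Notation VV := (@cusp_chart R n t).
Local Notation hh := (horofun w t).
Local Notation YY := (flat_coord w t).
Local Notation uu := (vertical w t).

Definition horo_scale p : R := expR (hh p - s).
Local Notation aa := horo_scale.
Definition scaled_coord p i : R := aa p * YY p i.
Local Notation QQ := scaled_coord.
(* The coordinate of [dev p] along the null vector [(uu, 1)]. *)
Definition null_coord p : R :=
  2^-1 * ((aa p)^-1 * (1 + \sum_i QQ p i ^+ 2) - aa p).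
Local Notation kk := null_coord.

Definition developing p : vec := mkv (fun i => QQ p i + kk p * uu i) (kk p + aa p).
Local Notation dev := developing.

(** Defined as the pullback by the developing map, so that hyperbolicity holds by construction;
    positivity and invariance remain to be shown. *)
Definition cusp_metric p u v : R := lorentz ('D_u dev p) ('D_v dev p).
Local Notation gg := cusp_metric.

Context (hw : cusp_weights w t) (n2 : (2 <= n)%N).

Let oV : open VV := @open_chart R n t.

Lemma horo_scale_gt0 p : 0 < aa p. Proof. exact: expR_gt0. Qed.

Lemma horo_scale_smooth m : Ck_on m VV (aa : vec -> R^o).
Proof.
apply: (@Ck_on_expR _ _ _ _ (fun p => hh p - s : R^o) oV).
exact: smooth_add (horofun_smooth hw m) (Ck_on_cst _ (- s : R^o) oV).
Qed.

Lemma scaled_coord_smooth m i : Ck_on m VV (fun p => QQ p i : R^o).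
Proof. exact: Ck_on_mul oV (horo_scale_smooth m) (flat_coord_smooth hw m i). Qed.

Lemma null_coord_smooth m : Ck_on m VV (kk : vec -> R^o).
Proof.
apply: smooth_cmul.
have := smooth_add (Ck_on_mul oV
  (Ck_on_inv oV _ (horo_scale_smooth m))
  (smooth_add (Ck_on_cst _ (1 : R^o) oV)
    (smooth_sum (fun i _ => Ck_on_mul oV (scaled_coord_smooth m i) (scaled_coord_smooth m i)))))
  (smooth_cmul (-1) (horo_scale_smooth m)).
move=> /(_ xpredT) h; apply: Ck_on_eq oV _ (h _) => p _.
  by rewrite mulN1r; congr (_ * (1 + _) - _); apply: eq_bigr => i _; rewrite expr2.
by rewrite gt_eqF// horo_scale_gt0.
Qed.

Lemma developing_smooth m : Ck_on m VV dev.
Proof.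
have c1 i : Ck_on m VV (fun p => QQ p i + kk p * uu i : R^o).
  apply: smooth_add; first exact: scaled_coord_smooth.
  by apply: Ck_on_mul oV (null_coord_smooth m) (Ck_on_cst _ (uu i : R^o) oV).
have c2 : Ck_on m VV (fun p => kk p + aa p : R^o).
  by apply: smooth_add (null_coord_smooth m) (horo_scale_smooth m).
have := Ck_on_add oV
  (Ck_on_sum (index_enum 'I_n) oV (fun i (_ : xpredT i) => Ck_on_scale (ev i) oV (c1 i)))
  (Ck_on_scale (ew : vec) oV c2).
apply: Ck_on_eq oV _ => p _; rewrite [RHS]vecE fctE fct_sumE.
by congr (_ + _ *: _); [apply: eq_bigr => i _; rewrite co_mkv|rewrite wo_mkv].
Qed.

Lemma scaled_coord_vertical p : \sum_i QQ p i * uu i = 0.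
Proof.
rewrite /QQ; under eq_bigr do rewrite -mulrA.
by rewrite -mulr_sumr (flat_coord_vertical hw) mulr0.
Qed.

(** This is the hyperboloid equation for [developing p] cleared of the inverse, the form in which it
    gets differentiated below. *)
Lemma null_coordE p : (kk p *+ 2 + aa p) * aa p = 1 + \sum_i QQ p i ^+ 2.
Proof.
have a0 : aa p != 0 by rewrite gt_eqF// horo_scale_gt0.
rewrite /kk; field.
exact: a0.
Qed.

Lemma developing_null p : wo (dev p) - \sum_i co (dev p) i * uu i = aa p.
Proof.
rewrite wo_mkv; under eq_bigr do rewrite co_mkv mulrDl -mulrA -expr2.
by rewrite big_split/= scaled_coord_vertical add0r -mulr_sumr vertical_norm//; ring.
Qed.

Lemma lorentz_developing p : lorentz (dev p) (dev p) = -1.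
Proof.
rewrite lorentzE wo_mkv; under eq_bigr do rewrite co_mkv.
have -> : \sum_i (QQ p i + kk p * uu i) * (QQ p i + kk p * uu i) =
  \sum_i QQ p i ^+ 2 + (kk p *+ 2) * (\sum_i QQ p i * uu i) +
  kk p ^+ 2 * \sum_i uu i ^+ 2.
  rewrite !mulr_sumr -!big_split/=; apply: eq_bigr => i _; ring.
rewrite scaled_coord_vertical vertical_norm//.
have -> : \sum_i QQ p i ^+ 2 = (kk p *+ 2 + aa p) * aa p - 1 by rewrite null_coordE; ring.
by ring.
Qed.

(** By Cauchy-Schwarz b^2 <= |co v|^2 = (wo v)^2 - 1, so |b| < |wo v| and wo v has the sign of wo v
    - b. *)
Lemma hyperbolic_null v : lorentz v v = -1 ->
  0 < wo v - \sum_i co v i * uu i -> 0 < wo v.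
Proof.
move=> vv; set b := \sum_i _ => a0.
have : 0 <= \sum_i (co v i - b * uu i) ^+ 2 by apply: sumr_ge0 => i _; exact: sqr_ge0.
have -> : \sum_i (co v i - b * uu i) ^+ 2 = \sum_i co v i * co v i - b ^+ 2.
  transitivity (\sum_i co v i * co v i - (b *+ 2) * b + b ^+ 2 * \sum_i uu i ^+ 2).
    rewrite !mulr_sumr -sumrN -!big_split/=; apply: eq_bigr => i _; ring.
  by rewrite vertical_norm//; ring.
have -> : \sum_i co v i * co v i = wo v * wo v - 1.
  by move: vv; rewrite lorentzE => /eqP; rewrite subr_eq => /eqP ->; ring.
move=> h; rewrite ltNge; apply/negP => w0.
nra.
Qed.

Lemma hyperbolic_developing p : hyperbolic_space (dev p).
Proof.
split; first exact: lorentz_developing.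
apply: hyperbolic_null (lorentz_developing p) _.
by rewrite developing_null horo_scale_gt0.
Qed.

Lemma developing_diff p : VV p -> differentiable dev p.
Proof. by move=> Vp; exact: (developing_smooth 1).1. Qed.

Lemma co_derive (f : vec -> vec) p v i : differentiable f p ->
  co ('D_v f p) i = 'D_v (fun q => co (f q) i : R^o) p.
Proof.
move=> df; rewrite derive_mx; last exact: diff_derivable.
by rewrite /co mxE.
Qed.

Lemma wo_derive (f : vec -> vec) p v : differentiable f p ->
  wo ('D_v f p) = 'D_v (fun q => wo (f q) : R^o) p.
Proof.
move=> df; rewrite derive_mx; last exact: diff_derivable.
by rewrite /wo mxE.
Qed.

(** Differentiating [null_coordE] expresses the derivative K of the null coordinate by the other
    derivatives; after substitution all terms containing Y itself cancel. *)
Lemma cusp_metric_sq p v : VV p ->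
  gg p v v = 'D_v (hh : vec -> R^o) p ^+ 2 +
    aa p ^+ 2 * \sum_i 'D_v (fun q => YY q i : R^o) p ^+ 2.
Proof.
move=> Vp.
have dY i : differentiable (fun q => YY q i : R^o) p by exact: (flat_coord_smooth hw 1 i).1.
have dQ i : differentiable (fun q => QQ q i : R^o) p by exact: (scaled_coord_smooth 1 i).1.
have da : differentiable (aa : vec -> R^o) p by exact: (horo_scale_smooth 1).1.
have dk : differentiable (kk : vec -> R^o) p by exact: (null_coord_smooth 1).1.
have dh : differentiable (hh : vec -> R^o) p by exact: (horofun_smooth hw 1).1.
have dcst (c : R) : differentiable (cst c : vec -> R^o) p by exact: differentiable_cst.
have Dcst (c : R) : 'D_v (cst c : vec -> R^o) p = 0 by exact: derive_cst.
have DD (f g : vec -> R^o) : differentiable f p -> differentiable g p ->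
  'D_v (fun q => f q + g q : R^o) p = 'D_v f p + 'D_v g p.
  by move=> df dg; apply: deriveD; exact: diff_derivable.
pose H : R := 'D_v (hh : vec -> R^o) p.
pose K : R := 'D_v (kk : vec -> R^o) p.
pose A : R := 'D_v (aa : vec -> R^o) p.
pose Y i : R := 'D_v (fun q => YY q i : R^o) p.
pose Q i : R := 'D_v (fun q => QQ q i : R^o) p.
have AE : A = aa p * H.
  have dhs : differentiable (fun q => hh q - s : R^o) p.
    by apply: differentiableD => //; exact: dcst.
  have [_] := derive_comp1 v dhs (is_derive_expR (hh p - s)).
  move=> e; rewrite /A [LHS]e (DD _ (cst (- s)))// Dcst addr0.
  by [].
have QE i : Q i = aa p * Y i + A * YY p i by apply: derive_mul.
have coE i : co ('D_v dev p) i = Q i + K * uu i.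
  rewrite co_derive; last exact: developing_diff.
  under [X in 'D_v X _]eq_fun do rewrite co_mkv.
  have dkc : differentiable (fun q => kk q * uu i : R^o) p.
    exact: differentiableM dk (dcst _).
  rewrite (DD (fun q => QQ q i) (fun q => kk q * uu i))//.
  by rewrite (derive_mul v dk (dcst (uu i))) Dcst mulr0 add0r.
have woE : wo ('D_v dev p) = K + A.
  rewrite wo_derive; last exact: developing_diff.
  under [X in 'D_v X _]eq_fun do rewrite wo_mkv.
  exact: DD.
(* The relation of orthogonality to u, differentiated along v. *)
have Quu : \sum_i Q i * uu i = 0.
  have dm i : differentiable (fun q => QQ q i * uu i : R^o) p.
    exact: differentiableM (dQ i) (dcst _).
  have [_] := derive_sum_seq (index_enum 'I_n) v (fun i (_ : xpredT i) => dm i).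
  under [X in 'D_v X _ = _]eq_fun do rewrite scaled_coord_vertical.
  rewrite Dcst => h; rewrite [RHS]h; apply: eq_bigr => i _.
  by rewrite (derive_mul v (dQ i) (dcst (uu i))) Dcst mulr0 add0r.
(* The derivative of [null_coordE] along v. *)
have KE : (K *+ 2 + A) * aa p + (kk p *+ 2 + aa p) * A = 2 * \sum_i QQ p i * Q i.
  have dm i : differentiable (fun q => QQ q i ^+ 2 : R^o) p.
    by under eq_fun do rewrite expr2; exact: differentiableM.
  have [ds Ds] := derive_sum_seq (index_enum 'I_n) v (fun i (_ : xpredT i) => dm i).
  have d2k : differentiable (fun q => kk q + kk q : R^o) p by exact: differentiableD.
  have dka : differentiable (fun q => kk q + kk q + aa q : R^o) p by exact: differentiableD.
  have := derive_mul v dka da.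
  rewrite (DD (fun q => kk q + kk q) aa)// DD// -/K -/A.
  under [X in 'D_v X _ = _]eq_fun do rewrite -mulr2n null_coordE.
  rewrite (DD (cst 1))// Dcst add0r Ds => e.
  rewrite -mulr2n in e; rewrite mulr_sumr.
  transitivity ((kk p + kk p + aa p) * A + (K *+ 2 + A) * aa p); first by ring.
  rewrite -e; apply: eq_bigr => i _.
  under [X in 'D_v X _]eq_fun do rewrite expr2.
  rewrite (derive_mul v (dQ i) (dQ i)) -/(Q i); ring.
rewrite /gg lorentzE woE; under eq_bigr do rewrite coE.
have -> : \sum_i (Q i + K * uu i) * (Q i + K * uu i) =
  \sum_i Q i ^+ 2 + (K *+ 2) * (\sum_i Q i * uu i) + K ^+ 2 * \sum_i uu i ^+ 2.
  rewrite !mulr_sumr -!big_split/=; apply: eq_bigr => i _; ring.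
rewrite Quu vertical_norm//.
pose N := \sum_i YY p i ^+ 2; pose M := \sum_i YY p i * Y i.
have Q2 : \sum_i Q i ^+ 2 = aa p ^+ 2 * \sum_i Y i ^+ 2 + 2 * aa p * A * M + A ^+ 2 * N.
  rewrite /M /N !mulr_sumr -!big_split/=; apply: eq_bigr => i _; rewrite QE; ring.
have QQ' : \sum_i QQ p i * Q i = aa p ^+ 2 * M + aa p * A * N.
  rewrite /M /N !mulr_sumr -!big_split/=; apply: eq_bigr => i _; rewrite QE /QQ; ring.
have k' : (kk p *+ 2 + aa p) * aa p = 1 + aa p ^+ 2 * N.
  by rewrite null_coordE /N mulr_sumr; congr (_ + _); apply: eq_bigr => i _; rewrite /QQ exprMn.
rewrite Q2; move: KE; rewrite QQ' AE => KE.
have a0 : aa p != 0 by rewrite gt_eqF// horo_scale_gt0.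
have KE2 : (K *+ 2 + aa p * H) * aa p =
    2 * (aa p ^+ 2 * M + aa p * (aa p * H) * N) - (1 + aa p ^+ 2 * N) * H.
  by rewrite -k' -KE; ring.
rewrite (_ : 'D_v (hh : vec -> R^o) p ^+ 2 + _ = H ^+ 2 + aa p ^+ 2 * (\sum_i Y i ^+ 2))//.
move: (\sum_i Y i ^+ 2) => S2.
transitivity (aa p ^+ 2 * S2 + 2 * aa p * (aa p * H) * M + (aa p * H) ^+ 2 * N
   - H * ((K *+ 2 + aa p * H) * aa p)); first by ring.
by rewrite KE2; ring.
Qed.

End DevelopingMap.

Section StationaryFunctions.
Context {R : realType} {V : normedModType R} (p v : V).
Implicit Types (f g : V -> R^o).

(** Functions with zero derivative along v at p are closed under sums and products, which allows the
    derivatives of the affine coordinates to be read off from those of h and Y. *)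
Definition stationary f : Prop := differentiable f p /\ 'D_v f p = 0.

Lemma stationary_cst (c : R) : stationary (cst c : V -> R^o).
Proof. by split; [exact: differentiable_cst|exact: derive_cst]. Qed.

Lemma stationary_mul f g : stationary f -> stationary g ->
  stationary (fun q => f q * g q : R^o).
Proof.
move=> [df f0] [dg g0]; split; first exact: differentiableM.
by rewrite derive_mul// f0 g0 mulr0 mul0r addr0.
Qed.

Lemma stationary_cmul (c : R) f : stationary f -> stationary (fun q => c * f q : R^o).
Proof. by move=> sf; exact: stationary_mul (stationary_cst c) sf. Qed.

Lemma stationary_add f g : stationary f -> stationary g ->
  stationary (fun q => f q + g q : R^o).
Proof.
move=> [df f0] [dg g0]; split; first exact: differentiableD.
have -> : (fun q => f q + g q : R^o) = f + g by [].
by rewrite deriveD ?f0 ?g0 ?addr0//; exact: diff_derivable.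
Qed.

Lemma stationary_sum (I : Type) (r : seq I) (P : pred I) (f : I -> V -> R^o) :
  (forall i, P i -> stationary (f i)) ->
  stationary (fun q => \sum_(i <- r | P i) f i q : R^o).
Proof.
move=> sf; have df i : P i -> differentiable (f i) p by move=> /sf[].
have [d D] := derive_sum_seq r v df; split => //; rewrite D.
by apply: big1 => i /sf[].
Qed.

Lemma stationary_eq f g : f =1 g -> stationary f -> stationary g.
Proof. by move=> /funext ->. Qed.

End StationaryFunctions.

(** * The Riemannian metric of a model *)

Section RiemannianModel.
Context {R : realType} {n : nat} (w : 'I_n -> R) (t : nat) (s : R).
Local Notation vec := 'cV[R]_n.+1.
Implicit Types (p q u v : vec) (i j k : 'I_n).
Local Notation VV := (@cusp_chart R n t).
Local Notation hh := (horofun w t).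
Local Notation YY := (flat_coord w t).
Local Notation dev := (developing w t s).
Local Notation gg := (cusp_metric w t s).
Context (hw : cusp_weights w t) (n2 : (2 <= n)%N).

Let w_gt0 i : (0 < w i) = (i < t)%N. Proof. by case: hw. Qed.

(** Together h and Y determine the affine point: they give ln (x_i) for the indices below t and x_i
    for those above, and h then gives the coordinate of index t. So all affine coordinates are
    stationary along v, and v is radial. *)
Lemma developing_immersion p v : VV p ->
  'D_v (hh : vec -> R^o) p = 0 ->
  (forall i, 'D_v (fun q => YY q i : R^o) p = 0) -> exists c : R, v = c *: p.
Proof.
move=> Vp h0 Y0; have [wp Vap] := Vp.
have Sh : stationary p v (hh : vec -> R^o).
  by split => //; exact: (horofun_smooth hw 1).1.
have SY i : stationary p v (fun q => YY q i : R^o).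
  by split => //; exact: (flat_coord_smooth hw 1 i).1.
have daff i : differentiable (fun q => aff q i : R^o) p.
  exact: ((@aff_smooth R n t 1 i).1 p Vp).
have Sln i : (i < t)%N -> stationary p v (fun q => ln (aff q i) : R^o).
  move=> it; have s0 : Num.sqrt (w i) != 0 by rewrite gt_eqF// sqrtr_gt0 w_gt0.
  have := stationary_add (stationary_cmul (Num.sqrt (w i))^-1 (SY i))
    (stationary_cmul (- (t == n)%:R) Sh).
  apply: stationary_eq => q; rewrite /flat_coord ltnNge (ltnW it)/= mul0r addr0.
  by rewrite mulKf// mulNr addrK.
have Sj i : i != t :> nat -> stationary p v (fun q => aff q i : R^o).
  rewrite neq_ltn => /orP[it|ti].
    have [_ e] := Sln i it; split => //.
    have ai : 0 < aff p i by exact: Vap.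
    have [_] := derive_comp1 v (daff i) (is_derive1_ln ai).
    move=> e'; have : (aff p i)^-1 * 'D_v (fun q => aff q i : R^o) p = 0.
      by rewrite -e' -[RHS]e.
    by move=> /eqP; rewrite mulf_eq0 invr_eq0 gt_eqF//= => /eqP.
  apply: stationary_eq (SY i) => q.
  by rewrite /flat_coord ti mul1r (sqrt_w0 hw (ltnW ti)) mul0r add0r.
have Si i : stationary p v (fun q => aff q i : R^o).
  have [it|] := eqVneq (i : nat) t; last exact: Sj.
  have S1 : stationary p v (fun q => \sum_k w k * ln (aff q k) : R^o).
    apply: stationary_sum => k _; have [kt|tk] := ltnP k t.
      by apply: stationary_cmul; exact: Sln.
    apply: stationary_eq (stationary_cst _ _ 0) => q.
    by rewrite (weight0 hw tk) mul0r.
  have S2 : stationary p v (fun q => \sum_(k < n | (t < k)%N) aff q k * aff q k : R^o).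
    apply: stationary_sum => k tk.
    by apply: stationary_mul; apply: Sj; rewrite gtn_eqF.
  have := stationary_add (stationary_add (stationary_cmul (-1) Sh)
    (stationary_cmul (-1) S1)) (stationary_cmul 2^-1 S2).
  apply: stationary_eq => q; rewrite /horofun /horo (sum_horo_index _ it).
  have -> : \sum_(k < n | (t < k)%N) aff q k ^+ 2 =
    \sum_(k < n | (t < k)%N) aff q k * aff q k.
    by apply: eq_bigr => k _; rewrite expr2.
  pose X : R := \sum_k w k * ln (aff q k).
  pose Y : R := \sum_(k < n | (t < k)%N) aff q k * aff q k.
  have e : -1 * (- X - aff q i + 2^-1 * Y) + -1 * X + 2^-1 * Y = aff q i by ring.
  exact: e.
exists (wo v / wo p); apply: vec_ext => [i|]; last by rewrite woZ divfK.
rewrite coZ mulrAC.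
have -> : co v i = 'D_v (fun q : vec => q (lift ord_max i) 0 : R^o) p.
  by have [_ ->] := coord_derive (lift ord_max i) p v.
have nE : \forall q \near p, (fun q : vec => q (lift ord_max i) 0 : R^o) q =
    (fun q => aff q i * wo q : R^o) q.
  have : nbhs p VV by apply: open_nbhs_nbhs; split=> //; exact: open_chart.
  by apply: filterS => q [wq _] /=; rewrite /aff divfK.
rewrite (near_eq_derive _ nE).
have [dw Dw] := coord_derive ord_max p v.
rewrite (derive_mul v (daff i) dw) (Si i).2 mul0r addr0 Dw /aff.
by rewrite /wo; ring.
Qed.

Lemma cusp_metric_gt0 p v : VV p -> (forall c : R, v != c *: p) -> 0 < gg p v v.
Proof.
move=> Vp vp; rewrite cusp_metric_sq// lt0r addr_ge0 ?sqr_ge0//; last first.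
  by rewrite mulr_ge0 ?sqr_ge0// sumr_ge0// => i _; exact: sqr_ge0.
rewrite andbT; apply/negP.
rewrite paddr_eq0 ?sqr_ge0//; last first.
  by rewrite mulr_ge0 ?sqr_ge0// sumr_ge0// => i _; exact: sqr_ge0.
have a0 : (horo_scale w t s p == 0) = false by rewrite gt_eqF ?horo_scale_gt0.
rewrite sqrf_eq0 mulf_eq0 sqrf_eq0 a0/= => /andP[/eqP h0].
rewrite psumr_eq0 => [/allP Y0|i _]; last exact: sqr_ge0.
have [|c vc] := developing_immersion Vp h0.
  by move=> i; have := Y0 i (mem_index_enum i); rewrite sqrf_eq0 => /eqP.
by have := vp c; rewrite vc eqxx.
Qed.

Lemma lorentzC u v : lorentz u v = lorentz v u.
Proof.
rewrite !lorentzE (mulrC (wo u)); congr (_ - _).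
by apply: eq_bigr => i _; rewrite mulrC.
Qed.

Lemma cusp_metricC p u v : gg p u v = gg p v u.
Proof. exact: lorentzC. Qed.

Lemma lorentz_comb (a : R) u v x : lorentz (a *: u + v) x = a * lorentz u x + lorentz v x.
Proof.
rewrite !lorentzE wo_comb; under eq_bigr do rewrite co_comb mulrDl -mulrA.
by rewrite big_split/= -mulr_sumr; ring.
Qed.

Lemma cusp_metric_linear p (a : R) u v x : VV p ->
  gg p (a *: u + v) x = a * gg p u x + gg p v x.
Proof.
move=> Vp; rewrite /cusp_metric.
have d : differentiable dev p by exact: developing_diff.
by rewrite !(deriveE _ d) linearP lorentz_comb.
Qed.

Lemma chart_scale (c : R) p : c != 0 -> VV p -> VV (c *: p).
Proof. by move=> c0 [wp Vp]; split; rewrite ?woZ ?mulf_neq0// aff_scale. Qed.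

Lemma developing_scale (c : R) p : c != 0 -> dev (c *: p) = dev p.
Proof.
move=> c0; have h : hh (c *: p) = hh p by rewrite /horofun aff_scale.
have a : horo_scale w t s (c *: p) = horo_scale w t s p by rewrite /horo_scale h.
have Q i : scaled_coord w t s (c *: p) i = scaled_coord w t s p i.
  by rewrite /scaled_coord a /flat_coord h aff_scale.
have k : null_coord w t s (c *: p) = null_coord w t s p.
  by rewrite /null_coord a; congr (_ * (_ * (_ + _) - _)); apply: eq_bigr => i _; rewrite Q.
by rewrite /developing k a; congr mkv; apply/funext => i; rewrite Q.
Qed.

Lemma derive_developing_radial p : 'D_p dev p = 0.
Proof.
rewrite /derive.
have e0 : \forall h \near (0 : R)^',
    (h : R)^-1 *: ((dev \o shift p) (h *: p) - dev p) = 0 :> vec.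
  exists 1; first exact: ltr01.
  move=> h; rewrite /= sub0r normrN => h1 _.
  have -> : h *: p + p = (1 + h) *: p by rewrite scalerDl scale1r addrC.
  rewrite developing_scale ?subrr ?scaler0//.
  by rewrite gt_eqF//; have := ler_norm (- h); rewrite normrN; lra.
apply: cvg_lim => //; apply: cvg_trans (near_eq_cvg _) (cvg_cst 0).
by apply: filterS e0 => h ->.
Qed.

Lemma cusp_metric_radial p u : gg p p u = 0.
Proof.
rewrite /cusp_metric derive_developing_radial; move: ('D_u dev p) => x; rewrite lorentzE wo0.
by rewrite big1 => [|i _]; rewrite ?co0 !mul0r ?subr0.
Qed.

Lemma cusp_metric_smooth m u v : Ck_on m VV (fun p => gg p u v : R^o).
Proof.
have oV := @open_chart R n t.
have dc (k : 'I_n.+1) x : Ck_on m VV (fun p => ('D_x dev p) k 0 : R^o).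
  have [_ /(_ x) D] := developing_smooth s hw m.+1.
  exact: (Ck_on_linear_comp oV (@coordL_continuous R n k) D).
have := smooth_add (smooth_sum (fun i (_ : xpredT i) =>
    Ck_on_mul oV (dc (lift ord_max i) u) (dc (lift ord_max i) v)))
  (smooth_cmul (-1) (Ck_on_mul oV (dc ord_max u) (dc ord_max v))).
by apply: Ck_on_eq oV _ => p _; rewrite mulN1r.
Qed.

End RiemannianModel.

(** * Automorphisms of a cusp domain *)

Section Cone.
Context {R : realType} {n : nat} (w : 'I_n -> R) (t : nat) (s : R).
Local Notation vec := 'cV[R]_n.+1.
Local Notation mat := 'M[R]_n.+1.
Implicit Types (p q u v : vec) (i j k l : 'I_n).
Local Notation VV := (@cusp_chart R n t).
Local Notation hh := (horofun w t).

Definition cusp_domain : set vec := [set p | VV p /\ hh p <= s].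
Local Notation domM := cusp_domain.
(** One half of the double cone over the domain; on it, convexity becomes stability under
    addition. *)
Definition cusp_cone : set vec := [set p | 0 < wo p /\ domM p].
Local Notation KK := cusp_cone.

(* The directions in which the cone [KK] recedes; those outside [KK] are the
   points of its closure at infinity. *)
Definition recession v : Prop := forall p, KK p -> forall r : R, 0 <= r -> KK (p + r *: v).

(** The simplicial cone spanned by the [ev i] with i <= t. Its extreme rays are what an automorphism
    permutes. *)
Definition ideal_cone v : Prop :=
  [/\ wo v = 0, forall i, (i <= t)%N -> 0 <= co v i
    & forall j, (t < j)%N -> co v j = 0].
Local Notation Delta := ideal_cone.

Context (hw : cusp_weights w t) (n2 : (2 <= n)%N).

Let w_ge0 i : 0 <= w i. Proof. by case: hw. Qed.

Lemma horofun_scale (c : R) p : c != 0 -> hh (c *: p) = hh p.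
Proof. by move=> c0; rewrite /horofun aff_scale. Qed.

Lemma cusp_domain_scale (c : R) p : c != 0 -> domM p -> domM (c *: p).
Proof.
move=> c0 [[wp Vp] hp]; split; last by rewrite horofun_scale.
by split; rewrite ?woZ ?mulf_neq0// aff_scale.
Qed.

Lemma cusp_domain_scaleE (c : R) p : c != 0 -> domM (c *: p) <-> domM p.
Proof.
move=> c0; split; last exact: cusp_domain_scale.
by move=> /(cusp_domain_scale (invr_neq0 c0)); rewrite scalerA mulVf// scale1r.
Qed.

Lemma cone_scale (c : R) p : 0 < c -> KK p -> KK (c *: p).
Proof.
by move=> c0 [wp dp]; split; [rewrite woZ mulr_gt0|apply: cusp_domain_scale; rewrite ?gt_eqF].
Qed.

Lemma coneI p : 0 < wo p -> posV t (aff p) -> hh p <= s -> KK p.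
Proof. by move=> wp Vp hp; split=> //; split=> //; split=> //; rewrite gt_eqF. Qed.

Lemma cusp_domain_cases p : domM p -> KK p \/ KK (- p).
Proof.
move=> dp; have [[wp _] _] := dp; case/orP: (lt_total wp) => w0; [right|left] => //.
rewrite -scaleN1r; split; first by rewrite woZ mulN1r oppr_gt0.
by apply: cusp_domain_scale => //; rewrite oppr_eq0 oner_neq0.
Qed.

(** In the affine chart p + q is the convex combination of p and q with weights proportional to wo p
    and wo q. *)
Lemma cone_add p q : KK p -> KK q -> KK (p + q).
Proof.
move=> [wp [[_ Vp] hp]] [wq [[_ Vq] hq]].
have wpq : 0 < wo (p + q) by rewrite woD addr_gt0.
pose a := wo p / wo (p + q).
have a01 : 0 <= a <= 1.
  rewrite /a (ltW (divr_gt0 wp wpq))/= ler_pdivrMr// mul1r woD.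
  by rewrite lerDl ltW.
have E : aff (p + q) = fun i => a * aff p i + (1 - a) * aff q i.
  apply/funext => i; rewrite /aff /a coD; move: wpq; rewrite woD => wpq.
  by field; rewrite !gt_eqF.
have [V h] := horo_convex hw a01 Vp Vq.
apply: coneI => //; first by rewrite E.
rewrite /horofun E (le_trans h)//; have /andP[a0 a1] := a01.
have b0 : 0 <= 1 - a by rewrite subr_ge0.
have := lerD (ler_wpM2l a0 hp) (ler_wpM2l b0 hq).
by rewrite /horofun; lra.
Qed.

Lemma aff_mkv x : aff (mkv x 1 : vec) = x.
Proof. by apply/funext => i; rewrite /aff co_mkv wo_mkv divr1. Qed.

Lemma cone_mkv x : posV t x -> horo w t x <= s -> KK (mkv x 1).
Proof. by move=> Vx hx; apply: coneI; rewrite ?wo_mkv// /horofun ?aff_mkv. Qed.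

Let i0 : 'I_n := Ordinal (ltnW n2).

Lemma cone_nonempty : exists p, KK p.
Proof.
have V1 : posV t (fun _ : 'I_n => 1 : R) by move=> i _; exact: ltr01.
have [r0 r0_gt0 /(_ r0 (lexx _)) [V h]] := horo_lower hw s V1 (leq0n t : (i0 <= t)%N).
by exists (mkv (upd (fun=> 1) i0 r0) 1); exact: cone_mkv.
Qed.

Lemma ideal_cone_recession v : Delta v -> recession v.
Proof.
move=> [wv v0 vj] p [wp [[_ Vp] hp]] r r0.
have E : aff (p + r *: v) = fun i => aff p i + r * co v i / wo p.
  by apply/funext => i; rewrite /aff coD coZ woD woZ wv mulr0 addr0 mulrDl.
have [|||V h] := @horo_mono R n w t hw (aff p) (fun i => r * co v i / wo p) => //.
- by move=> i it; rewrite divr_ge0 ?mulr_ge0 ?v0// ltW.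
- by move=> j tj; rewrite vj// mulr0 mul0r.
apply: coneI; first by rewrite woD woZ wv mulr0 addr0.
  by rewrite E.
by rewrite /horofun E (le_trans h).
Qed.

Lemma open_horofun_gt (r : R) : open [set p : vec | VV p /\ r < hh p].
Proof.
have oV := @open_chart R n t.
suff nV (p : vec) : VV p -> r < hh p -> nbhs p [set p : vec | VV p /\ r < hh p].
  by rewrite openE => p [Vp hp]; exact: nV.
move=> Vp hp; have ch : {for p, continuous (hh : vec -> R^o)} by exact: (horofun_smooth hw 0).
have n1 : \forall q \near p, VV q by exact: open_nbhs_nbhs.
have n3 : \forall q \near p, r < hh q.
  by apply: (ch [set x | r < x]); apply: open_nbhs_nbhs; split=> //; exact: open_gt.
exact: filterS2 n1 n3.
Qed.

Lemma open_horofun_lt (r : R) : open [set p : vec | VV p /\ hh p < r].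
Proof.
have oV := @open_chart R n t.
suff nV (p : vec) : VV p -> hh p < r -> nbhs p [set p : vec | VV p /\ hh p < r].
  by rewrite openE => p [Vp hp]; exact: nV.
move=> Vp hp; have ch : {for p, continuous (hh : vec -> R^o)} by exact: (horofun_smooth hw 0).
have n1 : \forall q \near p, VV q by exact: open_nbhs_nbhs.
have n3 : \forall q \near p, hh q < r.
  by apply: (ch [set x | x < r]); apply: open_nbhs_nbhs; split=> //; exact: open_lt.
exact: filterS2 n1 n3.
Qed.

(** The point v is the limit of the points p + r v: the logarithmic barrier keeps it off the walls
    x_i = 0, and openness of h > s keeps it in the sublevel set. *)
Lemma recession_finite v : recession v -> 0 < wo v -> KK v.
Proof.
move=> Rv wv; have [p Kp] := cone_nonempty; have [wp [[_ Vp] hp]] := Kp.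
(* Bounds the affine coordinates of all the points p + r v with r >= 1. *)
pose M := \sum_k (`|co p k| + `|co v k|) / wo v.
have [d d0 dP] := horo_bounded_below hw M s.
have Vv : posV t (aff v).
  move=> i it; apply: lt_le_trans d0 _; rewrite ler_pdivlMr// -subr_ge0.
  apply: (@linear_ge0 _ (co p i - d * wo p)) => r r1.
  have r0 : 0 < r by exact: lt_le_trans r1.
  have [wr [[_ Vr] hr]] := Rv p Kp r (ltW r0).
  have := dP _ Vr hr; have b k : `|aff (p + r *: v) k| <= M.
    rewrite /M (bigD1 k)//= -[leLHS]addr0; apply: lerD; last first.
      by apply: sumr_ge0 => l _; rewrite divr_ge0 ?addr_ge0// ltW.
    rewrite /aff normrM normfV (gtr0_norm wr) coD coZ woD woZ.
    rewrite ler_pdivrMr; last by rewrite -woZ -woD.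
    rewrite mulrAC ler_pdivlMr//.
    have h1 : `|co p k + r * co v k| <= `|co p k| + r * `|co v k|.
      by rewrite (le_trans (ler_normD _ _))// normrM (gtr0_norm r0).
    have h2 := normr_ge0 (co p k); have h3 := normr_ge0 (co v k).
    apply: le_trans (ler_wpM2r (ltW wv) h1) _.
    move: (`|co p k| : R) (`|co v k| : R) h2 h3 => a b h2 h3.
    rewrite -subr_ge0.
    have -> : (a + b) * (wo p + r * wo v) - (a + r * b) * wo v =
      (a + b) * wo p + a * (r - 1) * wo v by ring.
    have wp' := ltW wp; have wv' := ltW wv.
    have r1' : 0 <= r - 1 by rewrite subr_ge0.
    exact: addr_ge0 (mulr_ge0 (addr_ge0 h2 h3) wp') (mulr_ge0 (mulr_ge0 h2 r1') wv').
  move=> /(_ b i it); rewrite /aff ler_pdivlMr// coD coZ woD woZ -subr_ge0.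
  by congr (_ <= _); ring.
apply: coneI => //; rewrite leNgt; apply/negP => hv.
have wv0 : wo v != 0 by rewrite gt_eqF.
have oU : open [set p | VV p /\ s < hh p] by exact: open_horofun_gt.
(* If h exceeded s at v, it would also do so at v + (e / 2) p, a multiple of the cone point p + (2 /
   e) v. *)
have [] := open_line p oU (conj (conj wv0 Vv) hv).
move=> e e0 /(_ (e / 2)); have e20 : 0 < e / 2 by rewrite divr_gt0.
rewrite gtr0_norm// => -[|_]; first by lra.
have -> : v + (e / 2) *: p = (e / 2) *: (p + (e / 2)^-1 *: v).
  by rewrite scalerDr scalerA divff ?gt_eqF// scale1r addrC.
rewrite horofun_scale ?gt_eqF//.
have [_ [_ h]] := Rv p Kp (e / 2)^-1 (ltW (eq_ind_r is_true e20 (invr_gt0 (e / 2)))).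
by rewrite ltNge h.
Qed.

(** Growth rates along a ray with h <= s: coordinates below t must stay positive, the quadratic
    terms would outgrow everything else and must stay constant, and the linear coordinate cannot
    decrease since logarithms would not compensate. *)
Lemma recession_ideal_cone v : recession v -> ~ KK v -> Delta v.
Proof.
move=> Rv nKv; have [p Kp] := cone_nonempty; have [wp [[_ Vp] hp]] := Kp.
have wv : wo v = 0.
  apply/eqP; rewrite eq_le; apply/andP; split.
    by rewrite leNgt; apply/negP => wv; apply: nKv; exact: recession_finite.
  apply: (@linear_ge0 _ (wo p)) => r r1.
  have [+ _] := Rv p Kp r (le_trans ler01 r1).
  by rewrite woD woZ => /ltW.
pose x := aff p; pose c i := co v i.
have xr (r : R) : 0 <= r -> posV t (fun i => x i + r * c i) /\
    horo w t (fun i => x i + r * c i) <= s.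
  move=> r0; have [_ [[_ V] h]] := Rv p Kp (r * wo p) (mulr_ge0 r0 (ltW wp)).
  have E : aff (p + (r * wo p) *: v) = fun i => x i + r * c i.
    apply/funext => i; rewrite /aff coD coZ woD woZ wv mulr0 addr0 /x /c /aff.
    by field; rewrite gt_eqF.
  by move: V h; rewrite /horofun E.
have c0 i : (i < t)%N -> 0 <= c i.
  move=> it; apply: (@linear_ge0 _ (x i)) => r r1.
  by have [V _] := xr r (le_trans ler01 r1); exact/ltW/V.
(* Used with e = 1 against the quadratic terms, and with arbitrarily small e against the linear
   one. *)
have wln (e r : R) : 0 < e -> 0 <= r -> \sum_i w i * ln (x i + r * c i) <=
    \sum_i w i * (e * x i - ln e) + r * (e * \sum_i w i * c i).
  move=> e0 r0; rewrite !mulr_sumr -big_split/=; apply: ler_sum => i _.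
  have [it|ti] := ltnP i t; last by rewrite (weight0 hw ti) !mul0r !mulr0 addr0.
  have [V _] := xr r r0.
  apply: le_trans (ler_wpM2l (w_ge0 i) (ln_sublinear_eps e0 (V i it))) _.
  by rewrite le_eqVlt; apply/orP; left; apply/eqP; ring.
have cj j : (t < j)%N -> c j = 0.
  move=> tj; pose C := 2 * (s + \sum_i w i * (1 * x i - ln 1) +
      \sum_(i < n | i == t :> nat) x i).
  pose D := 2 * (1 * \sum_i w i * c i + \sum_(i < n | i == t :> nat) c i).
  apply: (@quadratic_le_linear _ (x j) _ C D) => r r0.
  have [_] := xr r r0; rewrite /horo [X in 2^-1 * X](bigD1 j)//=.
  have h0 : 0 <= \sum_(i < n | (t < i)%N && (i != j)) (x i + r * c i) ^+ 2.
    by apply: sumr_ge0 => i _; exact: sqr_ge0.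
  have h1 := wln 1 r ltr01 r0.
  have -> : \sum_(i < n | i == t :> nat) (x i + r * c i) =
    \sum_(i < n | i == t :> nat) x i + r * \sum_(i < n | i == t :> nat) c i.
    by rewrite mulr_sumr -big_split.
  move: h0 h1; rewrite /C /D.
  move: (\sum_(i < n | _ && _) _) (\sum_i w i * ln _) (\sum_(i < n | i == t :> nat) x i)
    (\sum_(i < n | i == t :> nat) c i) (\sum_i w i * (1 * x i - ln 1))
    (\sum_i w i * c i) => S1 S2 S3 S4 S5 S6 h0 h1 h2.
  lra.
have ct i : i = t :> nat -> 0 <= c i.
  move=> it; pose S := \sum_i w i * c i.
  have S0 : 0 <= S.
    apply: sumr_ge0 => k _; have [kt|tk] := ltnP k t; first by rewrite mulr_ge0 ?c0.
    by rewrite (weight0 hw tk) mul0r.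
  have key (e : R) : 0 < e -> 0 <= c i + e * S.
    move=> e0; apply: (@linear_ge0 _ (s + \sum_k w k * (e * x k - ln e) + x i)) => r r1.
    have r0 := le_trans ler01 r1; have [_] := xr r r0.
    rewrite /horo (sum_horo_index _ it).
    have h0 : 0 <= \sum_(k < n | (t < k)%N) (x k + r * c k) ^+ 2.
      by apply: sumr_ge0 => k _; exact: sqr_ge0.
    have h1 := wln e r e0 r0; move: h0 h1; rewrite -/S.
    move: (\sum_(k < n | (t < k)%N) (x k + r * c k) ^+ 2) (\sum_i w i * ln (x i + r * c i))
      (\sum_i w i * (e * x i - ln e)) => S1 S2 S3.
    lra.
  rewrite leNgt; apply/negP => ci.
  have S1 : 0 < 1 + S by rewrite ltr_pwDl.
  (* This e makes c_i + e S equal to c_i / (1 + S), which is negative. *)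
  have := key (- c i / (1 + S)); rewrite divr_gt0 ?oppr_gt0// => /(_ isT).
  have -> : c i + - c i / (1 + S) * S = c i / (1 + S).
    by field; rewrite gt_eqF.
  by rewrite ler_pdivlMr// mul0r leNgt ci.
split=> // i; rewrite leq_eqVlt => /orP[/eqP|]; [exact: ct|exact: c0].
Qed.

Lemma ideal_coneP v : Delta v <-> recession v /\ ~ KK v.
Proof.
split=> [dv|[Rv nKv]]; last exact: recession_ideal_cone.
by split; [exact: ideal_cone_recession|move=> [wv _]; case: dv => wv0; rewrite wv0 ltxx in wv].
Qed.

(** If A sent two points of the cone to opposite halves, a positive combination of them, still in
    the cone, would be sent to infinity. *)
Lemma cone_sign (A : mat) : (forall p, domM p <-> domM (A *m p)) ->
  exists2 e : R, e != 0 & forall p, KK p <-> KK ((e *: A) *m p).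
Proof.
move=> dA; have [p0 K0] := cone_nonempty; have [w0 d0] := K0.
have [[wA0 _] _] := (dA p0).1 d0.
have wD p : KK p -> wo (A *m p) != 0 by move=> [_ /dA[[]]].
pose e := Num.sg (wo (A *m p0)); have e0 : e != 0 by rewrite sgr_eq0.
have eA : 0 < e * wo (A *m p0) by rewrite -normrEsg normr_gt0.
have pos p : KK p -> 0 < e * wo (A *m p).
  move=> Kp; rewrite ltNge; apply/negP => le0.
  have lt0 : e * wo (A *m p) < 0.
    by rewrite lt_neqAle le0 andbT mulf_neq0// wD.
  (* The combination whose image has last coordinate 0. *)
  have Kc : KK ((- (e * wo (A *m p))) *: p0 + (e * wo (A *m p0)) *: p).
    by apply: cone_add; apply: cone_scale; rewrite ?oppr_gt0.
  have /eqP := wD _ Kc; apply.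
  rewrite mulmxDr -!scalemxAr woD !woZ; ring.
exists e => // p; split=> [Kp|].
  split; first by rewrite -scalemxAl woZ pos.
  by rewrite -scalemxAl; apply/(cusp_domain_scale e0)/(dA p).1; case: Kp.
move=> [wp]; rewrite -scalemxAl => /(cusp_domain_scaleE _ e0) /(dA p).2 /cusp_domain_cases[//|Kp].
have := pos _ Kp; move: wp; rewrite -scalemxAl woZ mulmxN -scaleN1r woZ.
lra.
Qed.

End Cone.

(** * Automorphisms of the cone permute its ideal directions *)

Section ConeAutomorphisms.
Context {R : realType} {n : nat} (w : 'I_n -> R) (t : nat) (s : R).
Local Notation vec := 'cV[R]_n.+1.
Local Notation mat := 'M[R]_n.+1.
Implicit Types (p q u v : vec) (i j k l m : 'I_n) (x : 'I_n -> R).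
Local Notation KK := (cusp_cone w t s).
Local Notation Delta := (@ideal_cone R n t).
Context (hw : cusp_weights w t) (n2 : (2 <= n)%N).
Context (A : mat) (uA : A \in unitmx) (KA : forall p, KK p <-> KK (A *m p)).

Let w_ge0 i : 0 <= w i. Proof. by case: hw. Qed.
Let w_gt0 i : (0 < w i) = (i < t)%N. Proof. by case: hw. Qed.
Let i0 : 'I_n := Ordinal (ltnW n2).
Let i1 : 'I_n := Ordinal n2.

Lemma cone_invmx q : KK q -> KK (invmx A *m q).
Proof. by move=> Kq; apply/KA; rewrite mulKVmx. Qed.

Lemma ideal_cone_A v : Delta v <-> Delta (A *m v).
Proof.
split=> /(ideal_coneP s hw n2) [Rv nK]; apply/(ideal_coneP s hw n2).
  split; last by rewrite -KA.
  move=> q /cone_invmx Kq r r0; have /KA := Rv _ Kq r r0.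
  by rewrite mulmxDr -scalemxAr mulKVmx.
split; last by rewrite KA.
move=> p /KA Kp r r0; have := Rv _ Kp r r0.
by move=> h; apply/KA; rewrite mulmxDr -scalemxAr.
Qed.

Lemma ideal_cone_ev i : (i <= t)%N -> Delta (ev i).
Proof.
move=> it; split; first exact: wo_ev.
  by move=> k _; rewrite co_ev.
by move=> j tj; rewrite co_ev; case: eqP => // ji; move: tj; rewrite ji ltnNge it.
Qed.

(** The ray of [ev i] is extreme in the ideal cone. If the image d has positive coordinate k, then d
    = u + v with u = d_k ev k and v both in the cone; pulled back, u must be a multiple of [ev i],
    so d is a multiple of [ev k]. *)
Lemma monomial i : (i <= t)%N -> exists2 k : 'I_n, (k <= t)%N &
  exists2 c : R, 0 < c & A *m ev i = c *: ev k.
Proof.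
move=> it; have De := ideal_cone_ev it; have DA := (ideal_cone_A _).1 De.
set d := A *m ev i in DA *; have [wd d0 dj] := DA.
have [k dk] : exists k, co d k != 0.
  apply: contrapT => h; have d00 : d = 0.
    apply: vec_ext => [k|]; last by rewrite wo0.
    by rewrite co0; apply/eqP; apply: contrapT => /negP dk; apply: h; exists k.
  have : co (ev i : vec) i = 0.
    by rewrite -[ev i](mulKmx uA) -/d d00 mulmx0 co0.
  by rewrite co_ev eqxx => /eqP; rewrite oner_eq0.
have kt : (k <= t)%N by rewrite leqNgt; apply: contraNN dk => /dj ->.
exists k => //; have dk0 : 0 < co d k by rewrite lt0r dk d0.
pose u : vec := co d k *: ev k; pose v : vec := d - u.
have Du : Delta u.
  have [e1 e2 e3] := ideal_cone_ev kt; split; first by rewrite woZ e1 mulr0.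
    by move=> l lt; rewrite coZ mulr_ge0 ?e2// ltW.
  by move=> j tj; rewrite coZ e3// mulr0.
have Dv : Delta v.
  split.
  - by rewrite /v -scaleN1r woD !woZ wd wo_ev; ring.
  - move=> l lt; rewrite /v -scaleN1r coD !coZ co_ev; have [->|_] := eqVneq l k.
      by rewrite mulr1 mulN1r subrr.
    by rewrite !mulr0 addr0 d0.
  - move=> j tj; rewrite /v -scaleN1r coD !coZ co_ev dj//; case: eqP => [jk|_];
      last by rewrite !mulr0 addr0.
    by move: tj; rewrite jk ltnNge kt.
have inv z : Delta z -> Delta (invmx A *m z).
  by move=> Dz; apply/ideal_cone_A; rewrite mulKVmx.
have [u1 u2 u3] := inv _ Du; have [v1 v2 v3] := inv _ Dv.
have uv : invmx A *m u + invmx A *m v = ev i.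
  by rewrite -mulmxDr /v addrC subrK /d mulKmx.
pose a := co (invmx A *m u) i.
have ue : invmx A *m u = a *: ev i.
  apply: vec_ext => [l|]; last by rewrite u1 woZ wo_ev mulr0.
  rewrite coZ co_ev; have [->|li] := eqVneq l i; first by rewrite mulr1.
  rewrite mulr0; have [tl|lt] := ltnP t l; first exact: u3.
  have : co (invmx A *m u) l + co (invmx A *m v) l = 0.
    by rewrite -coD uv co_ev (negbTE li).
  by have := u2 l lt; have := v2 l lt; lra.
have uE : u = a *: d by rewrite -(mulKVmx uA u) ue -scalemxAr.
have a0 : 0 < a.
  rewrite lt0r (u2 i it) andbT; apply: contraTneq dk0 => a0.
  have : co u k = 0 by rewrite uE a0 scale0r co0.
  by rewrite coZ co_ev eqxx mulr1 => ->; rewrite ltxx.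
exists (a^-1 * co d k); first by rewrite mulr_gt0 ?invr_gt0.
by rewrite -scalerA -/u uE scalerA mulVf ?gt_eqF// scale1r.
Qed.

(** Beyond t, where A need not act monomially, [sg] is completed by the identity and [c] by 1. *)
Lemma aut_perm : exists (sg : 'I_n -> 'I_n) (c : 'I_n -> R),
  [/\ injective sg, forall i, 0 < c i,
    forall i, (i <= t)%N -> (sg i <= t)%N /\ A *m ev i = c i *: ev (sg i)
    & forall i, (t < i)%N -> sg i = i].
Proof.
have ex i : exists kc : 'I_n * R, [/\ 0 < kc.2, (i <= t)%N ->
    (kc.1 <= t)%N /\ A *m ev i = kc.2 *: ev kc.1 & (t < i)%N -> kc.1 = i].
  have [it|ti] := leqP i t.
    by have [k kt [c c0 Ae]] := monomial it; exists (k, c); split.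
  by exists (i, 1).
have [f fP] := choice ex.
exists (fun i => (f i).1), (fun i => (f i).2); split.
- move=> i j e; have [ci Hi hi] := fP i; have [cj Hj hj] := fP j.
  have [it|ti] := leqP i t; have [jt|tj] := leqP j t.
  + have [_ Ai] := Hi it; have [_ Aj] := Hj jt.
    have ij : A *m ((f j).2 *: ev i) = A *m ((f i).2 *: ev j).
      by rewrite -!scalemxAr Ai Aj e !scalerA mulrC.
    have : (f j).2 *: ev i = (f i).2 *: ev j :> vec.
      by rewrite -[LHS](mulKmx uA) ij mulKmx.
    move=> /(congr1 (fun z => co z i)); rewrite !coZ !co_ev eqxx mulr1.
    by case: eqP => // _ /eqP; rewrite mulr0 gt_eqF.
  + by have [h _] := Hi it; have := tj; rewrite -(hj tj) -e ltnNge h.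
  + by have [h _] := Hj jt; have := ti; rewrite -(hi ti) e ltnNge h.
  + by rewrite -(hi ti) e (hj tj).
- by move=> i; case: (fP i).
- by move=> i; case: (fP i).
- by move=> i; case: (fP i).
Qed.

Lemma co_mul p k : co (A *m p) k =
  \sum_j co p j * co (A *m ev j) k + wo p * co (A *m ew) k.
Proof.
rewrite {1}[p]vecE mulmxDr mulmx_sumr coD co_sum -scalemxAr coZ.
by congr (_ + _); apply: eq_bigr => j _; rewrite -scalemxAr coZ.
Qed.

Lemma wo_mul p : wo (A *m p) =
  \sum_j co p j * wo (A *m ev j) + wo p * wo (A *m ew).
Proof.
rewrite {1}[p]vecE mulmxDr mulmx_sumr woD wo_sum -scalemxAr woZ.
by congr (_ + _); apply: eq_bigr => j _; rewrite -scalemxAr woZ.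
Qed.

Lemma affine_gt0_slope (a b : R) : (forall r : R, 0 < a + r * b) -> b = 0.
Proof.
move=> h; apply/eqP; rewrite eq_le; apply/andP; split.
  rewrite -oppr_ge0; apply: (@linear_ge0 _ a) => r _.
  by have := h (- r); rewrite mulNr mulrN => /ltW.
by apply: (@linear_ge0 _ a) => r _; exact/ltW/h.
Qed.

Lemma cone_fill x l : posV t x -> (l <= t)%N -> exists r : R, KK (mkv (upd x l r) 1).
Proof.
move=> Vx lt; have [r0 _ /(_ r0 (lexx _)) [V h]] := horo_lower hw s Vx lt.
by exists r0; exact: cone_mkv.
Qed.

Lemma upd_eq x i r : upd x i r i = r. Proof. by rewrite /upd eqxx. Qed.
Lemma upd_neq x i k r : k != i -> upd x i r k = x k.
Proof. by rewrite /upd => /negbTE ->. Qed.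

(** Raising coordinate l is free, as f l = 0, and brings any x with positive first coordinates into
    the cone; so the form is positive at all such x, whatever their level. Coordinates beyond t then
    range over all reals, which kills their coefficients and leaves only l'. *)
Lemma positive_form (f : 'I_n -> R) (b : R) l' l : (l <= t)%N -> l != l' ->
  (forall i, (i <= t)%N -> i != l' -> f i = 0) ->
  (forall p, KK p -> 0 < \sum_j co p j * f j + wo p * b) ->
  (forall j, (t < j)%N -> j != l' -> f j = 0) /\
  forall x, posV t x -> 0 < x l' * f l' + b.
Proof.
move=> lt ll' f0 fp.
have ev_form x r : \sum_j upd x l r j * f j = \sum_(j | j != l) x j * f j.
  rewrite (bigD1 l)//= f0// mulr0 add0r.
  by apply: eq_bigr => j jl; rewrite upd_neq.
have pos x : posV t x -> 0 < \sum_(j | j != l) x j * f j + b.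
  move=> Vx; have [r Kr] := cone_fill Vx lt; have := fp _ Kr.
  by rewrite wo_mkv mul1r; under eq_bigr do rewrite co_mkv; rewrite ev_form.
have fj j : (t < j)%N -> j != l' -> f j = 0.
  move=> tj jl'; have jl : j != l by apply: contraTneq tj => ->; rewrite -leqNgt.
  apply: (@affine_gt0_slope (\sum_(k | (k != l) && (k != j)) 1 * f k + b)) => r.
  have V1 : posV t (upd (fun=> 1) j r).
    apply: posV_upd => [k _|jt]; first exact: ltr01.
    by move: tj; rewrite ltnNge (ltnW jt).
  have := pos _ V1; rewrite (bigD1 j)//= upd_eq.
  under eq_bigr => k /andP[_ kj] do rewrite upd_neq//.
  by rewrite -addrA addrC.
split=> // x Vx; have := pos x Vx; rewrite (bigD1 l')/= 1?eq_sym// big1 ?addr0//.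
move=> k /andP[kl kl']; have [kt|tk] := leqP k t; first by rewrite f0// mulr0.
by rewrite fj// mulr0.
Qed.

(** Automorphisms are affine. The form wo o A is positive on the cone and vanishes on the ideal
    directions, so at most its coefficient at i1 survives; that one vanishes too, by its own
    argument when i1 lies beyond t. *)
Lemma wo_aut : exists2 a : R, 0 < a & forall p, wo (A *m p) = a * wo p.
Proof.
have [sg [c [_ _ Asg _]]] := aut_perm.
have f0 i : (i <= t)%N -> wo (A *m ev i) = 0.
  by move=> /Asg[_ ->]; rewrite woZ wo_ev mulr0.
have [||||fj fx] := @positive_form (fun j => wo (A *m ev j)) (wo (A *m ew)) i1 i0 => //.
- by move=> i /f0.
- by move=> p /KA[wp _]; rewrite -wo_mul.
have f1 : wo (A *m ev i1) = 0.
  have [|t1] := leqP i1 t; first exact: f0.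
  apply: (@affine_gt0_slope (wo (A *m ew))) => r; rewrite addrC.
  have V1 : posV t (upd (fun=> 1 : R) i1 r).
    apply: posV_upd => [k _|it]; first exact: ltr01.
    by have := t1; rewrite ltnNge (ltnW it).
  by have := fx _ V1; rewrite upd_eq.
exists (wo (A *m ew)).
  have /fx : posV t (fun _ : 'I_n => 1 : R) by move=> ? _; exact: ltr01.
  by rewrite f1 mulr0 add0r.
move=> p; rewrite wo_mul big1 ?add0r 1?mulrC// => j _.
have [jt|tj] := leqP j t; first by rewrite f0// mulr0.
have [->|ji] := eqVneq j i1; first by rewrite f1 mulr0.
by rewrite fj// mulr0.
Qed.

Lemma co_aut_gt0 p k : KK p -> (k < t)%N -> 0 < co (A *m p) k.
Proof.
move=> /KA[wp [[_ Vp] _]] kt; have := Vp k kt.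
by rewrite /aff pmulr_lgt0// invr_gt0.
Qed.

(** The index t is fixed: otherwise a coordinate that must stay positive would have nonzero slope
    along x_t, which takes all real values. For i < t, positivity reduces coordinate [sg i] of A p
    to c_i x_i + b, and letting x_i tend to 0, for A and then for its inverse, gives b = 0. *)
Lemma aut_forms : exists (sg : 'I_n -> 'I_n) (c : 'I_n -> R),
  [/\ injective sg, forall i, 0 < c i,
    forall i, (i < t)%N -> (sg i < t)%N,
    forall i, (t <= i)%N -> sg i = i
    & [/\ forall i, (i <= t)%N -> A *m ev i = c i *: ev (sg i)
    & forall p i, (i < t)%N -> co (A *m p) (sg i) = c i * co p i]].
Proof.
have [sg [c [isg c0 Asg sgt]]] := aut_perm.
have sgm m : m = t :> nat -> sg m = m.
  move=> mt; apply/eqP; apply: contrapT => /negP km; set k := sg m in km *.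
  have [kt Am] := Asg m (eq_leq mt).
  have {}kt : (k < t)%N by rewrite ltn_neqAle kt andbT -mt.
  have t0 : (0 < t)%N by exact: leq_trans kt.
  have im : i0 != m by apply: contraTneq t0 => h; rewrite -mt -h.
  have [||||_ fx] := @positive_form (fun j => co (A *m ev j) k) (co (A *m ew) k) m i0 => //.
  - move=> i it ik; have [_ ->] := Asg i it; rewrite coZ co_ev.
    case: eqP => [e|_]; last by rewrite mulr0.
    by move: ik; rewrite (isg _ _ (esym e)) eqxx.
  - by move=> p Kp; rewrite -co_mul co_aut_gt0.
  have /eqP : co (A *m ev m) k = 0.
    apply: (@affine_gt0_slope (co (A *m ew) k)) => r; rewrite addrC.
    have V1 : posV t (upd (fun=> 1 : R) m r).
      by apply: posV_upd => [? _|]; rewrite ?mt ?ltnn//; exact: ltr01.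
    by have := fx _ V1; rewrite upd_eq.
  by rewrite Am coZ co_ev eqxx mulr1 gt_eqF.
have sge i : (t <= i)%N -> sg i = i.
  by rewrite leq_eqVlt => /orP[/eqP/esym/sgm|/sgt].
have sgl i : (i < t)%N -> (sg i < t)%N.
  move=> it; have [kt _] := Asg i (ltnW it).
  rewrite ltn_neqAle kt andbT; apply/negP => /eqP kE.
  have tn : (t < n)%N by rewrite -kE.
  have e : sg (sg i) = sg i by exact: sgm.
  by have := isg _ _ e => e'; move: it; rewrite -e' kE ltnn.
exists sg, c; split => //; split; first by move=> i /Asg[].
move=> p i it; have [kt Ai] := Asg i (ltnW it).
(* An index l <= t other than i; when i = i0, the bound i < t gives i1 <= t. *)
pose l := if i == i0 then i1 else i0.
have li : l != i by rewrite /l; have [->|] := eqVneq i i0; last rewrite eq_sym.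
have lt : (l <= t)%N.
  by rewrite /l; case: eqP => // ii; rewrite ii in it.
have [||fj fx] := @positive_form (fun j => co (A *m ev j) (sg i))
    (co (A *m ew) (sg i)) i l lt li.
- move=> j jt ji; have [_ ->] := Asg j jt; rewrite coZ co_ev.
  case: eqP => [e|_]; last by rewrite mulr0.
  by move: ji; rewrite (isg _ _ (esym e)) eqxx.
- by move=> q Kq; rewrite -co_mul co_aut_gt0// sgl.
have ci : co (A *m ev i) (sg i) = c i by rewrite Ai coZ co_ev eqxx mulr1.
set b := co (A *m ew) (sg i) in fx.
have Vu (r : R) : 0 < r -> posV t (upd (fun _ : 'I_n => 1) i r).
  by move=> r0; apply: posV_upd => [? _|//]; exact: ltr01.
have small (a d : R) : 0 < d -> (forall r : R, 0 < r -> 0 < r * d + a) -> 0 <= a.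
  move=> d0 h; rewrite leNgt; apply/negP => a0.
  have := h (- a / (2 * d)); rewrite divr_gt0 ?oppr_gt0 ?mulr_gt0// => /(_ isT).
  have -> : - a / (2 * d) * d + a = a / 2 by field; rewrite gt_eqF.
  by rewrite pmulr_lgt0 ?invr_gt0// ltNge ltW.
have b0 : 0 <= b.
  apply: (small _ (c i)) => // r r0; have := fx _ (Vu r r0).
  by rewrite upd_eq ci.
have coE q : co (A *m q) (sg i) = c i * co q i + wo q * b.
  rewrite co_mul; congr (_ + _); rewrite (bigD1 i)//= ci mulrC big1 ?addr0// => j ji.
  have [jt|tj] := leqP j t; last by rewrite fj ?mulr0.
  have [_ ->] := Asg j jt; rewrite coZ co_ev; case: eqP => [e|_]; last by rewrite !mulr0.
  by move: ji; rewrite (isg _ _ (esym e)) eqxx.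
suff : b = 0 by move=> bz; rewrite coE bz mulr0 addr0.
have [a a0 wA] := wo_aut.
apply/eqP; rewrite eq_le b0 andbT -oppr_ge0.
(* The opposite inequality comes from the inverse automorphism. *)
apply: (small _ a) => // r r0; pose k := sg i.
pose l' := if k == i0 then i1 else i0.
have lk : l' != k by rewrite /l'; have [->|] := eqVneq k i0; last rewrite eq_sym.
have lt' : (l' <= t)%N.
  have := sgl i it; rewrite -/k => kt'.
  by rewrite /l'; case: eqP => // ii; rewrite ii in kt'.
have Vk : posV t (upd (fun _ : 'I_n => 1) k r).
  by apply: posV_upd => [? _|//]; exact: ltr01.
have [y Ky] := cone_fill Vk lt'.
have Kz := cone_invmx Ky; have := coE (invmx A *m mkv (upd (upd (fun=> 1) k r) l' y) 1).
have := wA (invmx A *m mkv (upd (upd (fun=> 1) k r) l' y) 1).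
rewrite mulKVmx// wo_mkv co_mkv -/k upd_neq 1?eq_sym// upd_eq => w1.
move: Kz; set q := invmx A *m _ => Kz e1; rewrite -/q in w1.
have : 0 < co q i.
  have [wq [[_ Vq] _]] := Kz; have := Vq i it.
  by rewrite /aff pmulr_lgt0// invr_gt0.
move=> /(mulr_gt0 (c0 i)); have : wo q = a^-1.
  by apply: (mulfI (lt0r_neq0 a0)); rewrite -w1 divff ?gt_eqF.
move=> wq h; have -> : r * a - b = a * (c i * co q i).
  by rewrite e1 wq; field; rewrite gt_eqF.
by rewrite mulr_gt0.
Qed.

End ConeAutomorphisms.

(** * Action of an automorphism on the horofunction and the flat coordinates *)

Section NormalizedAutomorphisms.
Context {R : realType} {n : nat} (w : 'I_n -> R) (t : nat) (s : R).
Local Notation vec := 'cV[R]_n.+1.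
Local Notation mat := 'M[R]_n.+1.
Implicit Types (p q u v : vec) (i j k l m : 'I_n) (x : 'I_n -> R).
Local Notation VV := (@cusp_chart R n t).
Local Notation hh := (horofun w t).
Local Notation YY := (flat_coord w t).
Local Notation uu := (vertical w t).
Local Notation KK := (cusp_cone w t s).
Local Notation hf := (horo w t).
Context (hw : cusp_weights w t) (n2 : (2 <= n)%N).

Let w_ge0 i : 0 <= w i. Proof. by case: hw. Qed.
Let w_gt0 i : (0 < w i) = (i < t)%N. Proof. by case: hw. Qed.
Let tn : (t <= n)%N. Proof. by case: hw. Qed.
Let i0 : 'I_n := Ordinal (ltnW n2).

Lemma horo_upd_lt x i r : posV t x -> (i <= t)%N -> x i < r ->
  hf (upd x i r) < hf x.
Proof.
move=> Vx; rewrite leq_eqVlt => /orP[/eqP it xr|it xr].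
  by rewrite (horo_upd_lin hw)//; lra.
rewrite (horo_upd_log w)// gtrDl pmulr_rlt0 ?w_gt0// subr_lt0 ltr_ln ?posrE//.
  exact: Vx.
exact: lt_trans (Vx i it) xr.
Qed.

Lemma aff_sub_ev p i r : wo p != 0 ->
  aff (p - r *: ev i) = upd (aff p) i (aff p i - r / wo p).
Proof.
move=> wp; apply/funext => k.
have wE : wo (p - r *: ev i) = wo p.
  by rewrite -scaleN1r woD !woZ wo_ev !mulr0 addr0.
have cE : co (p - r *: ev i) k = co p k - r * (k == i)%:R.
  by rewrite -scaleN1r coD !coZ co_ev mulN1r.
rewrite /aff wE cE /upd; have [->|_] := eqVneq k i; last by rewrite mulr0 subr0.
by rewrite mulr1 mulrBl.
Qed.

(** Detects the level s by the cone alone: points below it are those that can be moved backwards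
    along an ideal direction without leaving the cone, and A transports this condition. *)
Lemma horofun_ltP p i : (i <= t)%N -> KK p ->
  hh p < s <-> exists2 r : R, 0 < r & KK (p - r *: ev i).
Proof.
move=> it [wp [Vp hp]]; have [wp0 Vap] := Vp; split.
  move=> hlt; have oU : open [set p : vec | VV p /\ hh p < s] by exact: open_horofun_lt.
  have [e e0 eU] := open_line (- ev i) oU (conj Vp hlt).
  have e20 : 0 < e / 2 by rewrite divr_gt0.
  exists (e / 2) => //; have [] := eU (e / 2).
    by rewrite gtr0_norm//; lra.
  rewrite scalerN => Ve he; split; last by split=> //; exact: ltW.
  by rewrite -scaleN1r woD !woZ wo_ev !mulr0 addr0.
move=> [r r0 [wr [[_ Vr] hr]]]; apply: lt_le_trans hr.
rewrite aff_sub_ev// in Vr; rewrite /horofun aff_sub_ev//.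
have xe : aff p = upd (upd (aff p) i (aff p i - r / wo p)) i (aff p i).
  by apply/funext => k; rewrite /upd; case: eqP => // ->.
move: xe Vr; set y := upd _ i (_ - _) => xe Vr.
suff : hf (upd y i (aff p i)) < hf y by rewrite -xe.
apply: horo_upd_lt => //; rewrite /y upd_eq.
by rewrite ltrBlDr ltrDl divr_gt0.
Qed.

Context (A : mat) (uA : A \in unitmx) (KA : forall p, KK p <-> KK (A *m p))
  (wA : forall p, wo (A *m p) = wo p).

Lemma horofun_aut_lt p : KK p -> hh p < s <-> hh (A *m p) < s.
Proof.
have [sg [c [isg c0 sgl sge [Asg _]]]] := aut_forms hw n2 uA KA.
have i0t : (i0 <= t)%N by exact: leq0n.
have st : (sg i0 <= t)%N.
  have [h|h] := ltnP i0 t; first by rewrite ltnW// sgl.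
  by rewrite sge.
have shift p' r : A *m (p' - r *: ev i0) = A *m p' - (r * c i0) *: ev (sg i0).
  by rewrite mulmxBr -scalemxAr Asg// scalerA.
move=> Kp; have KAp := (KA p).1 Kp; split.
  move=> /(horofun_ltP i0t Kp)[r r0 Kr]; apply/(horofun_ltP st KAp).
  exists (r * c i0); first exact: mulr_gt0.
  by rewrite -shift -KA.
move=> /(horofun_ltP st KAp)[r r0 Kr]; apply/(horofun_ltP i0t Kp).
exists (r / c i0); first exact: divr_gt0.
by apply/KA; rewrite shift divfK ?gt_eqF.
Qed.

Lemma horofun_aut_eq p : KK p -> hh p = s -> hh (A *m p) = s.
Proof.
move=> Kp hs; have [_ [_ le]] := (KA p).1 Kp.
apply/eqP; rewrite eq_le le leNgt; apply/negP => /(horofun_aut_lt Kp).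
by rewrite hs ltxx.
Qed.

Definition affA x : 'I_n -> R := aff (A *m mkv x 1).

Lemma aff_mulA p : wo p != 0 -> aff (A *m p) = affA (aff p).
Proof.
move=> wp; rewrite /affA.
have {1}-> : p = wo p *: mkv (aff p) 1.
  by apply: vec_ext => [i|]; rewrite ?coZ ?woZ ?co_mkv ?wo_mkv ?mulr1// mulrC divfK.
by rewrite -scalemxAr aff_scale.
Qed.

Lemma affA_sum x k : affA x k = \sum_j x j * co (A *m ev j) k + co (A *m ew) k.
Proof.
rewrite /affA /aff wA wo_mkv divr1 co_mul wo_mkv mul1r.
by congr (_ + _); apply: eq_bigr => j _; rewrite co_mkv.
Qed.

Section Forms.
Context (sg : 'I_n -> 'I_n) (c : 'I_n -> R) (isg : injective sg)
  (c0 : forall i, 0 < c i) (sgl : forall i, (i < t)%N -> (sg i < t)%N)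
  (sge : forall i, (t <= i)%N -> sg i = i)
  (Asg : forall i, (i <= t)%N -> A *m ev i = c i *: ev (sg i))
  (coA : forall p i, (i < t)%N -> co (A *m p) (sg i) = c i * co p i).

Lemma reindex_sg (f : 'I_n -> R) (P : pred 'I_n) :
  \sum_(k | P k) f k = \sum_(i | P (sg i)) f (sg i).
Proof. by apply: reindex; exists (invF isg) => i _; rewrite ?invF_f ?f_invF. Qed.

Lemma sg_lt i : (sg i < t)%N = (i < t)%N.
Proof.
have [it|ti] := ltnP i t; first exact: sgl.
by rewrite sge// ltnNge ti.
Qed.

Lemma sg_le i : (sg i <= t)%N = (i <= t)%N.
Proof.
have [it|ti] := ltnP i t; last by rewrite sge.
by rewrite (ltnW it) ltnW// sgl.
Qed.

Lemma sg_surj k : exists i, sg i = k.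
Proof. by exists (invF isg k); rewrite f_invF. Qed.

Lemma affA_lt x i : (i < t)%N -> affA x (sg i) = c i * x i.
Proof. by move=> it; rewrite /affA /aff wA wo_mkv divr1 coA// co_mkv. Qed.

Lemma affA_gt x k : (t < k)%N -> affA x k =
  \sum_(j < n | (t < j)%N) x j * co (A *m ev j) k + co (A *m ew) k.
Proof.
move=> tk; rewrite affA_sum (bigID (fun j : 'I_n => (t < j)%N))/=.
rewrite [X in _ + X + _]big1 ?addr0// => j; rewrite -leqNgt => jt.
rewrite Asg// coZ co_ev; case: eqP => [e|_]; last by rewrite !mulr0.
by move: tk; rewrite e ltnNge sg_le jt.
Qed.

Lemma affA_eq x m : m = t :> nat -> affA x m = c m * x m +
  (\sum_(j < n | (t < j)%N) x j * co (A *m ev j) m + co (A *m ew) m).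
Proof.
move=> mt; have sm : sg m = m by apply: sge; rewrite mt.
rewrite affA_sum (bigID (fun j : 'I_n => (t < j)%N))/=.
have -> : \sum_(j < n | ~~ (t < j)%N) x j * co (A *m ev j) m = c m * x m; last by ring.
rewrite (bigD1 m)/= ?mt ?ltnn// big1 => [|j /andP[]].
  by rewrite addr0 Asg ?mt// sm coZ co_ev eqxx mulr1 mulrC.
rewrite -leqNgt => jt jm; rewrite Asg// coZ co_ev -sm (inj_eq isg) eq_sym (negbTE jm).
by rewrite !mulr0.
Qed.

Lemma posV_affA x : posV t x -> posV t (affA x).
Proof.
move=> Vx k; have [i <-] := sg_surj k; rewrite sg_lt => it.
by rewrite affA_lt// mulr_gt0// Vx.
Qed.

Lemma chart_aut p : VV p -> VV (A *m p).
Proof. by move=> [wp Vp]; split; rewrite ?wA// aff_mulA//; exact: posV_affA. Qed.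

Lemma horo_affA_eq x : posV t x -> hf x = s -> hf (affA x) = s.
Proof.
move=> Vx hx; have Kx : KK (mkv x 1) by apply: cone_mkv => //; rewrite hx.
by apply: (horofun_aut_eq Kx); rewrite /horofun aff_mkv.
Qed.

(* The function [hf] changes by a multiple of [c m] along the vertical
   direction [ev m], so it suffices to know it on the level [s]. *)
Lemma horo_affA_lin x m : m = t :> nat -> posV t x ->
  hf (affA x) - s = c m * (hf x - s).
Proof.
move=> mt Vx; pose z := upd x m (x m + (hf x - s)).
have Vz : posV t z by apply: posV_upd => //; rewrite mt ltnn.
have hz : hf z = s by rewrite (horo_upd_lin hw)//; ring.
have hAz := horo_affA_eq Vz hz.
have -> : affA x = upd (affA z) m (affA z m - c m * (hf x - s)).
  apply/funext => k; rewrite /upd; case: eqVneq => [->|km].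
    rewrite !affA_eq// /z upd_eq.
    have -> : \sum_(j < n | (t < j)%N) upd x m (x m + (hf x - s)) j * co (A *m ev j) m =
       \sum_(j < n | (t < j)%N) x j * co (A *m ev j) m.
      apply: eq_bigr => j tj; rewrite upd_neq//.
      by apply: contraTneq tj => ->; rewrite mt ltnn.
    by ring.
  have [kt|] := ltnP k t.
    have [i ik] := sg_surj k; rewrite -ik in kt *; rewrite sg_lt in kt.
    rewrite !affA_lt// /z upd_neq//.
    by apply: contraTneq kt => ->; rewrite mt ltnn.
  rewrite leq_eqVlt => /orP[/eqP tk|tk].
    by case/eqP: km; apply/val_inj; rewrite /= mt.
  rewrite !affA_gt//; congr (_ + _); apply: eq_bigr => j tj; rewrite /z upd_neq//.
  by apply: contraTneq tj => ->; rewrite mt ltnn.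
by rewrite (horo_upd_lin hw)// hAz; ring.
Qed.

Let one_ : 'I_n -> R := fun k => if (k < t)%N then 1 else 0.

Let posV_one : posV t one_.
Proof. by move=> i it; rewrite /one_ it ltr01. Qed.

(** Starting from a point with vanishing logarithms, multiplying x_i by the base of ln lowers h by
    w_i. It multiplies coordinate [sg i] of the image by the same number, lowering h there by
    [w (sg i)]. *)
Lemma weights_sg m i : m = t :> nat -> (i < t)%N -> w (sg i) = c m * w i.
Proof.
move=> mt it; pose x := upd one_ i (expR 1).
have Vx : posV t x by apply: posV_upd => //; rewrite expR_gt0.
have hx := horo_affA_lin mt Vx; have h1 := horo_affA_lin mt posV_one.
have e1 : hf x = hf one_ - w i.
  by rewrite (horo_upd_log w)// {2}/one_ it ln1 expRK; ring.
have e2 : affA x = upd (affA one_) (sg i) (c i * expR 1).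
  apply/funext => k; rewrite /upd; case: eqVneq => [->|ki].
    by rewrite affA_lt// /x upd_eq.
  have [kt|] := ltnP k t.
    have [l lk] := sg_surj k; rewrite -lk in kt ki *; rewrite sg_lt in kt.
    by rewrite !affA_lt// /x upd_neq//; apply: contraNneq ki => ->.
  rewrite leq_eqVlt => /orP[/eqP tk|tk].
    rewrite !affA_eq// /x upd_neq; last by apply: contraTneq it => <-; rewrite -tk ltnn.
    congr (_ + (_ + _)); apply: eq_bigr => j tj; rewrite /x upd_neq//.
    by apply: contraTneq tj => ->; rewrite -leqNgt ltnW.
  rewrite !affA_gt//; congr (_ + _); apply: eq_bigr => j tj; rewrite /x upd_neq//.
  by apply: contraTneq tj => ->; rewrite -leqNgt ltnW.
have e3 : hf (affA x) = hf (affA one_) - w (sg i).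
  rewrite e2 (horo_upd_log w) ?sgl// affA_lt// {2}/one_ it mulr1.
  by rewrite lnM ?posrE ?expR_gt0// expRK; ring.
by move: hx; rewrite e3 e1 mulrBr mulrBr; move: h1; rewrite mulrBr; lra.
Qed.

(** The total weight is positive and invariant under the permutation, but [weights_sg] multiplies it
    by [c m]. *)
Lemma scale_eq1 m : m = t :> nat -> (0 < t)%N -> c m = 1.
Proof.
move=> mt t0; pose S := \sum_(i < n | (i < t)%N) w i.
have S0 : 0 < S.
  rewrite /S (bigD1 i0)//= ltr_pwDl ?w_gt0//.
  by apply: sumr_ge0.
have : S = c m * S.
  rewrite {1}/S reindex_sg mulr_sumr; apply: eq_big => i; first exact: sg_lt.
  by rewrite sg_lt => it; exact: weights_sg.
by move=> /eqP; rewrite -{1}[S]mul1r (inj_eq (mulIf (lt0r_neq0 S0))) => /eqP.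
Qed.

(** Along the points [x r] both sides of [horo_affA_lin] are quadratic in r; the identity compares
    their leading coefficients. *)
Lemma quad_part m (y : 'I_n -> R) : m = t :> nat ->
  \sum_(k < n | (t < k)%N) (\sum_(j < n | (t < j)%N) y j * co (A *m ev j) k) ^+ 2 =
  c m * \sum_(j < n | (t < j)%N) y j ^+ 2.
Proof.
move=> mt.
pose x (r : R) k := if (k < t)%N then 1 else if (t < k)%N then r * y k else 0.
have Vx r : posV t (x r) by move=> i it; rewrite /x it ltr01.
pose L k := \sum_(j < n | (t < j)%N) y j * co (A *m ev j) k.
pose b k := co (A *m ew) k.
have xj r j : (t < j)%N -> x r j = r * y j.
  by move=> tj; rewrite /x tj ltnNge (ltnW tj).
have xm r : x r m = 0 by rewrite /x mt !ltnn.
have Lx r k : \sum_(j < n | (t < j)%N) x r j * co (A *m ev j) k = r * L k.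
  by rewrite /L mulr_sumr; apply: eq_bigr => j tj; rewrite xj// mulrA.
have hx r : hf (x r) = r ^+ 2 * (2^-1 * \sum_(j < n | (t < j)%N) y j ^+ 2).
  rewrite /horo big1 => [|i _]; last first.
    have [it|ti] := ltnP i t; last by rewrite (weight0 hw ti) mul0r.
    by rewrite /x it ln1 mulr0.
  rewrite (sum_horo_index _ mt) xm !oppr0 !add0r mulrCA; congr (_ * _).
  by rewrite mulr_sumr; apply: eq_bigr => j tj; rewrite xj// exprMn.
pose W := \sum_i w i * ln (affA (x 0) i).
have hA r : hf (affA (x r)) = - W - (r * L m + b m) +
    2^-1 * \sum_(k < n | (t < k)%N) (r * L k + b k) ^+ 2.
  rewrite /horo (sum_horo_index _ mt) affA_eq// Lx xm mulr0 add0r.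
  congr (- _ - _ + _ * _).
    rewrite [LHS]reindex_sg [RHS]reindex_sg; apply: eq_bigr => i _.
    have [it|ti] := ltnP i t; last by rewrite sge// (weight0 hw ti) !mul0r.
    by rewrite !affA_lt// /x it.
  by apply: eq_bigr => k tk; rewrite affA_gt// Lx.
have key r := horo_affA_lin mt (Vx r).
(* The values at 1, -1 and 0 isolate the coefficient of r^2. *)
have := key 1; have := key (-1); have := key 0.
rewrite !hx !hA.
have e (r : R) : \sum_(k < n | (t < k)%N) (r * L k + b k) ^+ 2 =
   r ^+ 2 * (\sum_(k < n | (t < k)%N) L k ^+ 2) +
   r * (\sum_(k < n | (t < k)%N) (L k * b k) *+ 2) + \sum_(k < n | (t < k)%N) b k ^+ 2.
  by rewrite !mulr_sumr -!big_split/=; apply: eq_bigr => k _; ring.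
rewrite !e -/(\sum_(k < n | (t < k)%N) L k ^+ 2).
move: (\sum_(k < n | (t < k)%N) L k ^+ 2) (\sum_(k < n | (t < k)%N) (L k * b k) *+ 2)
  (\sum_(k < n | (t < k)%N) b k ^+ 2) (\sum_(j < n | (t < j)%N) y j ^+ 2) => S1 S2 S3 S4.
lra.
Qed.

(** With no linear coordinate available, only the level s itself is known to be preserved. The test
    points [X d] lie on it whenever d is orthogonal to w: d = 0 gives C = 0, and d supported on two
    indices gives the proportionality of the weights. *)
Lemma weights_sg_full : t = n -> (forall i, w (sg i) = w i) /\
  forall x, posV t x -> hf (affA x) = hf x.
Proof.
move=> ten; have lt i : (i < t)%N by rewrite ten.
have Sw : \sum_i w i = 1 by case: hw => _ _ _; apply.
have Ssg : \sum_i w (sg i) = 1 by rewrite -Sw [RHS]reindex_sg.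
have hE x : hf x = - \sum_i w i * ln (x i).
  rewrite /horo [X in - _ - X]big1 => [|i /eqP it]; last by have := lt i; rewrite it ltnn.
  rewrite [X in _ * X]big1 => [|i ti]; last by have := lt i; rewrite ltnNge (ltnW ti).
  by rewrite subr0 mulr0 addr0.
pose C := \sum_i w (sg i) * ln (c i).
have hA x : posV t x -> hf (affA x) = - (\sum_i w (sg i) * ln (x i)) - C.
  move=> Vx; rewrite hE reindex_sg -opprD -big_split/=; congr (- _).
  apply: eq_bigr => i _; rewrite affA_lt// lnM ?posrE//; last exact: Vx.
  by rewrite -mulrDr addrC.
pose X (d : 'I_n -> R) i := expR (- s + d i).
have VX d : posV t (X d) by move=> i _; exact: expR_gt0.
have key d : \sum_i w i * d i = 0 -> - (\sum_i w (sg i) * (- s + d i)) - C = s.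
  move=> wd; rewrite -[RHS](@horo_affA_eq (X d))//.
    by rewrite hA//; congr (- _ - _); apply: eq_bigr => i _; rewrite expRK.
  rewrite hE; under eq_bigr do rewrite expRK mulrDr.
  by rewrite big_split/= wd -mulr_suml Sw; ring.
have C0 : C = 0.
  have := key (fun=> 0); rewrite big1 => [/(_ erefl)|i _]; last by rewrite mulr0.
  by under eq_bigr do rewrite addr0; rewrite -mulr_suml Ssg; lra.
have wE i : w (sg i) = w i.
  have wk k : w (sg i) * w k = w i * w (sg k).
    have [->|ik] := eqVneq i k; first by rewrite mulrC.
    (* Orthogonal to w and supported on i and k, so it isolates this pair of weights. *)
    pose d l := if l == i then w k else if l == k then - w i else 0.
    have S (f : 'I_n -> R) : \sum_l f l * d l = f i * w k - f k * w i.
      rewrite (bigD1 i)//= (bigD1 k) 1?eq_sym//= big1 => [|l /andP[li lk]].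
        by rewrite /d eqxx eq_sym (negbTE ik) eqxx; ring.
      by rewrite /d (negbTE li) (negbTE lk) mulr0.
    have := key d; rewrite S mulrC subrr C0 => /(_ erefl).
    under eq_bigr do rewrite mulrDr.
    rewrite big_split/= S -mulr_suml Ssg [w i * w (sg k)]mulrC.
    lra.
  have : \sum_k w (sg i) * w k = \sum_k w i * w (sg k) by apply: eq_bigr.
  by rewrite -!mulr_sumr Sw Ssg !mulr1.
split=> // x Vx; rewrite hA// C0 subr0 hE; congr (- _).
by apply: eq_bigr => i _; rewrite wE.
Qed.

(** In logarithmic coordinates the scalings c_i become translations, so the linear part of the
    action on Y is the permutation [sg] up to t and the linear part of A beyond. *)
Definition similarity_mx k i : R :=
  if (i <= t)%N then (k == sg i)%:R
  else if (t < k)%N then co (A *m ev i) k else 0.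

Local Notation M := similarity_mx.

Lemma similarity_mx_sg (y : 'I_n -> R) i : (i <= t)%N -> \sum_l M (sg i) l * y l = y i.
Proof.
move=> it; rewrite (bigD1 i)//= big1 => [|l li].
  by rewrite addr0 /M it eqxx mul1r.
rewrite /M; case: ifP => lt; last by rewrite ltnNge sg_le it mul0r.
by rewrite (inj_eq isg) eq_sym (negbTE li) mul0r.
Qed.

Lemma similarity_mx_gt (y : 'I_n -> R) k : (t < k)%N ->
  \sum_l M k l * y l = \sum_(j < n | (t < j)%N) y j * co (A *m ev j) k.
Proof.
move=> tk; rewrite (bigID (fun j : 'I_n => (t < j)%N))/= [X in _ + X]big1 => [|l].
  rewrite addr0; apply: eq_bigr => j tj.
  by rewrite /M leqNgt tj tk mulrC.
rewrite -leqNgt => lt; rewrite /M lt; case: eqP => [e|_]; last by rewrite mul0r.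
by move: tk; rewrite e ltnNge sg_le lt.
Qed.

Lemma vertical_gt k : (t < k)%N -> uu k = 0.
Proof.
move=> tk; rewrite /vertical (leq_ltn_trans _ (ltn_ord k)) ?(ltnW tk)//.
by rewrite gtn_eqF.
Qed.

Lemma sum_sg_split (f : 'I_n -> R) : \sum_k f k =
  \sum_(i < n | (i <= t)%N) f (sg i) + \sum_(k < n | (t < k)%N) f k.
Proof.
rewrite reindex_sg (bigID (fun j : 'I_n => (j <= t)%N))/=; congr (_ + _).
by apply: eq_big => i; rewrite -ltnNge// => ti; rewrite sge// ltnW.
Qed.

Lemma sum_split (f : 'I_n -> R) : \sum_k f k =
  \sum_(i < n | (i <= t)%N) f i + \sum_(k < n | (t < k)%N) f k.
Proof.
rewrite (bigID (fun j : 'I_n => (j <= t)%N))/=; congr (_ + _).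
by apply: eq_bigl => i; rewrite -ltnNge.
Qed.

(** The ratio a is the factor [c m] of the vertical direction when t < n; when t = n it is 1. *)
Lemma similarity_forms : exists2 a : R, 0 < a &
  [/\ (0 < t)%N -> a = 1, t = n -> a = 1,
    forall p, VV p -> hh (A *m p) - s = a * (hh p - s),
    forall i, (i < t)%N -> w (sg i) = w i
  & forall y : 'I_n -> R, \sum_(k < n | (t < k)%N)
     (\sum_(j < n | (t < j)%N) y j * co (A *m ev j) k) ^+ 2 =
    a * \sum_(j < n | (t < j)%N) y j ^+ 2].
Proof.
have [tlt|nt] := ltnP t n.
  pose m := Ordinal tlt; have mt : m = t :> nat by [].
  exists (c m); first exact: c0; split.
  - exact: scale_eq1.
  - by move=> e; have := tlt; rewrite e ltnn.
  - by move=> p [wp Vp]; rewrite /horofun aff_mulA//; exact: horo_affA_lin.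
  - move=> i it; rewrite (weights_sg mt it) (scale_eq1 mt) ?mul1r//.
    exact: leq_ltn_trans it.
  - by move=> y; exact: quad_part.
have ten : t = n by apply/eqP; rewrite eqn_leq tn nt.
have [wE hE] := weights_sg_full ten.
exists 1; first exact: ltr01; split => //.
- by move=> p [wp Vp]; rewrite mul1r /horofun aff_mulA// hE.
- have e (k : 'I_n) : (t < k)%N = false by rewrite ltnNge ten ltnW.
  by move=> y; rewrite !big_pred0 ?mulr0.
Qed.

End Forms.

(** In the coordinates (h, Y) an automorphism is a dilation of h about s with an affine map M Y +
    tau. Here M fixes u and is a similarity of ratio sqrt a on its orthogonal complement. For t > 0
    both blocks of M are isometric; for t = 0 the first block is the line of u, invisible on the
    complement. *)
Lemma aut_similarity : exists (a : R) (M : 'I_n -> 'I_n -> R) (tau : 'I_n -> R),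
  [/\ 0 < a, (0 < t)%N -> a = 1,
    forall p, VV p -> VV (A *m p) /\ hh (A *m p) - s = a * (hh p - s),
    forall p k, VV p -> YY (A *m p) k = \sum_i M k i * YY p i + tau k
  & [/\ forall y : 'I_n -> R, \sum_i y i * uu i = 0 ->
          \sum_k (\sum_i M k i * y i) ^+ 2 = a * \sum_i y i ^+ 2,
        forall k, \sum_i M k i * uu i = uu k,
        forall y : 'I_n -> R, \sum_k (\sum_i M k i * y i) * uu k = \sum_i y i * uu i
      & \sum_k tau k * uu k = 0]].
Proof.
have [sg [c [isg c0 sgl sge [Asg coA]]]] := aut_forms hw n2 uA KA.
have [a a0 [at1 an1 hA wsg qA]] := similarity_forms isg c0 sgl sge Asg coA.
pose M := similarity_mx sg.
(* The logarithms of the scalings up to t, the translation part of A beyond. *)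
pose tau k := \sum_(i < n | (i < t)%N) (k == sg i)%:R * (Num.sqrt (w i) * ln (c i)) +
  (t < k)%N%:R * co (A *m ew) k.
have usg i : (i <= t)%N -> uu (sg i) = uu i.
  rewrite /vertical => it; case: ifP => tlt; last first.
    have it' : (i < t)%N.
      by apply: leq_trans (ltn_ord i) _; rewrite leqNgt tlt.
    by rewrite wsg.
  move: it; rewrite leq_eqVlt => /orP[/eqP it|it]; first by rewrite sge ?it.
  by rewrite !ltn_eqF// sgl.
have M1 (y : 'I_n -> R) i : (i <= t)%N -> \sum_l M (sg i) l * y l = y i.
  exact: similarity_mx_sg.
have M2 (y : 'I_n -> R) k : (t < k)%N ->
    \sum_l M k l * y l = \sum_(j < n | (t < j)%N) y j * co (A *m ev j) k.
  exact: similarity_mx_gt.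
have tau_lt i : (i < t)%N -> tau (sg i) = Num.sqrt (w i) * ln (c i).
  move=> it; rewrite /tau (bigD1 i)//= eqxx mul1r big1 => [|l /andP[_ li]].
    by rewrite ltnNge ltnW ?sgl// mul0r !addr0.
  by rewrite (inj_eq isg) eq_sym (negbTE li) mul0r.
have tau_ge k : (t <= k)%N -> tau k = (t < k)%N%:R * co (A *m ew) k.
  move=> tk; rewrite /tau big1 ?add0r// => l lt.
  by case: eqP => [e|_]; [move: tk; rewrite e leqNgt sgl|rewrite mul0r].
have YYl p i : (i < t)%N ->
    YY p i = Num.sqrt (w i) * (ln (aff p i) + (t == n)%:R * hh p).
  by move=> it; rewrite /flat_coord [(t < i)%N]ltnNge (ltnW it) mul0r addr0.
have YYm p i : i = t :> nat -> YY p i = 0.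
  by move=> it; rewrite /flat_coord (sqrt_w0 hw) ?it// ltnn !mul0r addr0.
have YYg p i : (t < i)%N -> YY p i = aff p i.
  by move=> ti; rewrite /flat_coord (sqrt_w0 hw) ?(ltnW ti)// ti mul0r add0r mul1r.
clearbody M tau.
exists a, M, tau; split => //.
- by move=> p Vp; split; [exact: (chart_aut isg c0 sgl sge coA)|exact: hA].
- move=> p k Vp; have [wp Vap] := Vp.
  have [i <-] := sg_surj isg k; have [it|] := ltnP i t.
    rewrite (M1 _ _ (ltnW it)) (tau_lt _ it) (YYl _ _ it) (YYl _ _ (sgl _ it)).
    rewrite (wsg _ it) (aff_mulA wp) (affA_lt coA _ it) lnM ?posrE//; last exact: Vap.
    have h3 : (t == n)%:R * hh (A *m p) = (t == n)%:R * hh p :> R.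
      case: eqP => [/an1 a1|_]; last by rewrite !mul0r.
      by have := hA p Vp; rewrite a1 mul1r => /addIr ->.
    by rewrite h3; ring.
  rewrite leq_eqVlt => /orP[/eqP/esym ti|ti].
    have si : sg i = i by apply: sge; rewrite ti.
    rewrite M1 ?ti// tau_ge ?si ?ti// ltnn mul0r addr0.
    by rewrite !YYm.
  rewrite (sge _ (ltnW ti)) M2// (tau_ge _ (ltnW ti)) ti mul1r YYg// aff_mulA//.
  rewrite (affA_gt sgl sge Asg)//.
  by congr (_ + _); apply: eq_bigr => j tj; rewrite YYg.
split.
- move=> y y0; rewrite (sum_sg_split isg sge) [in RHS]sum_split mulrDr.
  congr (_ + _); last by rewrite -qA; apply: eq_bigr => k tk; rewrite M2.
  transitivity (\sum_(i < n | (i <= t)%N) y i ^+ 2).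
    by apply: eq_bigr => i it; rewrite M1.
  have [t0|] := posnP t; last by move=> /at1 ->; rewrite mul1r.
  rewrite big1 ?mulr0// => i it.
  have ii : i = i0 by apply/val_inj; move: it; rewrite t0 leqn0 => /eqP.
  move: y0; rewrite (bigD1 i0)//= big1 => [|k k0]; last first.
    by rewrite vertical_gt ?mulr0// t0 lt0n; apply: contraNneq k0 => k0; apply/eqP/val_inj.
  by rewrite /vertical t0 ltnW// eqxx mulr1 addr0 ii => ->; rewrite expr0n.
- move=> k; have [i <-] := sg_surj isg k; have [it|ti] := leqP i t.
    by rewrite M1// usg.
  rewrite sge 1?ltnW// M2// vertical_gt//.
  by rewrite big1// => j tj; rewrite vertical_gt// mul0r.
- move=> y; rewrite (sum_sg_split isg sge) [in RHS]sum_split; congr (_ + _).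
    by apply: eq_bigr => i it; rewrite M1// usg.
  by rewrite !big1// => k tk; rewrite vertical_gt// mulr0.
- rewrite (sum_sg_split isg sge) [X in _ + X]big1 => [|k tk]; last first.
    by rewrite vertical_gt// mulr0.
  rewrite addr0.
  have [tlt|nt] := ltnP t n.
    rewrite big1// => i; rewrite leq_eqVlt => /orP[/eqP it|it].
      by rewrite tau_ge sge ?it// ltnn !mul0r.
    by rewrite usg 1?ltnW// /vertical tlt ltn_eqF// mulr0.
  have ten : t = n by apply/eqP; rewrite eqn_leq tn nt.
  have lt i : (i < t)%N by rewrite ten.
  have [_ hE] := weights_sg_full isg c0 coA ten.
  have uE k : uu k = Num.sqrt (w k) by rewrite /vertical ten ltnn.
  (* For t = n, tau is orthogonal to u because the sum of w_i ln (c_i) vanishes, as the invariance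
     of h at the point (1, ..., 1) shows. *)
  transitivity (\sum_i w i * ln (c i)).
    apply: eq_big => i; first by rewrite ltnW.
    by move=> it; rewrite tau_lt// usg// uE mulrAC -expr2 sqr_sqrtr.
  have V1 : posV t (fun _ : 'I_n => 1 : R) by move=> i _; exact: ltr01.
  have := hE _ V1; rewrite /horo.
  have z (f : 'I_n -> R) : \sum_(i < n | i == t :> nat) f i = 0.
    by rewrite big1// => i /eqP it; have := lt i; rewrite it ltnn.
  have z2 (f : 'I_n -> R) : \sum_(i < n | (t < i)%N) f i = 0.
    by rewrite big1// => i ti; have := lt i; rewrite ltnNge ltnW.
  rewrite !z !z2 !mulr0 !subr0 !addr0 (reindex_sg isg) => h.
  have : \sum_i w i * ln (c i) = \sum_i w (sg i) * ln (affA (fun=> 1) (sg i)).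
    by apply: eq_bigr => i _; rewrite wsg// (affA_lt coA)// mulr1.
  move=> ->; apply: oppr_inj; rewrite h big1 ?oppr0// => i _.
  by rewrite ln1 mulr0.
Qed.


End NormalizedAutomorphisms.

(** * Linear isometries of the Lorentz form *)

Section LorentzGroup.
Context {R : realType} {n : nat}.
Local Notation vec := 'cV[R]_n.+1.
Local Notation mat := 'M[R]_n.+1.
Implicit Types (u v x : vec) (B : mat).

Lemma linear_mx (f : vec -> vec) : (forall (a : R) u v, f (a *: u + v) = a *: f u + f v) ->
  exists B : mat, forall v, f v = B *m v.
Proof.
move=> lf; have f0 : f 0 = 0.
  have := lf (-1) 0 0; rewrite scaler0 addr0 scaleN1r => e.
  by rewrite {1}e addNr.
have fZ (a : R) u : f (a *: u) = a *: f u by have := lf a u 0; rewrite f0 !addr0.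
have fD u v : f (u + v) = f u + f v by have := lf 1 u v; rewrite !scale1r.
exists (\matrix_(k, j) f (delta_mx j 0) k 0) => v.
have {1}-> : v = \sum_j v j 0 *: delta_mx j 0.
  by rewrite {1}[v]matrix_sum_delta; apply: eq_bigr => j _; rewrite big_ord1.
have -> : f (\sum_j v j 0 *: delta_mx j 0) = \sum_j v j 0 *: f (delta_mx j 0).
  by rewrite (big_morph f fD f0); apply: eq_bigr => j _; rewrite fZ.
by apply/colP => k; rewrite summxE !mxE; apply: eq_bigr => j _; rewrite !mxE mulrC.
Qed.

Lemma lorentz_polar u v :
  lorentz u v = 4^-1 * (lorentz (u + v) (u + v) - lorentz (u - v) (u - v)).
Proof.
have D x y z : lorentz (x + y) z = lorentz x z + lorentz y z.
  by rewrite -[x]scale1r lorentz_comb scale1r mul1r.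
have N x z : lorentz (- x) z = - lorentz x z.
  have Z0 : lorentz 0 z = 0 :> R.
    by rewrite lorentzE wo0 mul0r subr0 big1// => i _; rewrite co0 mul0r.
  by have := D x (- x) z; rewrite subrr Z0; lra.
have DD x y : lorentz (x + y) (x + y) = lorentz x x + lorentz y y + lorentz x y *+ 2.
  rewrite D !(lorentzC _ (x + y)) !D (lorentzC y x); ring.
rewrite (DD u v) (DD u (- v)) (lorentzC u (- v)) !N (lorentzC _ (- v)) N (lorentzC v u).
by field.
Qed.

Lemma lorentz_nondeg v : (forall x, lorentz v x = 0) -> v = 0.
Proof.
move=> h; apply: vec_ext => [i|]; rewrite ?co0 ?wo0.
  have := h (ev i); rewrite lorentzE wo_ev mulr0 subr0 (bigD1 i)//= co_ev eqxx mulr1.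
  by rewrite big1 ?addr0// => j ji; rewrite co_ev (negbTE ji) mulr0.
have := h ew; rewrite lorentzE wo_ew mulr1 big1 ?sub0r => [/eqP|i _]; last by rewrite co_ew mulr0.
by rewrite oppr_eq0 => /eqP.
Qed.

(** Polarization recovers the bilinear form, whose nondegeneracy makes B injective. *)
Lemma lorentz_unitmx B : (forall v, lorentz (B *m v) (B *m v) = lorentz v v) ->
  (forall u v, lorentz (B *m u) (B *m v) = lorentz u v) /\ B \in unitmx.
Proof.
move=> qB; have bB u v : lorentz (B *m u) (B *m v) = lorentz u v.
  by rewrite lorentz_polar -mulmxDr -mulmxBr !qB -lorentz_polar.
split=> //; rewrite -unitmx_tr -row_free_unit -kermx_eq0; apply/rowV0P => r /sub_kermxP rB.
have Br : B *m r^T = 0 by apply: trmx_inj; rewrite trmx_mul trmxK trmx0.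
apply: trmx_inj; rewrite trmx0; apply: lorentz_nondeg => x.
rewrite -bB Br lorentzE wo0 mul0r big1 ?subr0// => i _.
by rewrite co0 mul0r.
Qed.

Lemma preserves_unit B (X : set vec) : B \in unitmx ->
  (forall v, X v <-> X (B *m v)) -> preserves B X.
Proof.
move=> uB XB; apply/seteqP; split=> [_ [x Xx <-]|y Xy]; first by rewrite -XB.
by exists (invmx B *m y); rewrite ?mulKVmx// XB mulKVmx.
Qed.

End LorentzGroup.

(** * The developing map conjugates automorphisms to hyperbolic isometries *)

Section Isometries.
Context {R : realType} {n : nat} (w : 'I_n -> R) (t : nat) (s : R).
Local Notation vec := 'cV[R]_n.+1.
Local Notation mat := 'M[R]_n.+1.
Implicit Types (p q u v : vec) (i j k l : 'I_n).
Local Notation VV := (@cusp_chart R n t).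
Local Notation hh := (horofun w t).
Local Notation YY := (flat_coord w t).
Local Notation uu := (vertical w t).
Local Notation dev := (developing w t s).
Local Notation gg := (cusp_metric w t s).
Local Notation KK := (cusp_cone w t s).
Local Notation domM := (cusp_domain w t s).
Context (hw : cusp_weights w t) (n2 : (2 <= n)%N).

Definition null_vertical : vec := mkv uu 1.

Definition cusp_horosphere : set vec :=
  @hyperbolic_space R n `&` [set v | lorentz v null_vertical = -1].

Definition null_height v : R := wo v - \sum_i co v i * uu i.

Lemma lorentz_null v : lorentz v null_vertical = - null_height v.
Proof.
rewrite lorentzE wo_mkv mulr1 /null_height opprB; congr (_ - _).
by apply: eq_bigr => i _; rewrite co_mkv.
Qed.

Lemma horosphere_vertical : horosphere cusp_horosphere.
Proof.
exists null_vertical; split => //; last by have := @wo_mkv R n uu 1; rewrite /wo => ->.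
rewrite lorentz_null /null_height wo_mkv; under eq_bigr do rewrite co_mkv -expr2.
by rewrite vertical_norm// subrr oppr0.
Qed.

Lemma null_height_gt0 v : hyperbolic_space v -> 0 < null_height v.
Proof.
move=> [vv w0]; rewrite /null_height; set b := \sum_i _.
have : 0 <= \sum_i (co v i - b * uu i) ^+ 2 by apply: sumr_ge0 => i _; exact: sqr_ge0.
have -> : \sum_i (co v i - b * uu i) ^+ 2 = \sum_i co v i * co v i - b ^+ 2.
  transitivity (\sum_i co v i * co v i - (b *+ 2) * b + b ^+ 2 * \sum_i uu i ^+ 2).
    rewrite !mulr_sumr -sumrN -!big_split/=; apply: eq_bigr => i _; ring.
  by rewrite vertical_norm//; ring.
have -> : \sum_i co v i * co v i = wo v * wo v - 1.
  by move: vv; rewrite lorentzE => /eqP; rewrite subr_eq => /eqP ->; ring.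
rewrite -/(wo v) in w0 => h; rewrite ltNge; apply/negP => ab.
nra.
Qed.

(** The upper sheet is recognised by [null_height], which the isometries built below preserve,
    instead of by the last coordinate. *)
Lemma hyperbolicP v : hyperbolic_space v <-> lorentz v v = -1 /\ 0 < null_height v.
Proof.
split=> [Hv|[vv av]]; first by split; [case: Hv|exact: null_height_gt0].
by split => //; exact: (hyperbolic_null hw n2 vv av).
Qed.

Section Matrix.
Context (M : 'I_n -> 'I_n -> R) (tau : 'I_n -> R)
  (Mq : forall y : 'I_n -> R, \sum_i y i * uu i = 0 ->
          \sum_k (\sum_i M k i * y i) ^+ 2 = \sum_i y i ^+ 2)
  (Mu : forall k, \sum_i M k i * uu i = uu k)
  (Mdot : forall y : 'I_n -> R,
    \sum_k (\sum_i M k i * y i) * uu k = \sum_i y i * uu i)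
  (tauu : \sum_k tau k * uu k = 0).

Let Mv (y : 'I_n -> R) k := \sum_i M k i * y i.
Let T := \sum_k tau k ^+ 2.
Let ka v := \sum_k Mv (co v) k * tau k + 2^-1 * null_height v * T.

(** Split y into its components along u and orthogonal to u: M fixes the first, preserves the length
    of the second and keeps them orthogonal. *)
Lemma Mv_norm (y : 'I_n -> R) : \sum_k Mv y k ^+ 2 = \sum_i y i ^+ 2.
Proof.
pose b := \sum_i y i * uu i; pose z i := y i - b * uu i.
have z0 : \sum_i z i * uu i = 0.
  transitivity (b - b * \sum_i uu i ^+ 2); last by rewrite vertical_norm//; ring.
  by rewrite mulr_sumr -sumrB; apply: eq_bigr => i _; rewrite /z; ring.
have MvE k : Mv y k = Mv z k + b * uu k.
  rewrite -[uu k]Mu mulr_sumr -big_split/=; apply: eq_bigr => i _; rewrite /z; ring.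
have e1 : \sum_i y i ^+ 2 = \sum_i z i ^+ 2 + b ^+ 2.
  transitivity (\sum_i z i ^+ 2 + (b *+ 2) * (\sum_i z i * uu i) + b ^+ 2 * \sum_i uu i ^+ 2).
    by rewrite !mulr_sumr -!big_split/=; apply: eq_bigr => i _; rewrite /z; ring.
  by rewrite z0 vertical_norm//; ring.
rewrite e1 -(Mq z0).
transitivity (\sum_k Mv z k ^+ 2 + (b *+ 2) * (\sum_k Mv z k * uu k) + b ^+ 2 * \sum_i uu i ^+ 2).
  by rewrite !mulr_sumr -!big_split/=; apply: eq_bigr => k _; rewrite MvE; ring.
by rewrite Mdot z0 vertical_norm//; ring.
Qed.

(** The isometry fixing the null vector (u, 1) and acting on horospheres by M Y + tau. The
    coefficient [ka] of (u, 1) is the one forced by invariance of the Lorentz form. *)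
Let Bf v : vec := mkv (fun k => Mv (co v) k + null_height v * tau k + ka v * uu k) (wo v + ka v).

Lemma Bf_linear (a : R) u v : Bf (a *: u + v) = a *: Bf u + Bf v.
Proof.
have MvD k : Mv (co (a *: u + v)) k = a * Mv (co u) k + Mv (co v) k.
  rewrite /Mv mulr_sumr -big_split/=; apply: eq_bigr => i _; rewrite co_comb; ring.
have alD : null_height (a *: u + v) = a * null_height u + null_height v.
  rewrite /null_height wo_comb.
  have -> : \sum_i co (a *: u + v) i * uu i = a * (\sum_i co u i * uu i) + \sum_i co v i * uu i.
    by rewrite mulr_sumr -big_split/=; apply: eq_bigr => i _; rewrite co_comb; ring.
  by ring.
have kaD : ka (a *: u + v) = a * ka u + ka v.
  rewrite /ka alD.
  have -> : \sum_k Mv (co (a *: u + v)) k * tau k =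
     a * (\sum_k Mv (co u) k * tau k) + \sum_k Mv (co v) k * tau k.
    by rewrite mulr_sumr -big_split/=; apply: eq_bigr => k _; rewrite MvD; ring.
  by ring.
apply: vec_ext => [k|]; first by rewrite co_comb !co_mkv MvD alD kaD; ring.
by rewrite wo_comb !wo_mkv wo_comb kaD; ring.
Qed.

Lemma Bf_null_height v : null_height (Bf v) = null_height v.
Proof.
rewrite /null_height wo_mkv.
have -> : \sum_i co (Bf v) i * uu i = \sum_k Mv (co v) k * uu k +
   null_height v * (\sum_k tau k * uu k) + ka v * \sum_k uu k ^+ 2.
  rewrite !mulr_sumr -!big_split/=; apply: eq_bigr => k _; rewrite co_mkv; ring.
by rewrite Mdot tauu vertical_norm//; ring.
Qed.

Lemma Bf_lorentz v : lorentz (Bf v) (Bf v) = lorentz v v.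
Proof.
rewrite !lorentzE wo_mkv.
have -> : \sum_i co (Bf v) i * co (Bf v) i = \sum_k Mv (co v) k ^+ 2 + null_height v ^+ 2 * T +
   ka v ^+ 2 * (\sum_k uu k ^+ 2) + (null_height v *+ 2) * (\sum_k Mv (co v) k * tau k) +
   (ka v *+ 2) * (\sum_k Mv (co v) k * uu k) + (null_height v * ka v *+ 2) * (\sum_k tau k * uu k).
  rewrite /T !mulr_sumr -!big_split/=; apply: eq_bigr => k _; rewrite co_mkv; ring.
rewrite Mv_norm vertical_norm// Mdot tauu.
have -> : \sum_i co v i ^+ 2 = \sum_i co v i * co v i.
  by apply: eq_bigr => i _; rewrite expr2.
have -> : \sum_i co v i * uu i = wo v - null_height v by rewrite /null_height; ring.
have -> : \sum_k Mv (co v) k * tau k = ka v - 2^-1 * null_height v * T by rewrite /ka; ring.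
by field.
Qed.

Lemma Bf_developing p q : hh q = hh p ->
  (forall k, YY q k = \sum_i M k i * YY p i + tau k) -> dev q = Bf (dev p).
Proof.
move=> hE YE.
have aE : horo_scale w t s q = horo_scale w t s p by rewrite /horo_scale hE.
set a := horo_scale w t s p in aE; have a0 : a != 0 by rewrite gt_eqF// horo_scale_gt0.
pose Q := scaled_coord w t s p.
have QE k : scaled_coord w t s q k = Mv Q k + a * tau k.
  rewrite /scaled_coord aE YE mulrDr /Mv mulr_sumr; congr (_ + _).
  by apply: eq_bigr => i _; rewrite /Q /scaled_coord -/a; ring.
have MvE k : Mv (co (dev p)) k = Mv Q k + null_coord w t s p * uu k.
  rewrite -[uu k]Mu mulr_sumr -big_split/=; apply: eq_bigr => i _.
  by rewrite co_mkv /Q; ring.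
have alE : null_height (dev p) = a by rewrite /null_height developing_null.
pose m := \sum_k Mv Q k * tau k.
have kaE : ka (dev p) = m + 2^-1 * a * T.
  rewrite /ka alE; congr (_ + _).
  transitivity (m + null_coord w t s p * \sum_k tau k * uu k); last by rewrite tauu mulr0 addr0.
  by rewrite /m mulr_sumr -big_split/=; apply: eq_bigr => k _; rewrite MvE; ring.
have kE : null_coord w t s q = null_coord w t s p + ka (dev p).
  rewrite kaE /null_coord aE -/a.
  have -> : \sum_i scaled_coord w t s q i ^+ 2 = \sum_i Q i ^+ 2 + a *+ 2 * m + a ^+ 2 * T.
    rewrite -(Mv_norm Q) /m /T !mulr_sumr -!big_split/=; apply: eq_bigr => k _.
    by rewrite QE; ring.
  by rewrite -/Q; field.
apply: vec_ext => [k|]; last by rewrite !wo_mkv kE aE -/a; ring.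
by rewrite !co_mkv QE MvE alE kE; ring.
Qed.

Lemma Bf_matrix : exists B : mat, [/\ lorentz_isometry B, preserves B cusp_horosphere &
  forall p q, hh q = hh p -> (forall k, YY q k = \sum_i M k i * YY p i + tau k) ->
    dev q = B *m dev p].
Proof.
have [B BE] := linear_mx Bf_linear.
have [bB uB] : (forall u v, lorentz (B *m u) (B *m v) = lorentz u v) /\ B \in unitmx.
  by apply: lorentz_unitmx => v; rewrite -BE Bf_lorentz.
have HB v : hyperbolic_space v <-> hyperbolic_space (B *m v).
  by rewrite !hyperbolicP bB -BE Bf_null_height.
exists B; split.
- by split=> //; exact: preserves_unit.
- apply: preserves_unit => // v; split=> -[Hv]; rewrite /= lorentz_null => hv.
    by split; [exact: (HB v).1|rewrite /= lorentz_null -BE Bf_null_height].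
  by split; [exact: (HB v).2|rewrite /= lorentz_null -[null_height v]Bf_null_height BE].
- by move=> p q h y; rewrite -BE; exact: Bf_developing.
Qed.

End Matrix.

Lemma aut_normal (A : mat) : A \in unitmx -> (forall p, domM p <-> domM (A *m p)) ->
  exists2 e : R, e != 0 & [/\ e *: A \in unitmx,
    forall p, KK p <-> KK ((e *: A) *m p) & forall p, wo ((e *: A) *m p) = wo p].
Proof.
move=> uA dA; have [e e0 KA] := cone_sign hw n2 dA.
have uZ (c : R) : c != 0 -> c *: A \in unitmx.
  by move=> c0; rewrite unitmxZ// unitfE.
have [a a0 wA] := wo_aut hw n2 (uZ _ e0) KA.
have a'0 : a^-1 != 0 by rewrite invr_neq0// gt_eqF.
have E p : ((a^-1 * e) *: A) *m p = a^-1 *: ((e *: A) *m p).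
  by rewrite -scalerA -[in LHS]scalemxAl.
exists (a^-1 * e); first by rewrite mulf_neq0.
split; first by rewrite uZ// mulf_neq0.
  move=> p; rewrite E KA; split=> Kp; first by apply: (cone_scale _ Kp); rewrite invr_gt0.
  by have := cone_scale a0 Kp; rewrite scalerA divff ?gt_eqF// scale1r.
by move=> p; rewrite E woZ wA mulKf// gt_eqF.
Qed.

Lemma mul_scale_horofun (A : mat) (e : R) p : e != 0 -> hh ((e *: A) *m p) = hh (A *m p).
Proof. by move=> e0; rewrite -scalemxAl horofun_scale. Qed.

Lemma chart_scaleE (c : R) p : c != 0 -> VV (c *: p) <-> VV p.
Proof.
move=> c0; split; last exact: chart_scale.
by move=> /(chart_scale (invr_neq0 c0)); rewrite scalerA mulVf// scale1r.
Qed.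

Lemma aut_horofun_scale (A : mat) : A \in unitmx -> (forall p, domM p <-> domM (A *m p)) ->
  exists2 a : R, 0 < a & ((0 < t)%N -> a = 1) /\
    forall p, VV p -> VV (A *m p) /\ hh (A *m p) - s = a * (hh p - s).
Proof.
move=> uA dA; have [e e0 [ueA KA wA]] := aut_normal uA dA.
have [a [M [tau [a0 at1 hA _ _]]]] := aut_similarity hw n2 ueA KA wA.
exists a => //; split=> // p /hA; rewrite mul_scale_horofun// -scalemxAl.
by rewrite chart_scaleE.
Qed.

(** A point where h - s can be cancelled, so that the factor of an automorphism can be read off. *)
Lemma exists_horofun_neq : exists2 p, VV p & hh p != s.
Proof.
have [p Kp] := cone_nonempty s hw n2; have [wp [Vp hp]] := Kp.
have i0t : (Ordinal (ltnW n2) <= t)%N by exact: leq0n.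
have [h|h] := eqVneq (hh p) s; last by exists p.
have V1 : posV t (upd (aff p) (Ordinal (ltnW n2)) (aff p (Ordinal (ltnW n2)) + 1)).
  by apply: posV_upd => [|it]; [case: Vp|rewrite addr_gt0//; case: Vp => _; apply].
exists (mkv (upd (aff p) (Ordinal (ltnW n2)) (aff p (Ordinal (ltnW n2)) + 1)) 1).
  by split; rewrite ?wo_mkv ?oner_neq0// aff_mkv.
rewrite /horofun aff_mkv lt_eqF// -h; apply: horo_upd_lt => //; first by case: Vp.
by rewrite ltrDl.
Qed.

Lemma aut_isometry (A : mat) : A \in unitmx -> (forall p, domM p <-> domM (A *m p)) ->
  (forall p, VV p -> hh (A *m p) = hh p) ->
  exists B : mat, [/\ lorentz_isometry B, preserves B cusp_horosphere &
    forall p, VV p -> VV (A *m p) /\ dev (A *m p) = B *m dev p].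
Proof.
move=> uA dA hA; have [e e0 [ueA KA wA]] := aut_normal uA dA.
have [a [M [tau [a0 at1 hE YE [M1 M2 M3 M4]]]]] := aut_similarity hw n2 ueA KA wA.
have a1 : a = 1.
  have [p Vp hp] := exists_horofun_neq; have [_] := hE p Vp.
  rewrite mul_scale_horofun// hA// -{1}[_ - _]mul1r.
  by move=> /mulIf -> //; rewrite subr_eq0.
rewrite a1 in M1.
have [|B [iB SB dB]] := Bf_matrix _ M2 M3 M4.
  by move=> y /M1; rewrite mul1r.
exists B; split => // p Vp; have [VA _] := hE p Vp.
rewrite -scalemxAl chart_scaleE// in VA; split => //; apply: dB; first exact: hA.
move=> k; rewrite -YE// -scalemxAl /flat_coord /horofun aff_scale//.
Qed.

(** Differentiate the relation dev (A p) = B (dev p); the Lorentz isometry B then cancels. *)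
Lemma cusp_metric_aut (A : mat) p u v : A \in unitmx -> (forall p, domM p <-> domM (A *m p)) ->
  (forall p, VV p -> hh (A *m p) = hh p) -> VV p ->
  gg (A *m p) (A *m u) (A *m v) = gg p u v.
Proof.
move=> uA dA hA Vp; have [B [[bB _] _ dB]] := aut_isometry uA dA hA.
have dev_d q : VV q -> differentiable dev q by exact: developing_diff.
have [VAp _] := dB p Vp.
have D x : 'D_(A *m x) dev (A *m p) = B *m 'D_x dev p.
  have cA := @mulmx_continuous R n.+1 n.+1 1 A.
  have cB := @mulmx_continuous R n.+1 n.+1 1 B.
  rewrite -[LHS](@derive_comp_linear _ _ _ _ (mulmx A) dev p x cA (dev_d _ VAp)).
  rewrite -[RHS](@derive_linear_comp _ _ _ _ (mulmx B) dev p x cB (dev_d _ Vp)).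
  apply: near_eq_derive.
  have : nbhs p VV by apply: open_nbhs_nbhs; split=> //; exact: open_chart.
  by apply: filterS => q /dB[].
by rewrite /cusp_metric !D bB.
Qed.

End Isometries.

(** * Automorphisms normalizing a parabolic lattice *)

Section Pigeonhole.
Context {R : realType}.

Lemma truncn_close (x y : R) : 0 <= x -> 0 <= y ->
  Num.truncn x = Num.truncn y -> `|x - y| < 1.
Proof.
move=> x0 y0 e; have := truncn_itv x0; have := truncn_itv y0; rewrite e.
rewrite -[(_.+1)%:R]natr1 => /andP[y1 y2] /andP[x1 x2].
by rewrite ltr_norml; apply/andP; split; lra.
Qed.

(** Cut the cube containing all the matrices into finitely many boxes of side e; among enough
    matrices two share a box. *)
Lemma bounded_pigeonhole (m k : nat) (f : nat -> 'M[R]_(m, k)) (C e : R) : 0 < e ->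
  (forall l i j, `|f l i j| <= C) ->
  exists a b : nat, (a < b)%N /\ forall i j, `|f a i j - f b i j| < e.
Proof.
move=> e0 fC.
pose g l i j := Num.truncn ((f l i j + C) / e).
pose N := (Num.truncn ((C + C) / e)).+1.
have ge0 l i j : 0 <= (f l i j + C) / e.
  by rewrite divr_ge0 ?(ltW e0)//; have := fC l i j; rewrite ler_norml => /andP[]; lra.
have gN l i j : (g l i j < N)%N.
  rewrite /N ltnS; apply: le_truncn; rewrite ler_pM2r ?invr_gt0// lerD2r.
  by have := fC l i j; rewrite ler_norml => /andP[].
(* One index more than there are boxes. *)
pose G (l : 'I_(#|{ffun 'I_m * 'I_k -> 'I_N}|.+1)) :=
  [ffun ij : 'I_m * 'I_k => Ordinal (gN l ij.1 ij.2)].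
have [a [b [ab Gab]]] : exists a b, a != b /\ G a = G b.
  apply: contrapT => h; have /leq_card : injective G.
    move=> a b Gab; apply/eqP; apply: contrapT => /negP ab.
    by apply: h; exists a, b.
  by rewrite card_ord ltnn.
have close i j : `|f a i j - f b i j| < e.
  have := congr1 (fun z : {ffun 'I_m * 'I_k -> 'I_N} => val (z (i, j))) Gab.
  rewrite !ffunE /= => /truncn_close => /(_ (ge0 _ _ _) (ge0 _ _ _)).
  rewrite -mulrBl normrM (gtr0_norm (_ : 0 < e^-1)) ?invr_gt0// ltr_pdivrMr// mul1r.
  by congr (_ < _); congr (`|_|); ring.
case: (ltngtP (a : nat) b) => [ab'|ba'|e']; first by exists a, b.
  by exists b, a; split=> // i j; rewrite distrC.
by move: ab; rewrite (val_inj e') eqxx.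
Qed.

End Pigeonhole.

Section HoroPreserving.
Context {R : realType} {n : nat} (w : 'I_n -> R) (t : nat).
Local Notation mat := 'M[R]_n.+1.
Local Notation VV := (@cusp_chart R n t).
Local Notation hh := (horofun w t).

(** The group [G_ psi] in terms of the chart: preserving every level set means preserving the chart
    and the value of h. *)
Definition horo_preserving : set mat :=
  [set A | A \in unitmx /\ forall p, (VV p <-> VV (A *m p)) /\
     (VV p -> hh (A *m p) = hh p)].

Lemma horo_preserving_cusp_domain s A : horo_preserving A ->
  forall p, cusp_domain w t s p <-> cusp_domain w t s (A *m p).
Proof.
move=> [_ hA] p; have [VA hE] := hA p; split=> -[Vp hp].
  by split; [exact/VA|rewrite hE].
have Vp' := VA.2 Vp; by split => //; rewrite -hE.
Qed.

End HoroPreserving.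

(** * The flat distance on horospheres *)

Section FlatMetric.
Context {R : realType} {n : nat} (w : 'I_n -> R) (t : nat) (s : R).
Local Notation vec := 'cV[R]_n.+1.
Local Notation mat := 'M[R]_n.+1.
Implicit Types (p q u v : vec) (i j k l : 'I_n) (A B D : mat).
Local Notation VV := (@cusp_chart R n t).
Local Notation hh := (horofun w t).
Local Notation YY := (flat_coord w t).
Local Notation uu := (vertical w t).
Local Notation domM := (cusp_domain w t s).
Context (hw : cusp_weights w t) (n2 : (2 <= n)%N).

Definition flat_dist2 p q : R := \sum_k (YY p k - YY q k) ^+ 2.

Local Notation dist2 := flat_dist2.

Lemma dist2_eq0 p q : dist2 p q = 0 -> YY p = YY q.
Proof.
move=> /eqP; rewrite psumr_eq0 => [/allP h|k _]; last exact: sqr_ge0.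
by apply/funext => k; have := h k (mem_index_enum k); rewrite sqrf_eq0 subr_eq0 => /eqP.
Qed.

Lemma dist2_refl p q : YY p = YY q -> dist2 p q = 0.
Proof. by move=> e; rewrite /flat_dist2 e big1// => k _; rewrite subrr expr0n. Qed.

Lemma flat_coord_scale (c : R) p : c != 0 -> YY (c *: p) = YY p.
Proof. by move=> c0; apply/funext => k; rewrite /flat_coord /horofun aff_scale. Qed.

(** The last clause is the fixed point of a similarity of ratio different from 1. *)
Lemma aut_dist2 A : A \in unitmx -> (forall p, domM p <-> domM (A *m p)) ->
  exists2 a : R, 0 < a & [/\
    forall p, VV p -> VV (A *m p) /\ hh (A *m p) - s = a * (hh p - s),
    forall p q, VV p -> VV q -> dist2 (A *m p) (A *m q) = a * dist2 p q
  & a != 1 -> exists2 y : 'I_n -> R, \sum_k y k * uu k = 0 &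
      forall p, VV p -> YY p = y -> YY (A *m p) = y].
Proof.
move=> uA dA; have [e e0 [ueA KA wA]] := aut_normal hw n2 uA dA.
have [a [M [tau [a0 _ hA YE [M1 M2 M3 M4]]]]] := aut_similarity hw n2 ueA KA wA.
have Ye p k : VV p -> YY (A *m p) k = \sum_i M k i * YY p i + tau k.
  by move=> Vp; rewrite -YE// -scalemxAl flat_coord_scale.
exists a => //; split.
- by move=> p /hA; rewrite mul_scale_horofun// -scalemxAl chart_scaleE.
- move=> p q Vp Vq; rewrite /flat_dist2 -M1.
    apply: eq_bigr => k _; rewrite !Ye// opprD addrACA subrr addr0 -sumrB.
    by congr (_ ^+ 2); apply: eq_bigr => i _; rewrite mulrBr.
  by under eq_bigr do rewrite mulrBl; rewrite sumrB !(flat_coord_vertical hw) subrr.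
(* N agrees with M on the complement of u and kills u. A vector fixed by N lies in this complement,
   where lengths are multiplied by sqrt a, so it is 0; hence 1 - N is invertible and y = N y + tau
   is solvable. *)
move=> a1; pose N : 'M[R]_n := \matrix_(k, i) (M k i - uu k * uu i).
have Nv (y : 'cV[R]_n) k : (N *m y) k 0 =
    \sum_i M k i * y i 0 - uu k * \sum_i y i 0 * uu i.
  by rewrite mxE mulr_sumr -sumrB; apply: eq_bigr => i _; rewrite mxE; ring.
have Nu (y : 'cV[R]_n) : \sum_k (N *m y) k 0 * uu k = 0.
  under eq_bigr do rewrite Nv mulrBl.
  rewrite sumrB M3.
  transitivity (\sum_i y i 0 * uu i - (\sum_i y i 0 * uu i) * \sum_k uu k ^+ 2).
    by congr (_ - _); rewrite mulr_sumr; apply: eq_bigr => k _; ring.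
  by rewrite (vertical_norm hw n2) mulr1 subrr.
have uN : 1%:M - N \in unitmx.
  rewrite -unitmx_tr -row_free_unit -kermx_eq0; apply/rowV0P => r /sub_kermxP rN.
  have Br : (1%:M - N) *m r^T = 0 by apply: trmx_inj; rewrite trmx_mul trmxK trmx0.
  have {}Br : N *m r^T = r^T.
    by move: Br; rewrite mulmxBl mul1mx => /subr0_eq.
  have ru := Nu r^T; rewrite Br in ru.
  have := M1 (fun i => r^T i 0) ru.
  have -> : \sum_k (\sum_i M k i * r^T i 0) ^+ 2 = \sum_k r^T k 0 ^+ 2.
    by apply: eq_bigr => k _; rewrite -[in RHS]Br Nv ru mulr0 subr0.
  rewrite -{1}[\sum_k _]mul1r => /eqP.
  rewrite -subr_eq0 -mulrBl mulf_eq0 subr_eq0 eq_sym (negbTE a1)/=.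
  rewrite psumr_eq0 => [/allP h|k _]; last exact: sqr_ge0.
  apply/rowP => k; have := h k (mem_index_enum k).
  by rewrite !mxE sqrf_eq0 => /eqP.
pose y := invmx (1%:M - N) *m \col_k tau k.
have yE : y = N *m y + \col_k tau k.
  have : (1%:M - N) *m y = \col_k tau k by rewrite mulKVmx.
  by rewrite mulmxBl mul1mx => <-; rewrite addrC subrK.
have yu : \sum_k y k 0 * uu k = 0.
  rewrite yE; under eq_bigr do rewrite mxE mulrDl.
  rewrite big_split/= Nu add0r -[RHS]M4; apply: eq_bigr => k _.
  by rewrite mxE.
exists (fun k => y k 0) => // p Vp Yp; apply/funext => k.
rewrite Ye// Yp [in RHS]yE [in RHS]mxE Nv yu mulr0 subr0.
by rewrite [in RHS]mxE.
Qed.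

Lemma horo_preserving_dist2 A p q : horo_preserving w t A -> VV p -> VV q ->
  dist2 (A *m p) (A *m q) = dist2 p q.
Proof.
move=> GA Vp Vq; have uA : A \in unitmx by case: GA.
have dA := horo_preserving_cusp_domain s GA.
have [a a0 [hA dE _]] := aut_dist2 uA dA; rewrite dE//.
have [r Vr hr] := exists_horofun_neq s hw n2; have [_] := hA r Vr.
have [_ /(_ r)[_ /(_ Vr) ->]] := GA.
rewrite -{1}[_ - _]mul1r => /mulIf <-; first by rewrite mul1r.
by rewrite subr_eq0.
Qed.

Lemma horo_preserving_flat_coord A p q : horo_preserving w t A -> VV p -> VV q ->
  YY p = YY q -> YY (A *m p) = YY (A *m q).
Proof.
move=> GA Vp Vq pq; apply: dist2_eq0; rewrite horo_preserving_dist2//.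
exact: dist2_refl.
Qed.

End FlatMetric.

(** * Lattices in the parabolic group of type 0 *)

Section ParabolicLattice.
Context {R : realType} {n : nat} (w : 'I_n -> R) (s : R).
Local Notation vec := 'cV[R]_n.+1.
Local Notation mat := 'M[R]_n.+1.
Implicit Types (p q u v : vec) (i j k l : 'I_n) (A B D : mat).
Local Notation VV := (@cusp_chart R n 0).
Local Notation hh := (horofun w 0).
Local Notation YY := (flat_coord w 0).
Local Notation uu := (vertical w 0).
Local Notation domM := (cusp_domain w 0 s).
Local Notation dist2 := (flat_dist2 w 0).
Local Notation GG := (horo_preserving w 0).
Context (hw : cusp_weights w 0) (n2 : (2 <= n)%N).

Let i0 : 'I_n := Ordinal (ltnW n2).
Let i1 : 'I_n := Ordinal n2.

Lemma chart0 p : VV p <-> wo p != 0.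
Proof. by split=> [[]|]. Qed.

Lemma flat_coord0 p k : (0 < k)%N -> YY p k = aff p k.
Proof. by move=> k0; rewrite /flat_coord (sqrt_w0 hw)// k0 mul0r add0r mul1r. Qed.

Lemma flat_coord00 p : YY p i0 = 0.
Proof. by rewrite /flat_coord (sqrt_w0 hw)// mul0r add0r mul0r. Qed.

Lemma horofun0 p : hh p = - aff p i0 + 2^-1 * \sum_k YY p k ^+ 2.
Proof.
rewrite /horofun /horo big1 => [|i _]; last by rewrite (weight0 hw)// mul0r.
rewrite (sum_horo_index _ (erefl : i0 = 0%N :> nat)) oppr0 add0r.
congr (_ + _ * _); rewrite [RHS](bigD1 i0)//= flat_coord00 expr0n add0r.
apply: eq_big => k; first by rewrite lt0n.
by move=> k0; rewrite flat_coord0.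
Qed.

Lemma parabolic_group_normal D : GG D -> exists2 e : R, e != 0 &
  GG (e *: D) /\ forall p, wo ((e *: D) *m p) = wo p.
Proof.
move=> GD; have [uD hD] := GD.
have [e e0 [ueD _ wD]] := aut_normal hw n2 uD (horo_preserving_cusp_domain 0 GD).
exists e => //; split=> //; split=> // p; have [VD hE] := hD p.
by rewrite mul_scale_horofun// -scalemxAl chart_scaleE.
Qed.

Lemma parabolic_group_inv D : GG D -> GG (invmx D).
Proof.
move=> [uD hD]; split; first by rewrite unitmx_inv.
move=> p; have [VD hE] := hD (invmx D *m p); rewrite mulKVmx// in VD hE.
by split; [split=> /VD|move=> /VD /hE].
Qed.

Lemma dist2_triangle p q r : dist2 p r <= 2 * (dist2 p q + dist2 q r).
Proof.
rewrite /flat_dist2 -big_split/= mulr_sumr; apply: ler_sum => k _.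
rewrite -subr_ge0.
have -> : 2 * ((YY p k - YY q k) ^+ 2 + (YY q k - YY r k) ^+ 2) - (YY p k - YY r k) ^+ 2 =
  (YY p k - YY q k - (YY q k - YY r k)) ^+ 2 by ring.
exact: sqr_ge0.
Qed.

Lemma dist2_coord p q k : `|YY p k - YY q k| <= 1 + dist2 p q.
Proof.
have : (YY p k - YY q k) ^+ 2 <= dist2 p q.
  by rewrite /flat_dist2 (bigD1 k)//= lerDl sumr_ge0// => l _; exact: sqr_ge0.
rewrite -real_normK ?num_real// => h.
by have := sqr_ge0 (`|YY p k - YY q k| - 1); nra.
Qed.

(** Properness: if p0 is moved a bounded distance, the image of each P with wo P = 1 is bounded,
    since Y moves isometrically and the invariance of h controls the remaining coordinate. The
    columns of D are the image of [ew] and the differences between the images of [ev k + ew] and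
    [ew]. *)
Lemma parabolic_group_bound p0 (r : R) : VV p0 -> exists C : R, forall D, GG D ->
  (forall p, wo (D *m p) = wo p) -> dist2 (D *m p0) p0 <= r ->
  forall i j : 'I_n.+1, `|D i j| <= C.
Proof.
(* [C1 P] bounds the flat coordinates of D P, and [C2 P] its affine coordinates. *)
move=> V0; pose C1 (P : vec) : R := \sum_k `|YY p0 k| + (1 + 2 * (dist2 P p0 + r)).
pose C2 (P : vec) : R := C1 P + 2^-1 * (\sum_(k < n) C1 P ^+ 2) + `|hh P|.
have d0 p q : 0 <= dist2 p q by apply: sumr_ge0 => k _; exact: sqr_ge0.
have key D P k : GG D -> (forall p, wo (D *m p) = wo p) -> dist2 (D *m p0) p0 <= r ->
    wo P = 1 -> `|co (D *m P) k| <= C2 P.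
  move=> GD wD dr wP; have VP : VV P by apply/chart0; rewrite wP oner_neq0.
  have b1 l : `|YY (D *m P) l| <= C1 P.
    have h1 := dist2_coord (D *m P) p0 l.
    have h2 := dist2_triangle (D *m P) (D *m p0) p0.
    rewrite (horo_preserving_dist2 0 hw n2 GD VP V0) in h2.
    have h3 : `|YY p0 l| <= \sum_k `|YY p0 k|.
      by rewrite (bigD1 l)//= lerDl sumr_ge0.
    have h4 := ler_normD (YY (D *m P) l - YY p0 l) (YY p0 l).
    by rewrite subrK in h4; rewrite /C1; lra.
  have C10 : 0 <= C1 P by exact: le_trans (normr_ge0 _) (b1 k).
  have C2' : 0 <= \sum_(k < n) C1 P ^+ 2 by apply: sumr_ge0 => l _; exact: sqr_ge0.
  have cE l : co (D *m P) l = aff (D *m P) l by rewrite /aff wD wP divr1.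
  have [k0|k0] := posnP (k : nat); last first.
    by rewrite cE -flat_coord0//; apply: le_trans (b1 k) _; rewrite /C2;
      have := normr_ge0 (hh P); lra.
  have -> : k = i0 by apply/val_inj.
  have hE : hh (D *m P) = hh P by have [_ /(_ P)[_ ->]] := GD.
  have := horofun0 (D *m P); rewrite hE cE => /eqP; rewrite addrC -subr_eq => /eqP e.
  have -> : aff (D *m P) i0 = 2^-1 * (\sum_k YY (D *m P) k ^+ 2) - hh P by lra.
  have b2 : \sum_k YY (D *m P) k ^+ 2 <= \sum_(k < n) C1 P ^+ 2.
    by apply: ler_sum => l _; rewrite -real_normK ?num_real// lerXn2r ?nnegrE.
  have b3 : 0 <= \sum_k YY (D *m P) k ^+ 2 by apply: sumr_ge0 => l _; exact: sqr_ge0.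
  have := ler_norm (hh P); have := ler_norm (- hh P); rewrite normrN /C2 => ? ?.
  by rewrite ler_norml; apply/andP; split; lra.
pose S : R := \sum_k C2 (ev k + ew) + C2 ew + C2 ew + 1.
have wP k : wo (ev k + ew : vec) = 1 by rewrite woD wo_ev wo_ew add0r.
exists S => D GD wD dr.
have C2e := key D ew i0 GD wD dr (@wo_ew R n).
have C20 P : wo P = 1 -> 0 <= C2 P.
  by move=> wP'; exact: le_trans (normr_ge0 _) (key D P i0 GD wD dr wP').
have S0 : C2 ew + 1 <= S.
  have : 0 <= \sum_k C2 (ev k + ew).
    by apply: sumr_ge0 => k _; exact: C20.
  by have := C20 _ (@wo_ew R n); rewrite /S; lra.
have ce : C2 ew <= S by have := S0; lra.
have one_S : 1 <= S by have := C20 _ (@wo_ew R n); lra.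
have colw (i : 'I_n.+1) : `|(D *m ew) i 0| <= S.
  case: (unliftP ord_max i) => [k|] ->; first exact: le_trans (key D ew k GD wD dr (@wo_ew R n)) ce.
  by have := wD ew; rewrite wo_ew /wo => ->; rewrite normr1.
have colv (i : 'I_n.+1) j : `|(D *m ev j) i 0| <= S.
  case: (unliftP ord_max i) => [k|] ->; last first.
    by have := wD (ev j); rewrite wo_ev /wo => ->; rewrite normr0; exact: le_trans ler01 one_S.
  have h1 := key D _ k GD wD dr (wP j); have h2 := key D ew k GD wD dr (@wo_ew R n).
  rewrite mulmxDr coD in h1.
  have := ler_normB (co (D *m ev j) k + co (D *m ew) k) (co (D *m ew) k).
  rewrite addrK -/(co _ k) => h3; apply: le_trans h3 _.
  apply: le_trans (lerD h1 h2) _.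
  have : C2 (ev j + ew) <= \sum_k C2 (ev k + ew).
    by rewrite (bigD1 j)//= lerDl sumr_ge0// => l _; exact: C20.
  by have := C20 _ (@wo_ew R n); rewrite /S; lra.
move=> i j; have <- : (D *m (delta_mx j 0 : vec)) i 0 = D i j by rewrite -colE mxE.
by case: (unliftP ord_max j) => [k|] ->; [exact: colv|exact: colw].
Qed.

(** The unipotent map x_2 -> x_2 + b, x_1 -> x_1 + b x_2 + b^2 / 2, which preserves h = - x_1 +
    (x_2^2 + ... + x_n^2) / 2. *)
Definition parabolic (b : R) p : vec :=
  mkv (fun k => co p k + (k == i0)%:R * (b * co p i1 + 2^-1 * b ^+ 2 * wo p) +
    (k == i1)%:R * (b * wo p)) (wo p).

Lemma parabolic_in_group (b : R) : exists B, GG B /\ forall p, B *m p = parabolic b p.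
Proof.
have lin c (a : R) u v : parabolic c (a *: u + v) = a *: parabolic c u + parabolic c v.
  apply: vec_ext => [k|]; last by rewrite wo_comb !wo_mkv wo_comb.
  by rewrite co_comb !co_mkv !co_comb wo_comb; ring.
have [B BE] := linear_mx (lin b); have [B' BE'] := linear_mx (lin (- b)).
have i10 : (i1 == i0) = false by [].
have BB' : B *m B' = 1%:M.
  apply/matrixP => i j.
  have -> : (B *m B') i j = (B *m (B' *m (delta_mx j 0 : vec))) i 0.
    by rewrite mulmxA -colE [RHS]mxE.
  have -> : B *m (B' *m (delta_mx j 0 : vec)) = delta_mx j 0.
    rewrite -BE' -BE; apply: vec_ext => [k|]; last by rewrite !wo_mkv.
    rewrite !co_mkv !wo_mkv i10 eqxx mul0r mul1r.
    by field.
  by rewrite !mxE eqxx andbT.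
have uB : B \in unitmx by have [] := mulmx1_unit BB'.
exists B; split=> //; split=> // p; rewrite -BE !chart0 wo_mkv; split=> // wp.
have affE k : aff (parabolic b p) k = aff p k +
    (k == i0)%:R * (b * aff p i1 + 2^-1 * b ^+ 2) + (k == i1)%:R * b.
  by rewrite /aff co_mkv wo_mkv; field.
rewrite !horofun0 affE eqxx eq_sym i10 mul1r mul0r addr0.
rewrite (bigD1 i1)//= [in RHS](bigD1 i1)//= !flat_coord0// affE eqxx i10 mul0r mul1r addr0.
have -> : \sum_(k | k != i1) YY (parabolic b p) k ^+ 2 = \sum_(k | k != i1) YY p k ^+ 2.
  apply: eq_bigr => k k1; have [k0|k0] := posnP (k : nat).
    by have -> : k = i0 by [exact/val_inj]; rewrite !flat_coord00.
  rewrite !flat_coord0// affE (negbTE k1) mul0r addr0.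
  have -> : (k == i0) = false by apply: contraTF k0 => /eqP ->.
  by rewrite mul0r addr0.
by field.
Qed.

Lemma mulmxr_continuous p (i : 'I_n.+1) : continuous (fun B : mat => (B *m p) i 0 : R^o).
Proof.
suff c (B : mat) : {for B, continuous (fun B : mat => (B *m p) i 0 : R^o)} by [].
rewrite [X in {for _, continuous X}](_ : _ = (fun B : mat => \sum_k B i k * p k 0)).
  apply: (@cvg_big R^o _ _ _ _ _ _ (nbhs B)); first exact: add_continuous.
  move=> k _; apply: (@cvgM _ _ (nbhs B)); first exact: coord_continuous.
  exact: (@cvg_cst _ (p k 0) _ (nbhs B)).
by apply/funext => C; rewrite mxE.
Qed.

Context (Gamma : set mat) (lG : lattice_in GG Gamma).

Let pG : pgl_subgroup Gamma. Proof. by case: lG. Qed.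
Let GGG D : Gamma D -> GG D. Proof. by case: lG => _ + _ _; apply. Qed.

(** If Gamma fixed the flat coordinates of p0, those of B p0 would depend only on the class of B
    modulo Gamma, hence be bounded by compactness; parabolic translations make them unbounded. *)
Lemma lattice_moves p0 : VV p0 -> exists2 D, Gamma D & YY (D *m p0) != YY p0.
Proof.
move=> V0; apply: contrapT => fix0.
have {}fix0 D : Gamma D -> YY (D *m p0) = YY p0.
  by move=> GD; apply/eqP; apply: contrapT => /negP h; apply: fix0; exists D.
(* The condition |Y (B p0)| < m in the coordinate i1, multiplied by |wo (B p0)| so that it is open
   among all matrices. *)
pose W (m : nat) : set mat := GG `&`
  [set B | `|(B *m p0) (lift ord_max i1) 0| < m%:R * `|(B *m p0) ord_max 0| ].
have wB B : GG B -> wo (B *m p0) != 0.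
  by move=> [_ /(_ p0)[VB _]]; apply/chart0/VB.
have WE m B : GG B -> W m B <-> `|YY (B *m p0) i1| < m%:R.
  move=> GB; have w0 := wB B GB.
  rewrite flat_coord0// /aff normrM normfV ltr_pdivrMr ?normr_gt0//.
  by split=> [[]|].
have [_ _ _ cG] := lG.
have [W' [m ->]|B GB|F' [fF' F'W covF']] := cG [set W' | exists m, W' = W m].
- split; last first.
    move=> B B' [GB WB] GB' [D GD BD]; apply/(WE m B' GB'); rewrite BD -mulmxA.
    have VD : VV (D *m p0) by have [_ /(_ p0)[VD _]] := GGG GD; exact/VD.
    rewrite (horo_preserving_flat_coord 0 hw n2 GB VD V0 (fix0 D GD)).
    exact: (WE m B GB).1.
  exists [set B : mat | `|(B *m p0) (lift ord_max i1) 0| < m%:R * `|(B *m p0) ord_max 0| ] => //.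
  pose f (B : mat) : R^o := m%:R * `|(B *m p0) ord_max 0| - `|(B *m p0) (lift ord_max i1) 0|.
  have cf : continuous f.
    suff c (B : mat) : {for B, continuous f} by [].
    apply: (@cvgB _ R^o _ (nbhs B)); last first.
      by apply: (@cvg_norm _ _ _ (nbhs B)); exact: mulmxr_continuous.
    apply: (@cvgM _ _ (nbhs B)); first exact: (@cvg_cst _ (m%:R : R) _ (nbhs B)).
    by apply: (@cvg_norm _ _ _ (nbhs B)); exact: mulmxr_continuous.
  rewrite [X in open X](_ : _ = f @^-1` [set x | 0 < x]).
    by apply: open_comp; [move=> B _; exact: cf|exact: open_gt].
  by apply/seteqP; split=> B /=; rewrite /f subr_gt0.
- exists (W (Num.truncn `|YY (B *m p0) i1|).+1).
    by exists (Num.truncn `|YY (B *m p0) i1|).+1.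
  by apply/(WE _ B GB); exact: truncnS_gt.
have [m mF] : exists m, forall B, GG B -> `|YY (B *m p0) i1| < m%:R.
  move: fF' => /finite_seqP[l lF].
  suff [m mF] : exists m, forall W', W' \in l -> W' `<=` W m.
    exists m => B GB; apply/(WE m B GB); have [W' FW' WB] := covF' B GB.
    by apply: (mF W') => //; rewrite lF in FW'.
  have {}F'W W' : W' \in l -> exists m, W' = W m by move=> Wl; apply: F'W; rewrite lF.
  elim: l {lF} F'W => [|W0 l IH] lW; first by exists 0.
  have [m mE] := IH (fun W' Wl => lW W' (mem_behead (s := W0 :: l) Wl)).
  have [m0 W0E] := lW W0 (mem_head _ _).
  have mono a b : (a <= b)%N -> W a `<=` W b.
    move=> ab B [GB] WB; split=> //; apply: lt_le_trans WB _.
    by rewrite ler_wpM2r// ler_nat.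
  exists (maxn m0 m) => W'; rewrite inE => /orP[/eqP ->|/mE h].
    by rewrite W0E; apply: mono; exact: leq_maxl.
  by apply: subset_trans h (mono _ _ _); exact: leq_maxr.
(* Translation by b moves the coordinate i1 of p0 to at least m. *)
pose b : R := m%:R + `|aff p0 i1|.
have [B [GB BE]] := parabolic_in_group b.
have := mF B GB; rewrite BE flat_coord0// /aff co_mkv wo_mkv eqxx.
have -> : (i1 == i0) = false by [].
have wp : wo p0 != 0 by exact/chart0.
have -> : (co p0 i1 + false%:R * (b * co p0 i1 + 2^-1 * b ^+ 2 * wo p0)
    + true%:R * (b * wo p0)) / wo p0 =
  aff p0 i1 + b by rewrite /aff mul0r mul1r addr0; field.
rewrite ltNge => /negP; apply; apply: le_trans (ler_norm _); rewrite /b.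
by have := ler_norm (- aff p0 i1); rewrite normrN; lra.
Qed.

(* An automorphism contracting the flat coordinates and normalizing the lattice
   would conjugate an element moving its fixed point into infinitely many
   distinct elements of the lattice lying in a bounded set. *)
Lemma no_contraction A (a : R) : A \in unitmx ->
  (forall p, domM p <-> domM (A *m p)) ->
  (forall D, Gamma D -> Gamma (A *m D *m invmx A)) ->
  0 < a -> a < 1 ->
  (forall p q, VV p -> VV q -> dist2 (A *m p) (A *m q) = a * dist2 p q) ->
  (forall p, VV p <-> VV (A *m p)) ->
  (exists2 y : 'I_n -> R, \sum_k y k * uu k = 0 &
      forall p, VV p -> YY p = y -> YY (A *m p) = y) -> False.
Proof.
move=> uA dA nA a0 a1 dist_A VA [y yu yfix].
have n0 : (0 < n)%N by exact: ltnW.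
have y0 : y i0 = 0.
  move: yu; rewrite (bigD1 i0)//= big1 => [|k k0]; last first.
    have : (0 < k)%N by rewrite lt0n; apply: contraNneq k0 => k0; exact/eqP/val_inj.
    by move=> k0'; rewrite /vertical n0 gtn_eqF ?mulr0.
  by rewrite /vertical n0 eqxx mulr1 addr0.
pose p0 : vec := mkv y 1.
have V0 : VV p0 by apply/chart0; rewrite wo_mkv oner_neq0.
have Y0 : YY p0 = y.
  apply/funext => k; have [k0|k0] := posnP (k : nat).
    by have -> : k = i0 by [exact/val_inj]; rewrite flat_coord00 y0.
  by rewrite flat_coord0// aff_mkv.
have YA0 : YY (A *m p0) = YY p0 by rewrite [RHS]Y0; exact: yfix.
have [D0 GD0 mD0] := lattice_moves V0.
pose f (k : nat) := iter k (fun D => A *m D *m invmx A) D0.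
have Gf (k : nat) : Gamma (f k) by elim: k => // k IH; exact: (nA _ IH).
have VG D p : Gamma D -> VV p -> VV (D *m p).
  by move=> /GGG[_ /(_ p)[VD _]] /VD.
have VAi p : VV p -> VV (invmx A *m p) by move=> Vp; apply/VA; rewrite mulKVmx.
(* The displacement of p0 under the k-th conjugate. As A fixes the flat position of p0, it shrinks
   by the factor a at each step. *)
pose d (k : nat) := dist2 (f k *m p0) p0.
have dS (k : nat) : d k.+1 = a * d k.
  rewrite /d -(dist_A _ _ (VG _ _ (Gf k) V0) V0).
  have YAi : YY (invmx A *m p0) = YY p0.
    apply: dist2_eq0; have /eqP := dist_A _ _ (VAi _ V0) V0.
    by rewrite mulKVmx// dist2_refl// eq_sym mulf_eq0 gt_eqF//= => /eqP.
  have e1 : YY (f k.+1 *m p0) = YY (A *m (f k *m p0)).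
    have -> : f k.+1 *m p0 = A *m (f k *m (invmx A *m p0)) by rewrite !mulmxA.
    apply: dist2_eq0; rewrite dist_A; [|exact/VG/VAi|exact: VG].
    rewrite dist2_refl ?mulr0//.
    exact: (horo_preserving_flat_coord 0 hw n2 (GGG (Gf k)) (VAi _ V0) V0).
  by rewrite /flat_dist2 e1 YA0.
have d0 : 0 < d 0%N.
  rewrite lt0r sumr_ge0 ?andbT => [|k _]; last exact: sqr_ge0.
  by apply: contraNneq mD0 => /dist2_eq0 ->.
have dgt0 (k : nat) : 0 < d k by elim: k => // k IH; rewrite dS mulr_gt0.
have ddec (k l : nat) : (k < l)%N -> d l < d k.
  elim: l => // l IH; rewrite ltnS leq_eqVlt => /orP[/eqP ->|/IH h].
    by rewrite dS gtr_pMl.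
  by apply: lt_trans h; rewrite dS gtr_pMl.
have dle (k : nat) : d k <= d 0%N by case: k => // k; exact/ltW/ddec.
have [C CP] := parabolic_group_bound (d 0%N) V0.
(* Representatives that keep the last coordinate, to which [parabolic_group_bound] applies. *)
have norm_ (k : nat) : exists2 D, Gamma D /\ (forall p, wo (D *m p) = wo p) &
    exists2 e : R, e != 0 & D = e *: f k.
  have [e e0 [GD wD]] := parabolic_group_normal (GGG (Gf k)).
  exists (e *: f k); last by exists e.
  by split=> //; have [_ _ _ _] := pG; apply.
have [g gP ge] : exists2 g : nat -> mat,
    (forall k : nat, Gamma (g k) /\ forall p, wo (g k *m p) = wo p) &
    forall k : nat, exists2 e : R, e != 0 & g k = e *: f k.
  have [g gP] := choice (fun k : nat => let: ex_intro2 D h1 h2 := norm_ k in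
    ex_intro (fun D => (Gamma D /\ forall p, wo (D *m p) = wo p) /\
      exists2 e : R, e != 0 & D = e *: f k) D (conj h1 h2)).
  by exists g => k; have [] := gP k.
have gY (k : nat) : YY (g k *m p0) = YY (f k *m p0).
  by have [e e0 ->] := ge k; rewrite -scalemxAl flat_coord_scale.
have gd (k : nat) : dist2 (g k *m p0) p0 = d k by rewrite /flat_dist2 gY.
have ug (k : nat) : g k \in unitmx by case: (GGG (gP k).1).
have wgi (k : nat) p : wo (invmx (g k) *m p) = wo p.
  by have [_ wg] := gP k; rewrite -wg mulKVmx.
have gC (k : nat) (i j : 'I_n.+1) : `|g k i j| <= C.
  by apply: CP; [exact: GGG (gP k).1|exact: (gP k).2|rewrite gd].
have giC (k : nat) (i j : 'I_n.+1) : `|invmx (g k) i j| <= C.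
  apply: CP; [exact/parabolic_group_inv/GGG/(gP k).1|exact: wgi|].
  have GI := parabolic_group_inv (GGG (gP k).1).
  rewrite -[X in dist2 _ X](mulKmx (ug k) p0).
  rewrite (horo_preserving_dist2 0 hw n2 GI V0); last exact: VG (gP k).1 V0.
  have -> : dist2 p0 (g k *m p0) = dist2 (g k *m p0) p0.
    by apply: eq_bigr => l _; rewrite -sqrrN opprB.
  by rewrite gd.
have C0 : 0 <= C by exact: le_trans (normr_ge0 _) (gC 0%N ord0 ord0).
have [_ G1 GM GV _] := pG; have [_ _ dG _] := lG.
have [U [oU U1] UG] := dG _ G1.
have : nbhs (1%:M : mat) U by exact: open_nbhs_nbhs.
move=> /nbhs_ballP[rho /= rho0 rhoU].
(* Chosen so that the entries of (g_k - g_l) g_l^-1, at most (n + 1) (rho / m) C, are below rho. *)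
pose m : R := n.+1%:R * (C + 1).
have m0 : 0 < m by rewrite mulr_gt0 ?ltr0n// ltr_wpDl.
have [k [l [kl close]]] := bounded_pigeonhole (divr_gt0 rho0 m0) gC.
pose E := g k *m invmx (g l).
have GE : Gamma E by apply: GM; [exact: (gP k).1|exact/GV/(gP l).1].
have UE : U E.
  apply: rhoU; split=> // i j; rewrite -ball_normE /=.
  have -> : (1%:M : mat) = g l *m invmx (g l) by rewrite mulmxV.
  rewrite /E !mxE -sumrB.
  under eq_bigr do rewrite -mulrBl.
  apply: le_lt_trans (ler_norm_sum _ _ _) _.
  apply: (@le_lt_trans _ _ (\sum_(x < n.+1) (rho / m) * C)).
    apply: ler_sum => x _; rewrite normrM ler_pM//.
    by rewrite distrC; exact/ltW/close.
  rewrite sumr_const card_ord -mulr_natl.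
  have -> : n.+1%:R * (rho / m * C) = rho * (C / (C + 1)).
    by rewrite /m; field; rewrite -/(C + 1) gt_eqF ?ltr_wpDl//= addrC natr1 pnatr_eq0.
  rewrite gtr_pMr// ltr_pdivrMr; last by rewrite ltr_wpDl.
  by rewrite mul1r ltrDl.
have [c c0 Ec] := UG E GE UE.
have gkl : g k = c *: g l.
  by rewrite -[g k](mulmxKV (ug l)) -/E Ec -scalemxAl mul1mx.
have := ddec _ _ kl; rewrite -!gd.
have -> : dist2 (g k *m p0) p0 = dist2 (g l *m p0) p0.
  by rewrite /flat_dist2 gkl -scalemxAl flat_coord_scale.
by rewrite ltxx.
Qed.

(** The factors of A and of its inverse have product 1, so unless both are 1 one of the two maps is
    a contraction. *)
Lemma lattice_aut_horofun A : A \in unitmx -> (forall p, domM p <-> domM (A *m p)) ->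
  (forall D, Gamma D <-> Gamma (A *m D *m invmx A)) ->
  forall p, VV p -> hh (A *m p) = hh p.
Proof.
move=> uA dA nA p Vp.
have VA q : VV q <-> VV (A *m q).
  have [e e0 [_ _ wA]] := aut_normal hw n2 uA dA.
  rewrite !chart0 -[in X in X <-> _]wA -scalemxAl woZ mulf_eq0 (negbTE e0)/=.
  by [].
have [a a0 [hA dE fixA]] := aut_dist2 hw n2 uA dA.
have uA' : invmx A \in unitmx by rewrite unitmx_inv.
have dA' q : domM q <-> domM (invmx A *m q).
  by have h := dA (invmx A *m q); rewrite mulKVmx// in h; exact: iff_sym.
have [a' a'0 [hA' dE' fixA']] := aut_dist2 hw n2 uA' dA'.
have VA' q : VV q <-> VV (invmx A *m q).
  by have h := VA (invmx A *m q); rewrite mulKVmx// in h; exact: iff_sym.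
suff a1 : a = 1.
  by have [_] := hA p Vp; rewrite a1 mul1r => /addIr.
have aa' : a * a' = 1.
  have [q Vq hq] := exists_horofun_neq s hw n2.
  have [_ h1] := hA _ ((VA' q).1 Vq); have [_ h2] := hA' _ Vq.
  move: h1; rewrite mulKVmx// h2 mulrA -{1}[_ - _]mul1r => /mulIf -> //.
  by rewrite subr_eq0.
apply/eqP; apply: contrapT => /negP an1.
have a'n1 : a' != 1 by apply: contraNneq an1 => e; rewrite -aa' e mulr1.
case/orP: (lt_total an1) => lt.
  apply: (no_contraction uA dA _ a0 lt dE VA (fixA an1)).
  by move=> D; exact: (nA D).1.
apply: (no_contraction uA' dA' _ a'0 _ dE' VA' (fixA' a'n1)); last first.
  by rewrite -(ltr_pM2l a0) aa' mulr1.
move=> D GD; apply/nA; rewrite invmxK !mulmxA mulmxV// mul1mx -mulmxA mulmxV// mulmx1.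
exact: GD.
Qed.

End ParabolicLattice.

(** * Lifting projective diffeomorphisms *)

Section Orbits.
Context {R : realType} {n : nat}.
Local Notation vec := 'cV[R]_n.+1.
Local Notation mat := 'M[R]_n.+1.
Implicit Types (x y z : vec) (A B D E : mat) (U O X : set vec).

Section Group.
Context (Gamma : set mat) (pG : pgl_subgroup Gamma).

Lemma orb_sym x y : orb Gamma x y -> orb Gamma y x.
Proof.
have [Gu _ _ GV _] := pG => -[D GD ->]; exists (invmx D); first exact: GV.
by rewrite mulKmx//; exact: Gu.
Qed.

Lemma orb_trans x y z : orb Gamma x y -> orb Gamma y z -> orb Gamma x z.
Proof.
have [_ _ GM _ _] := pG => -[D GD ->] [E GE ->]; exists (E *m D); first exact: GM.
by rewrite mulmxA.
Qed.

Lemma orb_scale (c : R) x : c != 0 -> orb Gamma x (c *: x).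
Proof.
have [_ G1 _ _ GZ] := pG => c0; exists (c *: 1%:M); first exact: GZ.
by rewrite -scalemxAl mul1mx.
Qed.

Lemma orb_mul D x : Gamma D -> orb Gamma x (D *m x).
Proof. by exists D. Qed.

End Group.

(** Every point of X is a limit of interior points, so that Baire arguments find an open set even
    near the boundary. *)
Definition fat X : Prop := forall U x, open U -> U x -> X x ->
  exists O, [/\ open O, O !=set0 & O `<=` U `&` X].

(** The factor c adjusts the representative of the second endpoint, which may lie on the opposite
    half of the double cone. *)
Definition segment_connected_proj X : Prop := forall x y, X x -> X y ->
  exists2 c : R, c != 0 & forall r : R, 0 <= r <= 1 -> X ((1 - r) *: x + r *: (c *: y)).

End Orbits.

Section Lifting.
Context {R : realType} {n : nat}.
Local Notation vec := 'cV[R]_n.+1.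
Local Notation mat := 'M[R]_n.+1.
Local Notation quo := (proj_quotient R n).
Implicit Types (x y z : vec) (A B D E : mat) (U O X : set vec) (C : quo).

Definition group_domain C : Prop :=
  [/\ pgl_subgroup (grp C), discrete_in_pgl (grp C)
    & forall D x, grp C D -> dom C x -> dom C (D *m x)].

Definition nice_domain C : Prop :=
  [/\ group_domain C, fat (dom C), segment_connected_proj (dom C)
    & dom C !=set0].

Definition iso A C C' : Prop :=
  [/\ A \in unitmx, forall x, dom C x <-> dom C' (A *m x)
    & forall D, grp C D <-> grp C' (A *m D *m invmx A)].

Lemma dom_orb C x y : group_domain C -> dom C x -> orb (grp C) x y -> dom C y.
Proof. by move=> [_ _ pC] dx [D GD ->]; exact: pC. Qed.

Lemma dom_mulE C D x : group_domain C -> grp C D -> dom C (D *m x) -> dom C x.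
Proof.
move=> gC GD dDx; apply: (dom_orb gC dDx); apply: orb_sym; first by case: gC.
exact: orb_mul.
Qed.

Lemma lift_unique C' A1 A2 O : group_domain C' -> A1 \in unitmx -> A2 \in unitmx ->
  open O -> O !=set0 -> (forall y, O y -> orb (grp C') (A1 *m y) (A2 *m y)) ->
  exists2 D, grp C' D & A2 = D *m A1.
Proof.
move=> [pC dC _] u1 u2 oN [y0 Oy0] OA; exists (A2 *m invmx A1); last by rewrite mulmxKV.
have u1' : invmx A1 \in unitmx by rewrite unitmx_inv.
apply: (@discrete_baire _ _ _ _ [set z | O (invmx A1 *m z)]) => //.
- by rewrite unitmx_mul u2.
- exact: open_mulmx.
- by exists (A1 *m y0); rewrite /= mulKmx.
- by move=> z /= /OA; rewrite mulKVmx// mulmxA.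
Qed.

Lemma local_lift_mul C C' P U A D : pgl_subgroup (grp C') -> grp C' D ->
  local_lift C C' P U A -> local_lift C C' P U (D *m A).
Proof.
move=> pG GD [oU uA PA]; split=> //.
  by have [Gu _ _ _ _] := pG; rewrite unitmx_mul uA andbT; exact: Gu.
move=> y dy Uy; apply: orb_trans (PA y dy Uy) _ => //.
by rewrite -mulmxA; exact: orb_mul.
Qed.

Lemma line_continuous x y : continuous (fun r : R => (1 - r) *: x + r *: y : vec).
Proof.
move=> r; apply: cvgD.
  by apply: cvgZr_tmp; apply: cvgB; [exact: cvg_cst|exact: cvg_id].
by apply: cvgZr_tmp; exact: cvg_id.
Qed.

(** Continuation along the segment from x0 to x. A local lift that meets the set where A0 works
    differs from A0 by a group element, so A0 works near that point as well. The good points and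
    those with no good point nearby are thus two open sets covering the domain, and [0, 1] is
    connected. *)
Lemma global_lift C C' P U0 A0 x0 : pgl_subgroup (grp C) -> fat (dom C) ->
  segment_connected_proj (dom C) -> group_domain C' -> projective_map C C' P ->
  local_lift C C' P U0 A0 -> U0 x0 -> dom C x0 ->
  forall x, dom C x -> orb (grp C') (P x) (A0 *m x).
Proof.
move=> pC fC sC gC' [_ Pe Pl] L0 Ux0 dx0 x dx.
have [pC' _ _] := gC'; have [_ uA0 _] := L0.
pose good : set vec := [set y | exists2 U : set vec, U y & local_lift C C' P U A0].
pose bad : set vec := [set y | exists2 U : set vec, open U /\ U y &
  forall z, dom C z -> U z -> ~ good z].
have ogood : open good.
  rewrite openE => y [U Uy LU]; have [oU _ _] := LU.
  have : nbhs y U by exact: open_nbhs_nbhs.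
  by apply: filterS => z Uz; exists U.
have obad : open bad.
  rewrite openE => y [U [oU Uy] UN].
  have : nbhs y U by exact: open_nbhs_nbhs.
  by apply: filterS => z Uz; exists U.
have dich y : dom C y -> good y \/ bad y.
  move=> dy; have [U Uy [A LA]] := Pl y dy; have [oU uA PA] := LA.
  have [[z [dz Uz [U1 U1z L1]]]|none] :=
    pselect (exists z, [/\ dom C z, U z & good z]); last first.
    by right; exists U => // z dz Uz gz; apply: none; exists z.
  left; have [oU1 _ PA1] := L1.
  have oUU : open (U `&` U1) by exact: openI.
  have [N [oN N0 NU]] := fC _ z oUU (conj Uz U1z) dz.
  have [|D GD AD] := lift_unique gC' uA uA0 oN N0.
    move=> v Ov; have [[Uv U1v] dv] := NU v Ov.
    by apply: orb_trans (PA1 v dv U1v) => //; apply: orb_sym => //; exact: PA.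
  by exists U => //; rewrite AD; exact: local_lift_mul.
have [c c0 seg] := sC x0 x dx0 dx.
pose ga (r : R) : vec := (1 - r) *: x0 + r *: (c *: x).
have cga : continuous ga by exact: line_continuous.
have conn : connected (`[0, 1]%classic : set R) by exact: segment_connected.
have I01 r : (`[0, 1]%classic : set R) r -> dom C (ga r).
  by rewrite /= in_itv /= => /seg.
have ggood : open [set r | good (ga r)] by apply: open_comp => // r _; exact: cga.
have gbad : open [set r | bad (ga r)] by apply: open_comp => // r _; exact: cga.
have e : (`[0, 1]%classic : set R) `&` [set r | good (ga r)] = `[0, 1]%classic.
  apply: conn.
  - exists 0; split; first by rewrite /= in_itv /= lexx ler01.
    by rewrite /= /ga subr0 scale1r scale0r addr0; exists U0.
  - by exists [set r | good (ga r)].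
  - exists (~` [set r | bad (ga r)]); first exact: open_closedC.
    apply/seteqP; split=> r [r01 gr]; split=> //.
      by move=> [U [oU Ur] UN]; exact: (UN _ (I01 r r01) Ur).
    by have [//|br] := dich _ (I01 r r01); case: gr.
have : (`[0, 1]%classic : set R) 1 by rewrite /= in_itv /= lexx ler01.
rewrite -e => -[r1].
move=> [U U1 [_ _ PA]].
have d1 : dom C (ga 1) by exact: I01.
have := PA _ d1 U1; rewrite /ga subrr scale0r add0r scale1r -scalemxAr => h.
have dcx : dom C (c *: x) by move: d1; rewrite /ga subrr scale0r add0r scale1r.
apply: orb_trans (Pe x (c *: x) dx dcx (orb_scale pC _ c0)) _ => //.
apply: orb_trans h _ => //; apply: orb_sym => //; exact: orb_scale.
Qed.

(** A and A D lift the same map modulo [grp C'], hence differ by an element of it. *)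
Lemma lift_conj C C' P A D : nice_domain C -> group_domain C' -> A \in unitmx ->
  (forall x y, dom C x -> dom C y -> orb (grp C) x y -> orb (grp C') (P x) (P y)) ->
  (forall x, dom C x -> orb (grp C') (P x) (A *m x)) ->
  grp C D -> grp C' (A *m D *m invmx A).
Proof.
move=> [gC fC _ [x0 dx0]] gC' uA Pe PA GD; have [pC _ prC] := gC.
have [pC' _ _] := gC'; have [Gu _ _ _ _] := pC.
have [N [oN N0 NC]] := fC setT x0 openT Logic.I dx0.
have [||E GE ADE] := lift_unique (A2 := A *m D) gC' uA _ oN N0.
- by rewrite unitmx_mul uA; exact: Gu.
- move=> y /NC[_ dy]; rewrite -mulmxA.
  apply: orb_trans (PA _ (prC _ _ GD dy)) => //.
  apply: orb_trans (Pe _ _ dy (prC _ _ GD dy) (orb_mul _ GD)) => //.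
  by apply: orb_sym => //; exact: PA.
by rewrite ADE mulmxK.
Qed.

(** For lifts A of P and B of its inverse, B A lies in [grp C]; this gives surjectivity on domains
    and the converse inclusion between the groups. *)
Lemma diffeo_iso C C' P U A x0 : nice_domain C -> nice_domain C' ->
  projective_diffeo C C' P -> local_lift C C' P U A -> U x0 -> dom C x0 ->
  iso A C C'.
Proof.
move=> nC nC' [mP [Q mQ [QP PQ]]] LA Ux0 dx0.
have [gC fC sC _] := nC; have [gC' fC' sC' _] := nC'.
have [pC dC prC] := gC; have [pC' dC' prC'] := gC'.
have [Pd Pe _] := mP; have [Qd Qe Ql] := mQ; have [_ uA _] := LA.
have PA := global_lift pC fC sC gC' mP LA Ux0 dx0.
have [V Vy [B LB]] := Ql _ (Pd _ dx0); have [_ uB _] := LB.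
have QB := global_lift pC' fC' sC' gC mQ LB Vy (Pd _ dx0).
have dA x : dom C x -> dom C' (A *m x).
  by move=> dx; exact: dom_orb gC' (Pd _ dx) (PA _ dx).
have dB y : dom C' y -> dom C (B *m y).
  by move=> dy; exact: dom_orb gC (Qd _ dy) (QB _ dy).
have GBA : grp C (B *m A).
  have [N [oN N0 NC]] := fC setT x0 openT Logic.I dx0.
  apply: (discrete_baire pC dC _ oN N0); first by rewrite unitmx_mul uB.
  move=> y /NC[_ dy]; rewrite -mulmxA.
  apply: orb_trans (QP _ dy) _ => //; apply: orb_trans (QB _ (dA _ dy)) => //.
  exact: Qe (Pd _ dy) (dA _ dy) (PA _ dy).
split=> //.
  by move=> x; split=> [/dA//|/dB]; rewrite mulmxA; exact: dom_mulE.
move=> D; split; first exact: (lift_conj nC gC' uA Pe PA).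
move=> GE; have := lift_conj nC' gC uB Qe QB GE.
have [Gu _ GM GV _] := pC.
move=> h; have := GM _ _ (GM _ _ (GV _ GBA) h) GBA.
have -> : invmx (B *m A) *m (B *m (A *m D *m invmx A) *m invmx B) *m (B *m A) = D.
  have -> : B *m (A *m D *m invmx A) *m invmx B = (B *m A) *m D *m invmx A *m invmx B.
    by rewrite !mulmxA.
  rewrite -!mulmxA (mulmxA (invmx B)) mulVmx// mul1mx mulVmx// mulmx1.
  by rewrite (mulmxA B A D) mulKmx// unitmx_mul uB.
by [].
Qed.

(** The inverse map lifts to B on the model, with image X0 inside [dom C]. X0 is open in [dom C],
    its translates by [grp C] cover [dom C], and a translate meeting X0 equals it. So X0 is open and
    closed, and the connectedness of line sections leaves no room for other points. *)
Lemma cusp_iso C M P : group_domain C -> properly_convex (dom C) -> nice_domain M ->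
  projective_diffeo C M P -> exists B, iso B M C.
Proof.
move=> gC [[dC0 dCp] cC] nM [[Pd Pe Pl] [Q mQ [QP PQ]]].
have [gM fM sM [y0 dy0]] := nM; have [pM dM prM] := gM; have [pC _ prC] := gC.
have [Qd Qe Ql] := mQ; have [V Vy [B LB]] := Ql _ dy0; have [_ uB _] := LB.
have QB := global_lift pM fM sM gC mQ LB Vy dy0.
have dB y : dom M y -> dom C (B *m y).
  by move=> dy; exact: dom_orb gC (Qd _ dy) (QB _ dy).
pose X0 : set vec := [set z | dom M (invmx B *m z)].
have uB' : invmx B \in unitmx by rewrite unitmx_inv.
have X0C z : X0 z -> dom C z by move=> /dB; rewrite mulKVmx.
have X0Z (c : R) z : c != 0 -> X0 z -> X0 (c *: z).
  move=> c0; rewrite /X0 /= -scalemxAr => dz; apply: dom_orb gM dz _.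
  exact: orb_scale.
have PB z : X0 z -> orb (grp M) (P z) (invmx B *m z).
  move=> Xz; apply: orb_sym => //; apply: orb_trans (PQ _ Xz) _ => //.
  apply: Pe; [exact: Qd|exact: X0C|].
  by have := QB _ Xz; rewrite mulKVmx.
have fX0 U z : open U -> U z -> X0 z -> exists N, [/\ open N, N !=set0 & N `<=` U `&` X0].
  move=> oU Uz Xz.
  have oBU : open [set y | U (B *m y)] by exact: open_mulmx.
  have [|N [oN [v Ov] NU]] := fM _ (invmx B *m z) oBU _ Xz.
    by rewrite /= mulKVmx.
  exists [set v | N (invmx B *m v)]; split; first exact: open_mulmx.
    by exists (B *m v); rewrite /= mulKmx.
  by move=> v' /= /NU[/=]; rewrite mulKVmx.
have X0_open z : X0 z -> exists2 U : set vec, open U /\ U z &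
    forall z', dom C z' -> U z' -> X0 z'.
  move=> Xz; have [U Uz [A [oU uA PA]]] := Pl z (X0C _ Xz).
  have [N [oN N0 NU]] := fX0 U z oU Uz Xz.
  have [|D GD AD] := lift_unique gM uB' uA oN N0.
    move=> v /NU[Uv Xv]; apply: orb_trans (PA v (X0C _ Xv) Uv) => //.
    by apply: orb_sym => //; exact: PB.
  exists U => // z' dz' Uz'; apply: (dom_mulE gM GD); rewrite mulmxA -AD.
  exact: dom_orb gM (Pd _ dz') (PA _ dz' Uz').
have [Cu _ CM CV _] := pC; have [_ _ _ MV _] := pM.
have meet E z : grp C E -> X0 z -> X0 (E *m z) -> grp M (invmx B *m E *m B).
  move=> GE Xz XEz; have uE := Cu _ GE.
  have [U [oU Uz] UX] := X0_open _ XEz.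
  have oEU : open [set y | U (E *m y)] by exact: open_mulmx.
  have [N [oN N0 NU]] := fX0 _ z oEU Uz Xz.
  have oN' : open [set y | N (B *m y)] by exact: open_mulmx.
  apply: (discrete_baire pM dM _ oN').
  - by rewrite !unitmx_mul uB' uE uB.
  - by have [v Ov] := N0; exists (invmx B *m v); rewrite /= mulKVmx.
  move=> y /NU[/= UEy XBy]; rewrite -!mulmxA.
  have XEy : X0 (E *m (B *m y)) by apply: UX => //; apply: prC => //; exact: X0C.
  have h := PB _ XBy; rewrite mulKmx// in h.
  apply: orb_trans (orb_sym pM h) _ => //; apply: orb_trans (PB _ XEy) => //.
  by apply: Pe; [exact: X0C|exact: X0C|exact: orb_mul].
have meetX E z : grp C E -> X0 z -> X0 (E *m z) -> forall v, X0 v <-> X0 (E *m v).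
  move=> GE Xz XEz v; have GM := meet E z GE Xz XEz.
  have -> : X0 (E *m v) = dom M ((invmx B *m E *m B) *m (invmx B *m v)).
    by rewrite /X0 /= -!mulmxA mulKVmx.
  by split=> [|/(dom_mulE gM GM)//]; exact: prM.
have cover z : dom C z -> exists2 E, grp C E & X0 (E *m z).
  move=> dz; have dPz := Pd _ dz.
  have [E GE BE] : orb (grp C) z (B *m P z).
    by apply: orb_trans (QP _ dz) _ => //; exact: QB.
  by exists E => //; rewrite -BE /X0 /= mulKmx.
have co_open z : dom C z -> ~ X0 z -> exists2 U : set vec, open U /\ U z &
    forall z', dom C z' -> U z' -> ~ X0 z'.
  move=> dz nXz; have [E GE XEz] := cover z dz.
  have [U [oU Uz] UX] := X0_open _ XEz.
  exists [set v | U (E *m v)]; first by split=> //; exact: open_mulmx.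
  move=> z' dz' Uz' Xz'.
  have XEz' : X0 (E *m z') by apply: UX => //; exact: prC.
  by apply: nXz; exact/(meetX E z' GE Xz' XEz').
pose z0 := B *m y0; have Xz0 : X0 z0 by rewrite /X0 /= mulKmx.
have X0E z : dom C z -> X0 z.
  move=> dz; have [[c c0 zE]|nprop] := pselect (exists2 c : R, c != 0 & z = c *: z0).
    by rewrite zE; exact: X0Z.
  have z00 : z0 != 0 by apply/eqP => e; apply: dC0; rewrite -e; exact: X0C.
  have zn0 : z != 0 by apply/eqP => e; apply: dC0; rewrite -e.
  have ind : indep z0 z.
    move=> a b ab; have [b0|b0] := eqVneq b 0.
      split=> //; move: ab; rewrite b0 scale0r addr0 => /eqP.
      by rewrite scaler_eq0 (negbTE z00) orbF => /eqP.
    exfalso; apply: nprop; exists (- a / b).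
      apply: contraNneq zn0 => /eqP; rewrite mulf_eq0 invr_eq0 (negbTE b0) orbF oppr_eq0.
      move=> /eqP a0; move: ab; rewrite a0 scale0r add0r => /eqP.
      by rewrite scaler_eq0 (negbTE b0).
    apply: (scalerI b0); rewrite scalerA mulrCA divff// mulr1 scaleNr.
    by apply/eqP; rewrite -addr_eq0 addrC; apply/eqP.
  have [conn _] := cC _ _ ind.
  set L := dom C `&` _ in conn.
  have L0 : L z0.
    by split; [exact: X0C|split=> //; exists 1, 0; rewrite scale1r scale0r addr0].
  have Lz : L z.
    by split=> //; split=> //; exists 0, 1; rewrite scale1r scale0r add0r.
  have opX (S : set vec) : (forall z, dom C z -> S z -> exists2 U : set vec, open U /\ U z &
      forall z', dom C z' -> U z' -> S z') -> exists2 O, open O & L `&` S = L `&` O.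
    move=> oS; exists [set v | exists2 U : set vec, open U /\ U v &
      forall z', dom C z' -> U z' -> S z'].
      rewrite openE => v [U [oU Uv] UN].
      have : nbhs v U by exact: open_nbhs_nbhs.
      by apply: filterS => v' Uv'; exists U.
    apply/seteqP; split=> v [Lv Sv]; split=> //; first by apply: oS => //; case: Lv.
    by have [U [_ Uv] US] := Sv; apply: US => //; case: Lv.
  have [] := conn (L `&` X0) (L `&` ~` X0).
  - split; first by apply: opX => v _; exact: X0_open.
    by move=> x y [_ Xx] Ly [c c0 yE]; split=> //; rewrite yE; exact: X0Z.
  - split; first by apply: opX => v; exact: co_open.
    move=> x y [_ Xx] Ly [c c0 yE]; split=> // Xy; apply: Xx.
    have -> : x = c^-1 *: y by rewrite yE scalerA mulVf// scale1r.
    by apply: X0Z => //; rewrite invr_neq0.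
  - by rewrite -setIUr setUv setIT.
  - by rewrite setIACA setICr setI0.
  - by move=> e; have : (L `&` X0) z0 by []; rewrite e.
  - move=> e; apply: contrapT => nXz.
    by have : (L `&` ~` X0) z by []; rewrite e.
exists B; split=> //.
  by move=> y; split=> [/dB//|/X0E]; rewrite /X0 /= mulKmx.
move=> D; split; first exact: (lift_conj nM gC uB Qe QB).
move=> GE; have XE : X0 ((B *m D *m invmx B) *m z0).
  by apply: X0E; apply: prC => //; exact: X0C.
have := meet _ _ GE Xz0 XE.
by rewrite !mulmxA mulVmx// mul1mx -mulmxA mulVmx// mulmx1.
Qed.

End Lifting.

(** * The canonical metric *)

Section Model.
Context {R : realType} {n : nat} (w : 'I_n -> R) (t : nat) (s : R).
Local Notation vec := 'cV[R]_n.+1.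
Local Notation mat := 'M[R]_n.+1.
Implicit Types (p q u v : vec) (i j k : 'I_n) (r : R).
Local Notation VV := (@cusp_chart R n t).
Local Notation hh := (horofun w t).
Local Notation YY := (flat_coord w t).
Local Notation uu := (vertical w t).
Local Notation dev := (developing w t s).
Local Notation gg := (cusp_metric w t s).
Local Notation domM := (cusp_domain w t s).
Context (hw : cusp_weights w t) (n2 : (2 <= n)%N).

Let i0 : 'I_n := Ordinal (ltnW n2).

(* Moves the affine point by r in the first coordinate, against the gradient of
   the horofunction when r > 0. *)
Definition push r p : vec := p + r *: (wo p *: ev i0).

Lemma wo_push r p : wo (push r p) = wo p.
Proof. by rewrite /push woD !woZ wo_ev !mulr0 addr0. Qed.

Lemma aff_push r p : wo p != 0 -> aff (push r p) = upd (aff p) i0 (aff p i0 + r).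
Proof.
move=> w0; have -> : push r p = p - (- r * wo p) *: ev i0.
  by rewrite /push scalerA mulNr scaleNr opprK.
by rewrite aff_sub_ev// mulNr mulNr opprK mulfK.
Qed.

Lemma push_lt r p : VV p -> 0 < r -> VV (push r p) /\ hh (push r p) < hh p.
Proof.
move=> [w0 Vp] r0; rewrite /cusp_chart /horofun /= wo_push aff_push//.
split; first split=> //.
  by apply: posV_upd => // it; rewrite addr_gt0// Vp.
by apply: horo_upd_lt => //; rewrite ltrDl.
Qed.

Lemma pushNK r p : push r (push (- r) p) = p.
Proof. by rewrite {1}/push wo_push /push scaleNr addrNK. Qed.

Lemma cusp_domain_fat : fat domM.
Proof.
move=> U p oU Up [Vp hp]; have [e e0 Ue] := open_line (wo p *: ev i0) oU Up.
have e2 : 0 < e / 2 by rewrite divr_gt0.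
have [Vq hq] := push_lt Vp e2.
have oh : open [set q : vec | VV q /\ hh q < s] by exact: open_horofun_lt.
exists (U `&` [set q | VV q /\ hh q < s]); split; first exact: openI.
  exists (push (e / 2) p); split; last by split=> //; exact: lt_le_trans hq hp.
  by apply: Ue; rewrite gtr0_norm// ltr_pdivrMr// mulr_natr mulr2n ltrDl.
by move=> q [Uq [Vq' /ltW hq']].
Qed.

Lemma bd_cusp_domain p : bd domM p <-> VV p /\ hh p = s.
Proof.
split.
  move=> [[Vp hp] ni]; split=> //; apply/eqP; rewrite eq_le hp /= leNgt.
  apply/negP => lt; apply: ni.
  have oh : open [set q : vec | VV q /\ hh q < s] by exact: open_horofun_lt.
  have : nbhs p [set q : vec | VV q /\ hh q < s] by exact: open_nbhs_nbhs.
  by apply: filterS => q [Vq /ltW].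
move=> [Vp hp]; split; first by split=> //; rewrite hp.
move=> ip; have [e e0 Ue] := open_line (wo p *: ev i0) (open_interior domM) ip.
have e2 : 0 < e / 2 by rewrite divr_gt0.
have /interior_subset[Vq hq] : interior domM (push (- (e / 2)) p).
  by apply: Ue; rewrite normrN gtr0_norm// ltr_pdivrMr// mulr_natr mulr2n ltrDl.
have [_] := push_lt Vq e2; rewrite pushNK hp.
by move/(fun h => lt_le_trans h hq); rewrite ltxx.
Qed.

Lemma cusp_domain_segment : segment_connected_proj domM.
Proof.
have KKP x y : cusp_cone w t s x -> cusp_cone w t s y -> forall r : R, 0 <= r <= 1 ->
    domM ((1 - r) *: x + r *: y).
  move=> Kx Ky r /andP[r0 r1]; have [->|rn0] := eqVneq r 0.
    by rewrite subr0 scale1r scale0r addr0; case: Kx.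
  have [->|rn1] := eqVneq r 1.
    by rewrite subrr scale1r scale0r add0r; case: Ky.
  have r0' : 0 < r by rewrite lt_neqAle eq_sym rn0.
  have r1' : 0 < 1 - r by rewrite subr_gt0 lt_neqAle rn1.
  by have [] := cone_add hw (cone_scale r1' Kx) (cone_scale r0' Ky).
have N x r : (- r) *: x = r *: (- x) by rewrite scaleNr scalerN.
move=> x y /cusp_domain_cases[Kx|Kx] /cusp_domain_cases[Ky|Ky].
- by exists 1 => // r r01; rewrite scale1r; exact: KKP.
- by exists (-1) => [|r r01]; rewrite ?oppr_eq0 ?oner_eq0// scaleN1r; exact: KKP.
- exists (-1) => [|r r01]; first by rewrite oppr_eq0 oner_eq0.
  have := KKP _ _ Kx Ky r r01 => /(@cusp_domain_scale _ _ _ _ _ (-1)).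
  by rewrite oppr_eq0 oner_eq0 => /(_ isT); rewrite !scaleN1r opprD !scalerN opprK.
- exists 1 => // r r01; rewrite scale1r.
  have := KKP _ _ Kx Ky r r01 => /(@cusp_domain_scale _ _ _ _ _ (-1)).
  by rewrite oppr_eq0 oner_eq0 => /(_ isT); rewrite !scaleN1r opprD !scalerN !opprK.
Qed.

Lemma model_nice (Gamma : set mat) : lattice_in (horo_preserving w t) Gamma ->
  nice_domain (ProjQuotient domM Gamma).
Proof.
move=> [pG GG dG _]; split=> //=.
- by split=> //= D x /GG GD dx; exact: (horo_preserving_cusp_domain s GD x).1.
- exact: cusp_domain_fat.
- exact: cusp_domain_segment.
by have [p [_ dp]] := cone_nonempty s hw n2; exists p.
Qed.

Lemma horo_vertical_developing p : cusp_horosphere w t (dev p) <-> hh p = s.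
Proof.
have e : lorentz (dev p) (null_vertical w t) = - horo_scale w t s p.
  by rewrite lorentz_null /null_height developing_null.
split=> [[_]|hp]; last first.
  split; first exact: hyperbolic_developing.
  by rewrite /= e /horo_scale hp subrr expR0.
rewrite /= e => /oppr_inj; rewrite /horo_scale => /(congr1 (@ln R)); rewrite expRK ln1.
by move/eqP; rewrite subr_eq0 => /eqP.
Qed.

(** For t < n the vertical coordinate is free and adjusts the level; for t = n the level is adjusted
    by a common factor. *)
Lemma flat_surjective (y : 'I_n -> R) r : \sum_k y k * uu k = 0 ->
  exists p, [/\ VV p, hh p = r & YY p = y].
Proof.
have [tn w_ge0 w_gt0 w1] := hw => yu.
have sq i : (i < t)%N -> Num.sqrt (w i) != 0.
  by move=> it; rewrite sqrtr_eq0 -ltNge w_gt0.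
have mkP x : posV t x -> [/\ VV (mkv x 1), hh (mkv x 1) = horo w t x &
    forall k, YY (mkv x 1) k = Num.sqrt (w k) * (ln (x k) + (t == n)%:R * horo w t x)
      + (t < k)%:R * x k].
  move=> Vx; rewrite /cusp_chart /flat_coord /horofun /= aff_mkv wo_mkv.
  by split=> //; split=> //; exact: oner_neq0.
have [tln|nt] := ltnP t n.
  pose tt := Ordinal tln.
  pose x i : R := if (i < t)%N then expR (y i / Num.sqrt (w i)) else y i.
  pose x' := upd x tt (horo w t x + x tt - r).
  have Vx : posV t x by move=> i it; rewrite /x it expR_gt0.
  have Vx' : posV t x' by apply: posV_upd => //=; rewrite ltnn.
  have [V h Y] := mkP x' Vx'; exists (mkv x' 1); split=> //.
    by rewrite h /x' horo_upd_lin//; lra.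
  apply/funext => k; rewrite Y (ltn_eqF tln) mul0r addr0 /x' /upd.
  have [->|kt] := eqVneq k tt.
    rewrite /= ltnn mul0r addr0 (sqrt_w0 hw)// mul0r.
    move: yu; rewrite (bigD1 tt)//= big1 => [|j jt]; last first.
      by rewrite /vertical tln (_ : (j == t :> nat) = false) ?mulr0//; apply/negbTE.
    by rewrite /vertical tln eqxx mulr1 addr0.
  rewrite /x; case: ltngtP => [kt'|tk|e]; last by move: kt; rewrite -val_eqE /= e eqxx.
    by rewrite mul0r addr0 expRK mulrC divfK// sq.
  by rewrite (sqrt_w0 hw) ?(ltnW tk)// mul0r add0r mul1r.
have tE : t = n by apply/eqP; rewrite eqn_leq tn.
(* The sum of w_i ln (x_i) is - r, because y is orthogonal to u and the weights sum to 1. *)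
pose x i : R := expR (y i / Num.sqrt (w i) - r).
have Vx : posV t x by move=> i it; rewrite expR_gt0.
have lt i : (i < t)%N by rewrite tE.
have hx : horo w t x = r.
  have -> : horo w t x = - \sum_i w i * ln (x i).
    rewrite /horo [X in _ - X]big_pred0 => [|i]; last by rewrite ltn_eqF.
    rewrite [X in _ + _ * X]big_pred0 => [|i]; last by rewrite ltnNge (ltnW (lt i)).
    by rewrite mulr0 subr0 addr0.
  have -> : \sum_i w i * ln (x i) = \sum_i (y i * uu i - w i * r).
    apply: eq_bigr => i _; rewrite /x expRK /vertical tE ltnn.
    rewrite -{1}(sqr_sqrtr (w_ge0 i)) mulrBr expr2 -mulrA; congr (_ - _).
      by rewrite (mulrC (y i)) mulVKf 1?mulrC// sq.
    by rewrite -expr2 sqr_sqrtr.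
  by rewrite sumrB yu -mulr_suml w1// mul1r; lra.
have [V h Y] := mkP x Vx; exists (mkv x 1); split=> //; first by rewrite h.
apply/funext => k; rewrite Y hx ltnNge (ltnW (lt k)) tE eqxx mul1r /x expRK subrK.
by rewrite mul0r addr0 mulrC divfK// sq.
Qed.

Lemma flat_injective p q : VV p -> VV q -> hh p = hh q -> YY p = YY q -> peq p q.
Proof.
have [tn w_ge0 w_gt0 w1] := hw => -[p0 Vp] [q0 Vq] e eY.
have E k : k != t :> nat -> aff p k = aff q k.
  move=> kt; have := congr1 (@^~ k) eY; rewrite /flat_coord e.
  have [k_lt|k_ge] := ltnP k t.
    rewrite (ltnNge t k) (ltnW k_lt) /= !mul0r !addr0 => /mulfI h.
    have /h/addIr/ln_inj : Num.sqrt (w k) != 0 by rewrite sqrtr_eq0 -ltNge w_gt0.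
    by apply; rewrite posrE; [exact: Vp|exact: Vq].
  by rewrite (sqrt_w0 hw)// !mul0r !add0r ltn_neqAle k_ge eq_sym kt !mul1r.
apply: aff_eq_peq => // k; have [kt|/E//] := eqVneq (k : nat) t.
have qE : aff q = upd (aff p) k (aff q k).
  apply/funext => j; rewrite /upd; case: eqVneq => [->//|jk]; rewrite E//.
  by rewrite -kt.
move: e; rewrite /horofun {1}qE (horo_upd_lin hw)//; lra.
Qed.

Lemma developing_inj p q : VV p -> VV q -> hh p = s -> hh q = s -> dev p = dev q -> peq p q.
Proof.
move=> Vp Vq hp hq e; apply: flat_injective => //; first by rewrite hp.
have aE p' : hh p' = s -> horo_scale w t s p' = 1 by move=> h; rewrite /horo_scale h subrr expR0.
have k1 p' : null_coord w t s p' + horo_scale w t s p' = wo (dev p') by rewrite wo_mkv.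
have ke : null_coord w t s p = null_coord w t s q.
  by apply: (@addIr _ 1); rewrite -{1}(aE p hp) -(aE q hq) !k1 e.
apply/funext => k; have := congr1 (fun v => co v k) e.
by rewrite !co_mkv ke /scaled_coord !aE// !mul1r => /addIr.
Qed.

Lemma developing_onto v : cusp_horosphere w t v -> exists p, [/\ VV p, hh p = s & dev p = v].
Proof.
move=> [[lv v0]]; rewrite /= lorentz_null => /oppr_inj; rewrite /null_height => av.
(* On the horosphere a = 1, so k = wo v - 1 and the flat coordinates are what remains of [co v]
   after removing k u. *)
pose y k : R := co v k - (wo v - 1) * uu k.
have uE : \sum_k uu k * uu k = 1 by rewrite -(vertical_norm hw n2).
have yu : \sum_k y k * uu k = 0.
  have -> : \sum_k y k * uu k = \sum_k (co v k * uu k - (wo v - 1) * (uu k * uu k)).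
    by apply: eq_bigr => k _; rewrite /y; ring.
  by rewrite sumrB -mulr_sumr uE; lra.
have yy : \sum_k y k ^+ 2 = wo v *+ 2 - 2.
  have -> : \sum_k y k ^+ 2 = \sum_k (co v k * co v k -
      ((wo v - 1) *+ 2 * (co v k * uu k) - (wo v - 1) ^+ 2 * (uu k * uu k))).
    by apply: eq_bigr => k _; rewrite /y; ring.
  rewrite !sumrB -!mulr_sumr uE; move: lv; rewrite lorentzE => lv.
  have -> : \sum_i co v i * co v i = wo v * wo v - 1 by lra.
  have -> : \sum_i co v i * uu i = wo v - 1 by lra.
  by ring.
have [p [Vp hp Yp]] := flat_surjective s yu; exists p; split=> //.
have a1 : horo_scale w t s p = 1 by rewrite /horo_scale hp subrr expR0.
have QE k : scaled_coord w t s p k = y k by rewrite /scaled_coord a1 mul1r Yp.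
have kE : null_coord w t s p = wo v - 1.
  rewrite /null_coord a1 invr1 mul1r (eq_bigr (fun k => y k ^+ 2)) => [|k _]; last by rewrite QE.
  by rewrite yy; lra.
apply: vec_ext => [k|]; rewrite ?co_mkv ?wo_mkv kE; last by rewrite a1; lra.
by rewrite QE /y; lra.
Qed.

(** For positive type every automorphism of the domain preserves h. In type 0 the domain also has
    automorphisms dilating h - s, and these are excluded by the lattice. *)
Lemma model_aut (Gamma : set mat) A : lattice_in (horo_preserving w t) Gamma ->
  let M := ProjQuotient domM Gamma in iso A M M ->
  forall p u v, VV p -> gg (A *m p) (A *m u) (A *m v) = gg p u v.
Proof.
move=> lG M [uA dA GA] p u v Vp; apply: cusp_metric_aut => // {Vp u v}p Vp.
have [a a0 [a1 hA]] := aut_horofun_scale hw n2 uA dA.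
have [t0|t0] := posnP t; last first.
  by have [_] := hA p Vp; rewrite a1// mul1r => /addIr.
move: hw lG dA GA p Vp; rewrite /M t0 => hw0 lG0 dA GA.
exact: (lattice_aut_horofun hw0 n2 lG0 uA dA GA).
Qed.

End Model.

(** * Isomorphisms of quotients *)

Section Isomorphisms.
Context {R : realType} {n : nat}.
Local Notation vec := 'cV[R]_n.+1.
Local Notation mat := 'M[R]_n.+1.
Local Notation quo := (proj_quotient R n).
Implicit Types (x y z : vec) (A B D : mat) (C : quo).

Lemma iso_comp A B C1 C2 C3 : iso A C1 C2 -> iso B C2 C3 -> iso (B *m A) C1 C3.
Proof.
move=> [uA dA GA] [uB dB GB]; split; first by rewrite unitmx_mul uB.
  by move=> x; rewrite -mulmxA; exact: iff_trans (dA x) (dB _).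
move=> D; apply: iff_trans (GA D) _; apply: iff_trans (GB _) _.
suff -> : B *m (A *m D *m invmx A) *m invmx B = B *m A *m D *m invmx (B *m A) by [].
by rewrite (invrM uB uA : invmx (B *m A) = invmx A *m invmx B) !mulmxA.
Qed.

Lemma iso_inv A C C' : iso A C C' -> iso (invmx A) C' C.
Proof.
move=> [uA dA GA]; split; first by rewrite unitmx_inv.
  by move=> x; have := dA (invmx A *m x); rewrite mulKVmx// => h; exact: iff_sym.
move=> D; have := GA (invmx A *m D *m A).
have -> : A *m (invmx A *m D *m A) *m invmx A = D.
  by rewrite -!mulmxA mulmxV// mulmx1 mulKVmx.
by rewrite invmxK => h; exact: iff_sym.
Qed.

Lemma iso_nice A C C' : iso A C C' -> nice_domain C -> group_domain C' -> nice_domain C'.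
Proof.
move=> [uA dA _] [_ fC sC [x0 dx0]] gC'.
have dV y : dom C' y -> dom C (invmx A *m y) by move=> dy; apply/dA; rewrite mulKVmx.
split=> //; last by exists (A *m x0); exact: (dA x0).1.
- move=> U y oU Uy dy.
  have oAU : open [set x | U (A *m x)] by exact: open_mulmx.
  have [|N [oN [z Nz] NU]] := fC _ (invmx A *m y) oAU _ (dV y dy).
    by rewrite /= mulKVmx.
  exists [set v | N (invmx A *m v)]; split; first exact: open_mulmx.
    by exists (A *m z); rewrite /= mulKmx.
  by move=> v /= /NU[/= Uv /dA]; rewrite mulKVmx// in Uv *.
move=> x y dx dy; have [c c0 seg] := sC _ _ (dV x dx) (dV y dy).
exists c => // r r01; have /dA := seg r r01.
by rewrite mulmxDr -!scalemxAr !mulKVmx.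
Qed.

Lemma bd_iso A C C' x : iso A C C' -> bd (dom C) x <-> bd (dom C') (A *m x).
Proof.
move=> [uA dA _]; have h := interior_mulmx (dom C') x uA.
have dE : dom C = [set y | dom C' (A *m y)].
  by apply/seteqP; split=> y /= /dA.
rewrite /bd dE; split=> -[d ni]; split=> // i; apply: ni; exact/h.
Qed.

End Isomorphisms.

(** * Transport of the model metric to a cusp *)

Section ModelMetric.
Context {R : realType} {n : nat} (w : 'I_n -> R) (t : nat) (s : R).
Local Notation vec := 'cV[R]_n.+1.
Local Notation mat := 'M[R]_n.+1.
Local Notation quo := (proj_quotient R n).
Implicit Types (x y u v : vec) (A D : mat).
Local Notation VV := (@cusp_chart R n t).
Local Notation hh := (horofun w t).
Local Notation dev := (developing w t s).
Local Notation gg := (cusp_metric w t s).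
Local Notation domM := (cusp_domain w t s).
Context (hw : cusp_weights w t) (n2 : (2 <= n)%N).
Context (Gamma : set mat) (lG : lattice_in (horo_preserving w t) Gamma).
Local Notation M := (ProjQuotient domM Gamma).
Context (C : quo) (B : mat) (iB : iso B M C).

Let uB : B \in unitmx. Proof. by case: iB. Qed.

Local Notation Bi := (invmx B).

Let domC x : dom C x -> domM (Bi *m x).
Proof. by have [_ dB _] := iB; move=> dx; apply/dB; rewrite mulKVmx. Qed.

Let UU : set vec := [set x | VV (Bi *m x)].

Let oU : open UU. Proof. by apply: open_mulmx; exact: open_chart. Qed.

Let domU x : dom C x -> UU x. Proof. by case/domC. Qed.

Definition pull_metric x u v : R := gg (Bi *m x) (Bi *m u) (Bi *m v).
Definition pull_developing x : vec := dev (Bi *m x).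

Lemma pull_developing_smooth : smooth_open UU pull_developing.
Proof.
split=> // k; apply: (@Ck_on_comp_linear _ _ _ _ _ VV _ (mulmx Bi)) => //.
  exact: mulmx_continuous.
exact: developing_smooth.
Qed.

Lemma derive_pull_developing x u : UU x -> 'D_u pull_developing x = 'D_(Bi *m u) dev (Bi *m x).
Proof.
move=> Ux; apply: (@derive_comp_linear _ _ _ _ (mulmx Bi)).
  exact: mulmx_continuous.
exact: developing_diff.
Qed.

Lemma pull_developing_isometric : isometric_on (dom C) pull_metric pull_developing.
Proof.
split.
- by move=> x _; exact: hyperbolic_developing.
- move=> x y _ _ [c c0 ->]; rewrite /pull_developing -scalemxAr developing_scale//.
move=> x dx; exists UU, pull_developing; split.
- exact: domU.
- exact: pull_developing_smooth.
- by move=> y _ _.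
- by move=> y dy Uy u v; rewrite !derive_pull_developing.
Qed.

Let conj_group A : grp C A -> horo_preserving w t (Bi *m A *m B).
Proof.
have [_ _ GB] := iB; have [_ GG _ _] := lG => GA; apply: GG.
apply/(GB (Bi *m A *m B)).
by rewrite -!mulmxA mulmxV// mulmx1 mulKVmx.
Qed.

Let conj_mul A x : Bi *m (A *m x) = (Bi *m A *m B) *m (Bi *m x).
Proof. by rewrite -!mulmxA mulKVmx. Qed.

Lemma pull_riemannian : riemannian_metric C pull_metric.
Proof.
split.
- by move=> x _ u v; exact: cusp_metricC.
- move=> x /domC[Vx _] a u v y; rewrite /pull_metric mulmxDr -scalemxAr.
  exact: cusp_metric_linear.
- move=> x /domC[Vx _]; split=> u; first exact: cusp_metric_radial.
  move=> ux; apply: cusp_metric_gt0 => // c; apply: contra (ux c) => /eqP e.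
  by apply/eqP; rewrite -[u](mulKVmx uB) e -scalemxAr mulKVmx.
- move=> A x u v /conj_group gA /domC[Vx _]; rewrite /pull_metric !conj_mul.
  apply: cusp_metric_aut => //; first by case: gA.
    exact: horo_preserving_cusp_domain.
  by have [_ h] := gA; move=> p; case: (h p).
move=> u v x dx; exists UU, (fun y => pull_metric y u v : R^o); split=> //.
  exact: domU.
split=> // k.
apply: (@Ck_on_comp_linear _ _ _ _ _ VV _ (mulmx Bi)
  (fun p => gg p (Bi *m u) (Bi *m v) : R^o)) => //.
  exact: mulmx_continuous.
exact: cusp_metric_smooth.
Qed.

Lemma pull_hyperbolic : hyperbolic_metric C pull_metric.
Proof.
split; first exact: pull_riemannian.
move=> x dx; exists setT; first by split=> //; exact: openT.
by exists pull_developing; rewrite setIT; exact: pull_developing_isometric.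
Qed.

Lemma pull_boundary : boundary_horosphere_quotient C pull_metric.
Proof.
have bdP x : bd (dom C) x <-> VV (Bi *m x) /\ hh (Bi *m x) = s.
  by apply: iff_trans (bd_iso _ (iso_inv iB)) _; exact: bd_cusp_domain.
exists pull_developing, (cusp_horosphere w t); split.
- exact: pull_developing_isometric.
- exact: horosphere_vertical.
- apply/seteqP; split=> [v [x /bdP[_ hx] <-]|v]; first exact/horo_vertical_developing.
  move=> /(developing_onto s hw n2)[p [Vp hp <-]]; exists (B *m p);
    last by rewrite /pull_developing mulKmx.
  by apply/bdP; rewrite mulKmx.
- move=> x y /bdP[Vx hx] /bdP[Vy hy] /(developing_inj hw Vx Vy hx hy)[c c0 e].
  by exists c => //; rewrite -[y](mulKVmx uB) e -scalemxAr mulKVmx.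
move=> A /conj_group gA.
have [|//||E [lE pE dE]] := aut_isometry hw n2 (s := s) (A := Bi *m A *m B).
- by case: gA.
- exact: horo_preserving_cusp_domain.
- by have [_ h] := gA; move=> p; case: (h p).
exists E; split=> // x /domC[Vx _].
by rewrite /pull_developing conj_mul; have [_] := dE _ Vx.
Qed.

End ModelMetric.

(** * From psi to weights *)

Section WeightsOfPsi.
Context {R : realType} {n : nat} (psi : 'rV[R]_n).
Local Notation vec := 'cV[R]_n.+1.
Implicit Types (p q v : vec) (i j k : 'I_n).
Local Notation t := (cusp_type psi).

Definition psi_weight i : R :=
  (if (t < n)%N then 1 else (\sum_(k < n) psi 0 k)^-1) * psi 0 i.

Local Notation w := psi_weight.
Local Notation hh := (horofun w t).
Local Notation VV := (@cusp_chart R n t).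

Context (hA : in_A psi) (n2 : (2 <= n)%N).

(** By monotonicity the positive entries form an initial segment, whose length is their number. *)
Lemma psi_gt0 i : (0 < psi 0 i) = (i < t)%N.
Proof.
have [psi0 mono] := hA.
have card_lt (m : nat) : (m <= n)%N -> #|[set j : 'I_n | (j < m)%N]%SET| = m.
  move=> mn; rewrite -sum1_card (eq_bigl (fun j : 'I_n => (j < m)%N)) => [|j].
    by rewrite -(big_ord_widen n (fun=> 1%N) mn) sum1_card card_ord.
  by rewrite inE.
apply/idP/idP => [i0|].
  rewrite -[X in (X <= _)%N](card_lt i.+1)//; apply: subset_leq_card.
  by apply/fintype.subsetP => j; rewrite !inE ltnS => /mono; exact: lt_le_trans.
apply: contraTT => i0; rewrite -leqNgt -[X in (_ <= X)%N](card_lt i (ltnW (ltn_ord i))).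
apply: subset_leq_card; apply/fintype.subsetP => j; rewrite !inE => j0.
by rewrite ltnNge; apply: contra i0 => /mono; exact: lt_le_trans.
Qed.

Lemma psi_cusp_weights : cusp_weights w t.
Proof.
have [psi0 mono] := hA.
have tn : (t <= n)%N by rewrite -[X in (_ <= X)%N]card_ord; exact: max_card.
have S0 : t = n -> 0 < \sum_(k < n) psi 0 k.
  move=> tE; pose i0 : 'I_n := Ordinal (ltnW n2).
  rewrite (bigD1 i0)//=; apply: ltr_pwDl; last by apply: sumr_ge0.
  by rewrite psi_gt0 tE ltn_ord.
have c0 : 0 < (if (t < n)%N then 1 else (\sum_(k < n) psi 0 k)^-1).
  by case: ltnP => // nt; rewrite invr_gt0 S0//; apply/eqP; rewrite eqn_leq tn.
split=> //.
- by move=> i; rewrite /psi_weight mulr_ge0// ltW.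
- by move=> i; rewrite /psi_weight pmulr_rgt0// psi_gt0.
move=> tE; rewrite /psi_weight tE ltnn -mulr_sumr mulVf//.
by rewrite gt_eqF// S0.
Qed.

Lemma affineE (x : 'cV[R]_n) : affine x = mkv (fun i => x i 0) 1.
Proof. by []. Qed.

Lemma h_horo (x : 'cV[R]_n) : h_ psi x = horo w t (fun i => x i 0).
Proof.
have [tn _ _ _] := psi_cusp_weights.
rewrite /h_ /horo /psi_weight; case: ltnP => [tln|nt].
  have -> : \sum_(i < n | (i < t)%N) psi 0 i * ln (x i 0) =
      \sum_(i < n) 1 * psi 0 i * ln (x i 0).
    rewrite big_mkcond; apply: eq_bigr => i _; rewrite mul1r -psi_gt0.
    case: ifPn => // i0; suff -> : psi 0 i = 0 by rewrite mul0r.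
    by apply/eqP; rewrite eq_le leNgt i0; have [/(_ i)] := hA.
  by rewrite [X in X + _]addrC.
have lt i : (i < t)%N := leq_trans (ltn_ord i) nt.
rewrite [X in _ - X + _]big_pred0 => [|i]; last by rewrite ltn_eqF.
rewrite [X in _ = _ + _ * X]big_pred0 => [|i]; last by rewrite ltnNge (ltnW (lt i)).
rewrite mulr0 subr0 addr0 mulNr mulr_sumr.
by congr (- _); apply: eq_bigr => i _; rewrite mulrA.
Qed.

Lemma to_projP (X : set 'cV[R]_n) p :
  to_proj X p <-> wo p != 0 /\ X (\col_i aff p i).
Proof.
split.
  move=> [x Xx [c c0 ->]]; rewrite affineE.
  have -> : wo (c *: mkv (fun i => x i 0) 1 : vec) = c by rewrite woZ wo_mkv mulr1.
  split=> //; rewrite aff_scale// aff_mkv.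
  by rewrite (_ : \col_i _ = x)//; apply/colP => i; rewrite mxE.
move=> [p0 Xp]; exists (\col_i aff p i) => //; exists (wo p) => //.
apply: vec_ext => [i|]; rewrite affineE ?coZ ?woZ ?co_mkv ?wo_mkv ?mulr1//.
by rewrite mxE mulrC divfK.
Qed.

Lemma V_posV p : V_ psi (\col_i aff p i) <-> posV t (aff p).
Proof. by split=> h i /h; rewrite mxE. Qed.

Lemma h_horofun p : h_ psi (\col_i aff p i) = hh p.
Proof. by rewrite h_horo /horofun; congr (horo _ _ _); apply/funext => i; rewrite mxE. Qed.

Lemma horosphere_psiE (s : R) p : horosphere_psi psi s p <-> VV p /\ hh p = s.
Proof.
apply: iff_trans (to_projP _ _) _; rewrite /cusp_chart /= h_horofun.
by split=> [[p0 [/V_posV Vp hp]]|[[p0 /V_posV Vp] hp]].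
Qed.

Lemma sublevel_psiE (s : R) : sublevel_psi psi s = cusp_domain w t s.
Proof.
apply/seteqP; split=> p; rewrite /cusp_domain /cusp_chart /=.
  by move=> /to_projP[p0 [/V_posV Vp]]; rewrite h_horofun.
move=> [[p0 /V_posV Vp] hp]; apply/to_projP; split=> //; split=> //.
by rewrite h_horofun.
Qed.

Lemma G_psiE : G_ psi = horo_preserving w t.
Proof.
apply/seteqP; split=> A [uA pA]; split=> //.
  move=> p; have inv q : VV (A *m q) -> VV q /\ hh (A *m q) = hh q.
    move=> VA; have : horosphere_psi psi (hh (A *m q)) (A *m q) by apply/horosphere_psiE.
    rewrite -(pA (hh (A *m q))) => -[q' /horosphere_psiE[Vq' e]] /(congr1 (mulmx (invmx A))).
    by rewrite !mulKmx// -e => <-.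
  have dir : VV p -> VV (A *m p).
    move=> Vp; suff /horosphere_psiE[] : horosphere_psi psi (hh p) (A *m p) by [].
    by rewrite -(pA (hh p)); exists p => //; exact/horosphere_psiE.
  split; first by split=> [/dir//|/inv[]].
  by move=> /dir /inv[].
move=> s; apply: preserves_unit => // p; split=> /horosphere_psiE[Vp hp].
  apply/horosphere_psiE; have [VE hE] := pA p.
  by split; [exact/VE|rewrite hE].
have [VE hE] := pA p; have Vp' : VV p by exact/VE.
by apply/horosphere_psiE; rewrite -hE.
Qed.

End WeightsOfPsi.

(** * Choice of a model for each isomorphism class *)

Section Models.
Context {R : realType} {n : nat}.
Local Notation mat := 'M[R]_n.+1.
Local Notation quo := (proj_quotient R n).
Implicit Types (C : quo).

Record model_data := ModelData {
  mod_weights : 'I_n -> R; mod_type : nat; mod_level : R; mod_group : set mat }.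

Definition model (m : model_data) : quo :=
  ProjQuotient (cusp_domain (mod_weights m) (mod_type m) (mod_level m)) (mod_group m).

Definition models C : set model_data :=
  [set m | [/\ cusp_weights (mod_weights m) (mod_type m),
     lattice_in (horo_preserving (mod_weights m) (mod_type m)) (mod_group m)
   & exists B, iso B (model m) C]].

Lemma models_iso C C' A : iso A C C' -> models C = models C'.
Proof.
move=> iA; apply/seteqP; split=> m [hw lG [B iB]]; split=> //.
  by exists (A *m B); exact: iso_comp iB iA.
by exists (invmx A *m B); exact: iso_comp iB (iso_inv iA).
Qed.

Lemma cusp_group_domain C : generalized_cusp C -> group_domain C.
Proof.
move=> [_ [pG dG _ pr] _ _ _]; split=> // D x GD dx.
by rewrite -(pr D GD); exists x.
Qed.

Lemma models_cusp C : (2 <= n)%N -> generalized_cusp C -> boundary_horomanifold C ->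
  models C !=set0.
Proof.
move=> n2 gC [psi [s [Gamma [hA lG _ [P dP]]]]].
have hw := psi_cusp_weights hA n2.
rewrite sublevel_psiE// in dP; rewrite G_psiE// in lG.
exists (ModelData (psi_weight psi) (cusp_type psi) s Gamma); split=> //.
apply: cusp_iso dP; first exact: cusp_group_domain.
  by case: gC.
exact: model_nice.
Qed.

End Models.

Theorem theorem3p19 (R : realType) (n : nat) (hn : (2 <= n)%N) :
  exists kappa : proj_quotient R n ->
      'cV[R]_n.+1 -> 'cV[R]_n.+1 -> 'cV[R]_n.+1 -> R,
    (forall C : proj_quotient R n,
        generalized_cusp C -> boundary_horomanifold C ->
        hyperbolic_metric C (kappa C) /\
        boundary_horosphere_quotient C (kappa C)) /\
    (forall (C C' : proj_quotient R n) (P : 'cV[R]_n.+1 -> 'cV[R]_n.+1),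
        generalized_cusp C -> boundary_horomanifold C ->
        generalized_cusp C' -> boundary_horomanifold C' ->
        projective_diffeo C C' P ->
        projective_isometry C C' (kappa C) (kappa C') P).
Proof.
(* Default data for an empty set of models. *)
have m0 : @model_data R n := ModelData (fun=> 0) 0 0 setT.
have [|ch chP] := @choice _ model_data (fun (X : set (@model_data R n)) m => X !=set0 -> X m).
  by move=> X; have [[m Xm]|nX] := pselect (X !=set0); [exists m|exists m0].
have [|b bP] := @choice _ 'M[R]_n.+1
    (fun C B => models C !=set0 -> iso B (model (ch (models C))) C).
  move=> C; have [/chP[_ _ [B iB]]|nX] := pselect (models C !=set0).
    by exists B.
  by exists 1%:M.
exists (fun C => let m := ch (models C) in
  pull_metric (mod_weights m) (mod_type m) (mod_level m) (b C)).
split=> [C gC bC|C C' P gC bC gC' bC' dP U A LA x dx Ux u v] /=.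
  have mC := models_cusp hn gC bC; have [hw lG _] := chP _ mC; have iB := bP C mC.
  by split; [exact: (pull_hyperbolic hw hn lG iB)|exact: (pull_boundary hw hn lG iB)].
have mC := models_cusp hn gC bC; have [hw lG _] := chP _ mC; have iB := bP C mC.
have mC' := models_cusp hn gC' bC'; have [hw' lG' _] := chP _ mC'; have iB' := bP C' mC'.
have iA : iso A C C'.
  apply: diffeo_iso dP LA Ux dx.
    exact: iso_nice iB (model_nice _ hw hn lG) (cusp_group_domain gC).
  exact: iso_nice iB' (model_nice _ hw' hn lG') (cusp_group_domain gC').
have eM := models_iso iA; rewrite -eM in iB' *.
(* The lift of P, read in the common model of C and C', is an automorphism of this model. *)
have iT := iso_comp (iso_comp iB iA) (iso_inv iB').
have [uB dB _] := iB.
have V : cusp_chart (mod_type (ch (models C))) (invmx (b C) *m x).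
  by suff [] : dom (model (ch (models C))) (invmx (b C) *m x) by []; apply/dB; rewrite mulKVmx.
have := model_aut hw hn lG iT (invmx (b C) *m u) (invmx (b C) *m v) V.
by rewrite /pull_metric -!mulmxA !mulKVmx.
Qed.
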